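(* Let $\alpha\in\mathbb C$ be generic, i.e. $\frac{\alpha\ln q}{2\pi i}\notin\mathbb Q$. There exists a unique Poisson bracket on $\widehat G_\alpha$ of the form $$\{\varphi,\psi\}=\left\langle\left\langle\begin{pmatrix} r+aP_0 & bP_0\\ cP_0 & r+dP_0\end{pmatrix}\begin{pmatrix}\overline{\nabla\varphi}\\ \overline{\nabla'\varphi}\end{pmatrix},\begin{pmatrix}\overline{\nabla\psi}\\ \overline{\nabla'\psi}\end{pmatrix}\right\rangle\right\rangle,\qquad r=\tfrac12(P_+-P_-),\qquad( * )$$ where $a,b,c,d$ are linear operators in $J_0$ with $a=-a^*$, $d=-d^*$, $c^*=b$, which satisfies the following conditions: 1) the expression $( * )$ is well-defined, i.e. it does not depend on the $J_{(-)}$-components of $\overline{d\varphi},\overline{d\psi}$; 2) the Hamiltonians $H_m=\frac\alpha m\operatorname{Tr}L^{m/\alpha}$, $m\in\mathbb N$, give rise to the Lax equations $\frac{dL}{dt}=\left[(L^{m/\alpha})_{(+)},L\right]$, $L\in\widehat G_\alpha$. This bracket is given by $$\{\varphi,\psi\}=\left\langle\left\langle\begin{pmatrix} r+\frac12\frac{1+\hat h^\alpha}{1-\hat h^\alpha}P_0' & -\frac{\hat h^\alpha}{1-\hat h^\alpha}P_0'+\frac12P_{00}\\[4pt] \frac{1}{1-\hat h^\alpha}P_0'+\frac12P_{00} & r-\frac12\frac{1+\hat h^\alpha}{1-\hat h^\alpha}P_0'\end{pmatrix}\begin{pmatrix}\overline{\nabla\varphi}\\ \overline{\nabla'\varphi}\end{pmatrix},\begin{pmatrix}\overline{\nabla\psi}\\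 \overline{\nabla'\psi}\end{pmatrix}\right\rangle\right\rangle .$$
   Context: Fix $q\in\mathbb C$, $0<|q|<1$, with $\ln q$ chosen by $-\pi<\arg q<\pi$, $\ln1=0$; $q^\alpha=e^{\alpha\ln q}$. $\mathbb C((z^{-1}))$ is the field of formal series $\sum_{i\le N}a_iz^i$; $(\hat h^\alpha f)(z)=f(q^\alpha z)$. $\Psi\mathbf D_q$ is the algebra of formal series $A=\sum_{i=-\infty}^{N}a_iD^i$, $a_i\in\mathbb C((z^{-1}))$, $D a=(\hat ha)D$. $J_+,J_0,J_-$ are the subspaces of series with only positive, zero, negative powers of $D$ ($J_0=\mathbb C((z^{-1}))$); $J_{(-)}=J_-+J_0$; $P_+,P_0,P_-$ are the corresponding projections; $A_{(+)}=(P_++P_0)A$. $\int a\,dz/z$ is the coefficient of $z^0$; $\operatorname{Tr}A=\int P_0A\,dz/z$; $\langle A,B\rangle=\operatorname{Tr}AB$; adjoints in $J_0$ are with respect to $\int fg\,dz/z$; $P_{00}A=\operatorname{Tr}(A)\cdot1$, $P_0'=P_0-P_{00}$; $\langle\langle(X_1,X_2),(Y_1,Y_2)\rangle\rangle=\langle X_1,Y_1\rangle-\langle X_2,Y_2\rangle$. $\widehat G_\alpha$ is the set of formal series $L=D^\alpha+\sum_{i\ge1}a_iD^{\alpha-i}$, $a_i\in\mathbb C((z^{-1}))$; symbols are multiplied by $D^\alpha\circ a=(\hat h^\alpha a)\circ D^\alpha$. Write $L=\overline L D^\alpha$ with $\overline L\in\widehat G_0$, and $\sigma_\beta(X)=D^\beta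 XD^{-\beta}$. Tangent vectors to $\widehat G_\alpha$ at $L$ are $\overline XD^\alpha$, $\overline X\in J_-$. For a smooth functional $\varphi$ on $\widehat G_\alpha$, $\overline{d\varphi}(L)\in\Psi\mathbf D_q$ satisfies $\langle\overline X,\overline{d\varphi}\rangle=\frac{d}{dt}|_{t=0}\varphi(L+t\overline XD^\alpha)$ for all $\overline X\in J_-$; it is defined up to an arbitrary element of $J_{(-)}$. Put $\overline{\nabla\varphi}=\overline L\,\overline{d\varphi}$ and $\overline{\nabla'\varphi}=\sigma_{-\alpha}(\overline{d\varphi}\,\overline L)$. Complex powers: for $X\in J_-$ let $\exp t(X+\ln D)=A(t)D^t$, where $A(t)\in\widehat G_0$ is the unique solution of $\frac{dA}{dt}=A\,\sigma_t(X)$, $A(0)=1$. For generic $\alpha$ every $L\in\widehat G_\alpha$ is uniquely $L=\exp\alpha(X+\ln D)$, $X\in J_-$, and $L^\beta:=\exp\alpha\beta(X+\ln D)\in\widehat G_{\alpha\beta}$; thus $L^{m/\alpha}\in\widehat G_m\subset\Psi\mathbf D_q$ for $m\in\mathbb N$. The equation generated by a Hamiltonian $H$ is the one for which $\frac d{dt}\psi(L)=\{H,\psi\}(L)$ for all $\psi$. *)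

(* Defs.v *)
From HB Require Import structures.
From mathcomp Require Import all_boot all_order all_algebra.
From mathcomp Require Import all_classical all_reals all_analysis.
From mathcomp Require Import complex.

Set Implicit Arguments.
Unset Strict Implicit.
Unset Printing Implicit Defensive.

Import Order.TTheory GRing.Theory Num.Theory.
Import numFieldNormedType.Exports.

Local Open Scope classical_set_scope.
Local Open Scope ring_scope.

(* R[i] itself has no topology in the libraries; seen as the carrier of an
   abstract numClosedFieldType it gets the canonical, normed, one. *)
Definition CC (R : realType) : numClosedFieldType := complex R.

Definition cexp (R : realType) (z : CC R) : CC R :=
  Complex (expR (complex.Re z) * cos (complex.Im z))
          (expR (complex.Re z) * sin (complex.Im z)).

Definition is_ln (R : realType) (q lnq : CC R) : Prop :=
  cexp lnq = q /\ - pi < complex.Im lnq < pi.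

Definition generic (R : realType) (lnq alpha : CC R) : Prop :=
  forall r : rat, alpha * lnq / (Complex 0 (2 * pi) : CC R) != ratr r.

(* Formal series \sum_(n <= N) v_n T^n with coefficients in V. They are used
   twice: V = C with T = z gives C((z^-1)), and then V = C((z^-1)) with T = D
   gives the space underlying the algebra of q-pseudodifference symbols. *)

Section Series.
Variables (K : pzRingType) (V : lmodType K).

Definition ubounded : {pred int -> V} :=
  fun f => `[< exists N : int, forall n : int, N < n -> f n = 0 >].

Lemma uboundedP (f : int -> V) :
  reflect (exists N : int, forall n : int, N < n -> f n = 0) (f \in ubounded).
Proof. exact: asboolP. Qed.

Lemma ubounded_submod : submod_closed ubounded.
Proof.
split; first by apply/uboundedP; exists 0.
move=> c f g /uboundedP[N hN] /uboundedP[M hM]; apply/uboundedP.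
exists (Num.max N M) => n; rewrite gt_max => /andP[hn1 hn2].
change (c *: f n + g n = 0).
by rewrite hN // hM // scaler0 addr0.
Qed.

HB.instance Definition _ :=
  GRing.isSubmodClosed.Build K (int -> V) ubounded ubounded_submod.

Record series := Series { coefs :> int -> V; _ : coefs \in ubounded }.

HB.instance Definition _ := [isSub for coefs].
HB.instance Definition _ := [Choice of series by <:].
HB.instance Definition _ := [SubChoice_isSubLmodule of series by <:].

Lemma series_ub (f : series) : exists N : int, forall n : int, N < n -> f n = 0.
Proof. by case: f => f /= /uboundedP. Qed.

Lemma ubounded_restr (P : pred int) (f : series) :
  (fun n => if P n then f n else 0) \in ubounded.
Proof.
have [N hN] := series_ub f; apply/uboundedP; exists N => n hn.
by rewrite hN // if_same.
Qed.

Definition restr (P : pred int) (f : series) : series :=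
  Series (ubounded_restr P f).

Lemma ubounded_monom (m : int) (v : V) :
  (fun n => if n == m then v else 0) \in ubounded.
Proof. by apply/uboundedP; exists m => n hn; rewrite gt_eqF. Qed.

Definition monom (m : int) (v : V) : series := Series (ubounded_monom m v).

End Series.

Section Symbols.
Variables (R : realType) (lnq : CC R).
Local Notation C := (CC R).

Definition J0 := series (C : lmodType C).
Definition PsiD := series (J0 : lmodType C).

Definition qpow (a : C) : C := cexp (a * lnq).

Lemma ubounded_mulJ (f g : J0) :
  (fun n : int => \sum_(i \in [set: int]) (f i * g (n - i) : C))
    \in @ubounded C (C : lmodType C).
Proof.
have [N hN] := series_ub f; have [M hM] := series_ub g.
apply/uboundedP; exists (N + M) => n hn; apply: fsbig1 => i _.
have [/hN -> | hi] := ltP N i; first by rewrite mul0r.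
by rewrite hM ?mulr0 // ltrBrDl (le_lt_trans _ hn) // lerD2r.
Qed.

Definition mulJ (f g : J0) : J0 := Series (ubounded_mulJ f g).

Definition oneJ : J0 := monom 0 (1 : C).

(* int_ f stands for \int f dz/z. *)
Definition int_ (f : J0) : C := f 0.

Lemma ubounded_diag (u : int -> C) (f : J0) :
  (fun k : int => u k * f k : C) \in @ubounded C (C : lmodType C).
Proof.
have [N hN] := series_ub f; apply/uboundedP; exists N => n hn.
by rewrite hN // mulr0.
Qed.

Definition diag (u : int -> C) (f : J0) : J0 := Series (ubounded_diag u f).

(* F(\hat h^a), where \hat h^a z^k = q^(a k) z^k. *)
Definition hcalc (F : C -> C) (a : C) : J0 -> J0 := diag (fun k => F (qpow a ^ k)).

Definition hhat (a : C) : J0 -> J0 := hcalc id a.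

Lemma hhat0 (a : C) : hhat a 0 = 0.
Proof. by apply: val_inj; apply: funext => k; rewrite /= mulr0. Qed.

Lemma mulJ0l (g : J0) : mulJ 0 g = 0.
Proof.
apply: val_inj; apply: funext => k /=.
by apply: fsbig1 => i _; rewrite mul0r.
Qed.

Lemma mulJ0r (f : J0) : mulJ f 0 = 0.
Proof.
apply: val_inj; apply: funext => k /=.
by apply: fsbig1 => i _; rewrite mulr0.
Qed.

(* (a D^i) (b D^j) = a (\hat h^i b) D^(i + j) *)
Lemma ubounded_mulD (A B : PsiD) :
  (fun n : int =>
     \sum_(i \in [set: int]) mulJ (A i) (hhat i%:~R (B (n - i))))
    \in @ubounded C (J0 : lmodType C).
Proof.
have [N hN] := series_ub A; have [M hM] := series_ub B.
apply/uboundedP; exists (N + M) => n hn; apply: fsbig1 => i _.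
have [/hN -> | hi] := ltP N i; first by rewrite mulJ0l.
rewrite hM ?hhat0 ?mulJ0r // ltrBrDl (le_lt_trans _ hn) // lerD2r //.
Qed.

Definition mulD (A B : PsiD) : PsiD := Series (ubounded_mulD A B).

Definition ofJ0 (f : J0) : PsiD := monom 0 f.
Definition oneD : PsiD := ofJ0 oneJ.
Definition Dpow (m : int) : PsiD := monom m oneJ.

Lemma ubounded_sigma (b : C) (A : PsiD) :
  (fun n : int => hhat b (A n)) \in @ubounded C (J0 : lmodType C).
Proof.
have [N hN] := series_ub A; apply/uboundedP; exists N => n hn.
by rewrite hN // hhat0.
Qed.

(* D^b A D^(-b) *)
Definition sigma (b : C) (A : PsiD) : PsiD := Series (ubounded_sigma b A).

Definition Pplus : PsiD -> PsiD := restr (fun n => 0 < n).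
Definition Pminus : PsiD -> PsiD := restr (fun n => n < 0).
Definition Pgeq0 : PsiD -> PsiD := restr (fun n => 0 <= n).
Definition P0 (A : PsiD) : J0 := A 0.

Definition Jminus : set PsiD := [set X | forall n : int, 0 <= n -> X n = 0].
Definition Jleq0 : set PsiD := [set X | forall n : int, 0 < n -> X n = 0].

Definition Tr (A : PsiD) : C := int_ (P0 A).
Definition pair (A B : PsiD) : C := Tr (mulD A B).

(* P_00 and P_0', seen as operators on J_0 to be composed with P_0. *)
Definition P00 (f : J0) : J0 := int_ f *: oneJ.
Definition P0' (f : J0) : J0 := f - P00 f.

Definition rmat (A : PsiD) : PsiD := 2^-1 *: (Pplus A - Pminus A).

(* Elements L = \bar L D^alpha of \hat G_alpha are represented by their bars
   \bar L in \hat G_0, i.e. by their coefficients, alpha being fixed; likewise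
   for the tangent vectors \bar X D^alpha. Accordingly functionals on
   \hat G_alpha are functions of \bar L; their values outside G0 are never
   used. *)
Definition G0 : set PsiD :=
  [set L | P0 L = oneJ /\ forall n : int, 0 < n -> L n = 0].

Definition functional := PsiD -> C.

Fixpoint differentiable_n (k n : nat) (F : 'rV[C]_n -> C) : Prop :=
  if k is k'.+1 then
    (forall x, differentiable F x) /\
    (forall v, differentiable_n k' (fun x => 'd F x v))
  else continuous F.

Definition smooth_n (n : nat) (F : 'rV[C]_n -> C) : Prop :=
  forall k, differentiable_n k F.

(* \hat G_alpha is the union of the subsets {L | ord_z a_i <= N_i for all i},
   each of which is a countable product of complex lines. The smooth functionals
   on such a product (smooth over C, since differentials are C-linear) are, by
   Liouville's theorem, the smooth functions of finitely many coordinates.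
   The finite set of coordinates depends on N, so that a differential can have
   infinitely many nonzero coefficients in each degree in D. *)
Definition ord_le (N : int -> int) (L : PsiD) : Prop :=
  forall n k : int, n < 0 -> N n < k -> L n k = 0.

Definition smooth (phi : functional) : Prop :=
  forall N : int -> int, exists (n : nat) (c : 'I_n -> int * int)
    (F : 'rV[C]_n -> C), smooth_n F /\
    forall L, G0 L -> ord_le N L -> phi L = F (\row_j L (c j).1 (c j).2).

(* G is a representative of \overline{d phi}(L). *)
Definition is_grad (phi : functional) (L G : PsiD) : Prop :=
  forall X, Jminus X ->
    is_derive (0 : C) (1 : C) (fun t : C => phi (L + t *: X)) (pair X G).

Definition nablal (L G : PsiD) : PsiD := mulD L G.
Definition nablar (alpha : C) (L G : PsiD) : PsiD := sigma (- alpha) (mulD G L).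

Record opmatrix := OpMatrix
  { opa : J0 -> J0; opb : J0 -> J0; opc : J0 -> J0; opd : J0 -> J0 }.

Definition adjoint (u v : J0 -> J0) : Prop :=
  forall f g : J0, int_ (mulJ (u f) g) = int_ (mulJ f (v g)).

Definition admissible (M : opmatrix) : Prop :=
  [/\ [/\ linear (opa M), linear (opb M), linear (opc M) & linear (opd M)],
      adjoint (opa M) (fun f => - opa M f),
      adjoint (opd M) (fun f => - opd M f)
    & adjoint (opc M) (opb M)].

(* The right-hand side of the formula for {phi, psi}(L), as a function of
   representatives Gphi and Gpsi of the differentials. *)
Definition star (alpha : C) (M : opmatrix) (L Gphi Gpsi : PsiD) : C :=
  let X1 := nablal L Gphi in let X2 := nablar alpha L Gphi in
  let Y1 := nablal L Gpsi in let Y2 := nablar alpha L Gpsi in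
  pair (rmat X1 + ofJ0 (opa M (P0 X1)) + ofJ0 (opb M (P0 X2))) Y1
  - pair (ofJ0 (opc M (P0 X1)) + (rmat X2 + ofJ0 (opd M (P0 X2)))) Y2.

Definition well_defined (alpha : C) (M : opmatrix) : Prop :=
  forall L U V Y Z : PsiD, G0 L -> Jleq0 Y -> Jleq0 Z ->
    star alpha M L (U + Y) (V + Z) = star alpha M L U V.

Definition bracket := functional -> functional -> functional.

Definition of_star_form (alpha : C) (M : opmatrix) (B : bracket) : Prop :=
  forall phi psi, smooth phi -> smooth psi ->
  forall L Gphi Gpsi, G0 L -> is_grad phi L Gphi -> is_grad psi L Gpsi ->
    B phi psi L = star alpha M L Gphi Gpsi.

Record poisson (B : bracket) : Prop := Poisson {
  poisson_smooth : forall phi psi,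
    smooth phi -> smooth psi -> smooth (B phi psi);
  poisson_anti : forall phi psi, smooth phi -> smooth psi ->
    forall L, G0 L -> B phi psi L = - B psi phi L;
  poisson_linear : forall (c : C) phi chi psi,
    smooth phi -> smooth chi -> smooth psi ->
    forall L, G0 L ->
      B (fun A => c * phi A + chi A) psi L = c * B phi psi L + B chi psi L;
  poisson_leibniz : forall phi chi psi,
    smooth phi -> smooth chi -> smooth psi ->
    forall L, G0 L ->
      B (fun A => phi A * chi A) psi L
      = phi L * B chi psi L + chi L * B phi psi L;
  poisson_jacobi : forall phi chi psi,
    smooth phi -> smooth chi -> smooth psi ->
    forall L, G0 L ->
      B phi (B chi psi) L + B chi (B psi phi) L + B psi (B phi chi) L = 0 }.

(* exp t(X + ln D) = A(t) D^t *)
Definition is_exp (X : PsiD) (A : C -> PsiD) : Prop :=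
  [/\ forall t, G0 (A t), A 0 = oneD &
      forall (t : C) (n k : int),
        is_derive t (1 : C) (fun s : C => A s n k)
          (mulD (A t) (sigma t X) n k)].

Definition exp_ (X : PsiD) : C -> PsiD :=
  xget (fun _ => 0) [set A | is_exp X A].

(* X such that L = exp alpha(X + ln D) *)
Definition log_ (alpha : C) (L : PsiD) : PsiD :=
  xget 0 [set X | Jminus X /\ exp_ X alpha = L].

(* The bar of L^beta, an element of \hat G_(alpha beta). *)
Definition cpow (alpha beta : C) (L : PsiD) : PsiD :=
  exp_ (log_ alpha L) (alpha * beta).

(* L^(m/alpha), in \hat G_m, as an element of PsiD. *)
Definition fracpow (alpha : C) (m : nat) (L : PsiD) : PsiD :=
  mulD (cpow alpha (m%:R / alpha) L) (Dpow m).

Definition hamiltonian (alpha : C) (m : nat) : functional :=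
  fun L => alpha / m%:R * Tr (fracpow alpha m L).

(* [A, L] = (A \bar L - \bar L sigma_alpha(A)) D^alpha for A in PsiD; this is
   the bar of it. *)
Definition commutator (alpha : C) (A L : PsiD) : PsiD :=
  mulD A L - mulD L (sigma alpha A).

(* The Hamiltonian H generates the equation dL/dt = V(L) (V is given by bars):
   along it, d psi(L)/dt = {H, psi}(L) for all psi. *)
Definition generates (B : bracket) (H : functional) (V : PsiD -> PsiD) : Prop :=
  smooth H /\
  forall L, G0 L -> Jminus (V L) /\
    forall psi, smooth psi ->
      is_derive (0 : C) (1 : C) (fun t : C => psi (L + t *: V L)) (B H psi L).

Definition lax (alpha : C) (B : bracket) : Prop :=
  forall m : nat, (0 < m)%N ->
    generates B (hamiltonian alpha m)
      (fun L => commutator alpha (Pgeq0 (fracpow alpha m L)) L).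

Definition lax_poisson_bracket (alpha : C) (B : bracket) : Prop :=
  poisson B /\
  exists M : opmatrix,
    [/\ admissible M, of_star_form alpha M B, well_defined alpha M
      & lax alpha B].

(* On the image of P_0' the operator 1 - \hat h^alpha is invertible for generic
   alpha, and its functions are evaluated on the eigenvalues q^(alpha k). *)
Definition explicit_ops (alpha : C) : opmatrix := OpMatrix
  (fun f => 2^-1 *: hcalc (fun u => (1 + u) / (1 - u)) alpha (P0' f))
  (fun f => - hcalc (fun u => u / (1 - u)) alpha (P0' f) + 2^-1 *: P00 f)
  (fun f => hcalc (fun u => (1 - u)^-1) alpha (P0' f) + 2^-1 *: P00 f)
  (fun f => - (2^-1 *: hcalc (fun u => (1 + u) / (1 - u)) alpha (P0' f))).

End Symbols.

(* Main.v *)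
Require Import Defs.
From HB Require Import structures.
From mathcomp Require Import all_boot all_order all_algebra.
From mathcomp Require Import all_classical all_reals all_analysis.
From mathcomp Require Import complex.
From mathcomp Require Import zify ring lra.
Import Order.TTheory GRing.Theory Num.Theory.
Import numFieldNormedType.Exports.
Local Open Scope classical_set_scope.
Local Open Scope ring_scope.

Set Implicit Arguments.
Unset Strict Implicit.
Unset Printing Implicit Defensive.

(** Why the theorem holds. Write h for \hat h^alpha, and let U and V represent
    two differentials at L. Conjugating by D^alpha turns the formula (star)
    into
      <r(L U) + f1(x, y), L V> - <r(U L) + f2(x, y), V L>,
    with x = P_0(L U), y = P_0(U L) and f1, f2 linear with values in J_0
    (starE). Hence it is the derivative in the direction V of the Hamiltonian
    field A_1 L - L A_2, where A_1 = r(L U) + f1 and A_2 = r(U L) + f2.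

    Jacobi identity. For constant U, V, W the Jacobi sum is a difference of
    two cyclic sums of Tr([r X + f, r Y + g] Z), one for X = L U, the other for
    X = U L. Such a sum is -1/4 Tr([X, Y] Z) whatever f and g are
    (jacobi_rmat), because r X + f is the half-sum, and X the difference, of
    an element of J_{>=0} and one of J_{<=0}, and Tr([., .] .) vanishes on
    each of these two subalgebras; by cyclicity the two sums agree
    (jacobi_linear). So every admissible choice of a, b, c, d satisfies the
    identity on linear functionals. In general the bracket is the derivative
    of one functional along the field of the other, and the second derivatives
    cancel by symmetry (dirD_bracket0, bracket0_poisson).

    Uniqueness. Independence of the J_{(-)}-components amounts to the first,
    and the Lax equations to the second of the relations
      f1(y, y) + y/2 = f2(y, y) + y/2 = a constant,
      f1(w, h w) - w/2 = f2(w, h w) - (h w)/2 = a constant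
    (wd_rel, lax_rel), where y and w range over all of J_0; for w this uses
    that P_0 L^(1/alpha) is arbitrary (fracpow1_surj). For generic alpha the
    operator 1 - h is invertible on series without constant term, so that the
    pairs (y, y) and (w, h w) span all (x, y) with equal integrals; these are
    the only ones that occur, since Tr(L U) = Tr(U L). Thus f1 and f2 are known
    up to a common constant, and a common constant contributes
    Tr(L V) - Tr(V L) = 0 (star_unique). The operators of the theorem satisfy
    both relations, as one sees on the powers of z.

    Complex powers. Every L in G_0 is S^-1 e^(alpha l) sigma_alpha(S) with S in
    G_0 without constant coefficients below degree 0 and l in J_- with constant
    coefficients (dress_eq): degree by degree one divides by 1 - q^(alpha k),
    k <> 0. Then L = exp alpha(X + ln D) for the X with
    X + ln D = S^-1 (l + ln D) S (is_exp_dressed), this X is unique (exp_inj),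
    and L^(m/alpha) = S^-1 e^(m l) D^m S. Its trace is Tr(e^(m l) D^m), and since
    varying S only conjugates, the differential of H_m at L is
    L^-1 L^(m/alpha) (dress_variation, is_grad_hamiltonian). With this
    differential, (star) is the commutator of the Lax equation up to the two
    differences in the second relation above (star_lax). *)

(** * Sums over the integers and twisted convolution *)

Definition irange (a b : int) : seq int :=
  [seq a + i%:Z | i <- iota 0 (if a <= b then absz (b - a + 1)%R else 0%N)].

Lemma mem_irange a b i : (i \in irange a b) = (a <= i <= b).
Proof.
apply/mapP/andP => [[k] | [h1 h2]].
  rewrite mem_iota; case: ifP => h h1 ->; split; lia.
exists (absz (i - a)); last by lia.
rewrite mem_iota; case: ifP => h; lia.
Qed.

Lemma irange_uniq a b : uniq (irange a b).
Proof. by rewrite map_inj_uniq ?iota_uniq // => i j; lia. Qed.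

(** The series are defined with sums over all of Z, of which only finitely
    many terms do not vanish; the next lemmas replace them by sums over lists,
    for which induction is available. *)
Lemma fsumT_seq (V : nmodType) (s : seq int) (F : int -> V) :
  uniq s -> (forall i, i \notin s -> F i = 0) ->
  \sum_(i \in [set: int]) F i = \sum_(i <- s) F i.
Proof.
move=> us h; rewrite (@fsbigE _ _ _ _ _ s) => //; last by move=> i _ /h.
by apply: eq_bigl => i; rewrite in_setT.
Qed.

Lemma fsumT_irange (V : nmodType) a b (F : int -> V) :
  (forall i, ~~ (a <= i <= b) -> F i = 0) ->
  \sum_(i \in [set: int]) F i = \sum_(i <- irange a b) F i.
Proof.
move=> h; apply: fsumT_seq; first exact: irange_uniq.
by move=> i; rewrite mem_irange; apply: h.
Qed.

Lemma fsumT1 (V : nmodType) a (F : int -> V) :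
  (forall i, i != a -> F i = 0) -> \sum_(i \in [set: int]) F i = F a.
Proof.
move=> h; rewrite (@fsumT_seq _ [:: a]) ?big_seq1// => i.
by rewrite inE; apply: h.
Qed.

Lemma fsumT_reindex (V : nmodType) (h : int -> int) (F : int -> V) :
  bijective h -> \sum_(i \in [set: int]) F i = \sum_(i \in [set: int]) F (h i).
Proof. by move=> bh; apply: reindex_fsbigT. Qed.

Section Conv.
Variables (V : zmodType) (m : V -> V -> V) (tau : int -> V -> V).
Hypothesis mDl : forall a b c, m (a + b) c = m a c + m b c.
Hypothesis mDr : forall a b c, m a (b + c) = m a b + m a c.
Hypothesis mA : forall a b c, m a (m b c) = m (m a b) c.
Hypothesis tauD : forall i a b, tau i (a + b) = tau i a + tau i b.
Hypothesis tauM : forall i a b, tau i (m a b) = m (tau i a) (tau i b).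
Hypothesis tauA : forall i j a, tau i (tau j a) = tau (i + j) a.

Let m0l a : m 0 a = 0.
Proof. by apply: (addrI (m 0 a)); rewrite -mDl !addr0. Qed.
Let m0r a : m a 0 = 0.
Proof. by apply: (addrI (m a 0)); rewrite -mDr !addr0. Qed.
Let tau0 i : tau i 0 = 0.
Proof. by apply: (addrI (tau i 0)); rewrite -tauD !addr0. Qed.

(** Products of formal series and of symbols are both of this form: with [tau]
    trivial for J_0, and with [tau i] the action of D^i for symbols. Their
    algebra is derived from this one source. *)
Definition tconv (f g : int -> V) (n : int) : V :=
  \sum_(i \in [set: int]) m (f i) (tau i (g (n - i))).

Definition zero_above (N : int) (f : int -> V) := forall n, N < n -> f n = 0.

Lemma tconv_range N M a b f g n : zero_above N f -> zero_above M g -> a <= n - M -> N <= b ->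
  tconv f g n = \sum_(i <- irange a b) m (f i) (tau i (g (n - i))).
Proof.
move=> hf hg ha hb; apply: fsumT_irange => i; rewrite negb_and => /orP[h|h].
  by rewrite hg ?tau0 ?m0r//; lia.
by rewrite hf ?m0l//; lia.
Qed.

Lemma tconv_bnd N M f g : zero_above N f -> zero_above M g -> zero_above (N + M) (tconv f g).
Proof.
move=> hf hg n hn; apply: fsbig1 => i _.
have [h|h] := ltP N i; first by rewrite hf// m0l.
by rewrite hg ?tau0 ?m0r//; lia.
Qed.

Lemma tconvDl N M f f' g n : zero_above N f -> zero_above N f' -> zero_above M g ->
  tconv (fun i => f i + f' i) g n = tconv f g n + tconv f' g n.
Proof.
move=> hf hf' hg; have hff : zero_above N (fun i => f i + f' i).
  by move=> i hi; rewrite hf// hf'// addr0.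
rewrite !(@tconv_range N M (n - M) N)// -big_split/=.
by apply: eq_bigr => i _; rewrite mDl.
Qed.

Lemma tconvDr N M f g g' n : zero_above N f -> zero_above M g -> zero_above M g' ->
  tconv f (fun i => g i + g' i) n = tconv f g n + tconv f g' n.
Proof.
move=> hf hg hg'; have hgg : zero_above M (fun i => g i + g' i).
  by move=> i hi; rewrite hg// hg'// addr0.
rewrite !(@tconv_range N M (n - M) N)// -big_split/=.
by apply: eq_bigr => i _; rewrite tauD mDr.
Qed.

(** Both sides are sums of f_i g_(j-i) h_(n-j) over the same finite triangle,
    once the summation index of the inner convolution is shifted by [i]. *)
Lemma tconvA N M P f g h n : zero_above N f -> zero_above M g -> zero_above P h ->
  tconv f (tconv g h) n = tconv (tconv f g) h n.
Proof.
move=> hf hg hh.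
have hgh := tconv_bnd hg hh; have hfg := tconv_bnd hf hg.
rewrite (@tconv_range N (M + P) (n - (M + P)) N)//.
rewrite (@tconv_range (N + M) P (n - P) (N + M))//.
have mr a (s : seq int) (F : int -> V) :
    m a (\sum_(i <- s) F i) = \sum_(i <- s) m a (F i).
  by elim/big_rec2: _ => [|i x y _ <-]; rewrite ?m0r ?mDr.
have ml a (s : seq int) (F : int -> V) :
    m (\sum_(i <- s) F i) a = \sum_(i <- s) m (F i) a.
  by elim/big_rec2: _ => [|i x y _ <-]; rewrite ?m0l ?mDl.
have ts j (s : seq int) (F : int -> V) :
    tau j (\sum_(i <- s) F i) = \sum_(i <- s) tau j (F i).
  by elim/big_rec2: _ => [|i x y _ <-]; rewrite ?tau0 ?tauD.
transitivity (\sum_(i <- irange (n - (M + P)) N) \sum_(j <- irange (n - P) (N + M))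
    m (m (f i) (tau i (g (j - i)))) (tau j (h (n - j)))); last first.
  rewrite exchange_big/= big_seq [RHS]big_seq; apply: eq_bigr => j.
  rewrite mem_irange => hj.
  have hr : n - (M + P) <= j - M by lia.
  by rewrite (@tconv_range N M (n - (M + P)) N)// ml.
rewrite big_seq [RHS]big_seq; apply: eq_bigr => i; rewrite mem_irange => hi.
rewrite /tconv (@fsumT_reindex _ (fun j => j - i)); last first.
  by exists (fun j => j + i) => j; lia.
rewrite (@fsumT_irange _ (n - P) (N + M)); last first.
  move=> j; rewrite negb_and => /orP[hj|hj].
    by rewrite hh ?tau0 ?m0r//; lia.
  by rewrite hg ?m0l//; lia.
rewrite ts mr; apply: eq_bigr => j _.
rewrite tauM tauA mA; congr (m (m _ (tau _ (g _))) (tau _ (h _))); lia.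
Qed.

End Conv.

(** * The algebra of symbols *)

Section Symbols.
Variables (R : realType).
Local Notation C := (CC R).
Implicit Types (f g h : J0 R) (A B : PsiD R).

Lemma cexpD (x y : C) : cexp (x + y) = cexp x * cexp y.
Proof.
case: x => a b; case: y => c d; rewrite /cexp /= expRD cosD sinD.
by congr Complex; ring.
Qed.

Lemma cexp0 : cexp (0 : C) = 1.
Proof. by rewrite /cexp /= expR0 cos0 sin0 mulr1 mulr0. Qed.

Lemma cexp_neq0 (x : C) : cexp x != 0.
Proof.
apply/eqP => h; have : cexp (x + - x) = 1 by rewrite subrr cexp0.
by rewrite cexpD h mul0r => /eqP; rewrite eq_sym oner_eq0.
Qed.

Lemma J0P f g : (forall k, f k = g k) -> f = g.
Proof. by move=> h; apply: val_inj; apply: funext. Qed.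

Lemma serP (V : lmodType C) (u v : Defs.series V) : (forall n, u n = v n) -> u = v.
Proof. by move=> h; apply: val_inj; apply: funext. Qed.

Lemma PsiP A B : (forall n k, A n k = B n k) -> A = B.
Proof. by move=> h; apply: val_inj; apply: funext => n; apply: J0P => k; exact: h. Qed.

Lemma serD (V : lmodType C) (f g : Defs.series V) n : (f + g) n = f n + g n.
Proof. by []. Qed.
Lemma serN (V : lmodType C) (f : Defs.series V) n : (- f) n = - f n.
Proof. by []. Qed.
Lemma serB (V : lmodType C) (f g : Defs.series V) n : (f - g) n = f n - g n.
Proof. by []. Qed.
Lemma ser0 (V : lmodType C) n : (0 : Defs.series V) n = 0.
Proof. by []. Qed.
Lemma serZ (V : lmodType C) (c : C) (f : Defs.series V) n : (c *: f) n = c *: f n.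
Proof. by []. Qed.

Lemma bndP (V : lmodType C) (f : Defs.series V) : exists N, zero_above N f.
Proof. exact: series_ub. Qed.

Let convJ := @tconv C *%R (fun _ => id).

Lemma mulJE f g : mulJ f g = convJ f g :> (int -> C).
Proof. by []. Qed.

Lemma mulJA f g h : mulJ f (mulJ g h) = mulJ (mulJ f g) h.
Proof.
have [N hN] := bndP f; have [M hM] := bndP g; have [P hP] := bndP h.
apply: J0P => k; rewrite !mulJE.
apply: (@tconvA C *%R (fun _ => id) _ _ _ _ _ _ N M P) => //.
- exact: mulrDl.
- exact: mulrDr.
- exact: mulrA.
Qed.

Lemma mulJC f g : mulJ f g = mulJ g f.
Proof.
apply: J0P => k; rewrite /= (@fsumT_reindex _ (fun i => k - i)); last first.
  by exists (fun i => k - i) => i; lia.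
by apply: eq_fsbigr => i _; rewrite mulrC; have -> : k - (k - i) = i by lia.
Qed.

Lemma mulJDl f f' g : mulJ (f + f') g = mulJ f g + mulJ f' g.
Proof.
have [N hN] := bndP f; have [N' hN'] := bndP f'; have [M hM] := bndP g.
apply: J0P => k; apply: (@tconvDl C *%R (fun _ => id) _ _ _ (Num.max N N') M) => //.
- exact: mulrDl.
- exact: mulrDr.
- by move=> n hn; apply: hN; lia.
- by move=> n hn; apply: hN'; lia.
Qed.

Lemma mulJDr f g g' : mulJ f (g + g') = mulJ f g + mulJ f g'.
Proof. by rewrite !(mulJC f) mulJDl. Qed.

Lemma mulJZl (c : C) f g : mulJ (c *: f) g = c *: mulJ f g.
Proof.
apply: J0P => k; rewrite serZ /= [RHS]mulr_fsumr.
by apply: eq_fsbigr => i _; rewrite mulrA.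
Qed.

Lemma mulJZr (c : C) f g : mulJ f (c *: g) = c *: mulJ f g.
Proof. by rewrite mulJC mulJZl mulJC. Qed.

Lemma mulJNl f g : mulJ (- f) g = - mulJ f g.
Proof. by rewrite -scaleN1r mulJZl scaleN1r. Qed.
Lemma mulJNr f g : mulJ f (- g) = - mulJ f g.
Proof. by rewrite -scaleN1r mulJZr scaleN1r. Qed.

Lemma mul1J f : mulJ (oneJ R) f = f.
Proof.
apply: J0P => k; rewrite /= (@fsumT1 _ 0).
  by rewrite eqxx mul1r subr0.
by move=> i /negPf ->; rewrite mul0r.
Qed.

Lemma mulJ1 f : mulJ f (oneJ R) = f.
Proof. by rewrite mulJC mul1J. Qed.

Lemma int_D f g : int_ (f + g) = int_ f + int_ g. Proof. by rewrite /int_ serD. Qed.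
Lemma int_N f : int_ (- f) = - int_ f. Proof. by rewrite /int_ serN. Qed.
Lemma int_B f g : int_ (f - g) = int_ f - int_ g. Proof. by rewrite /int_ serB. Qed.
Lemma int_Z (c : C) f : int_ (c *: f) = c * int_ f. Proof. by rewrite /int_ serZ. Qed.

Variable lnq : C.
Local Notation qpow := (qpow lnq).
Local Notation hhat := (hhat lnq).
Local Notation mulD := (mulD lnq).
Local Notation sigma := (sigma lnq).

Lemma qpowD a b : qpow (a + b) = qpow a * qpow b.
Proof. by rewrite /Defs.qpow mulrDl cexpD. Qed.
Lemma qpow0 : qpow 0 = 1.
Proof. by rewrite /Defs.qpow mul0r cexp0. Qed.
Lemma qpow_neq0 a : qpow a != 0.
Proof. exact: cexp_neq0. Qed.
Lemma qpowN a : qpow (- a) = (qpow a)^-1.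
Proof.
by apply: (mulfI (qpow_neq0 a)); rewrite -qpowD subrr qpow0 mulfV// qpow_neq0.
Qed.
Lemma qpow_exp a (k : int) : qpow a ^ k = qpow (k%:~R * a).
Proof.
have hn (n : nat) : qpow a ^+ n = qpow (n%:R * a).
  elim: n => [|n IH]; first by rewrite mul0r qpow0.
  by rewrite exprS IH -qpowD -[n.+1]add1n natrD mulrDl mul1r.
case: k => n; first by rewrite -exprnP hn.
by rewrite NegzE -exprnN hn -qpowN mulrNz mulNr.
Qed.

Lemma hhatE a f k : hhat a f k = qpow a ^ k * f k.
Proof. by []. Qed.
Lemma hhatD a f g : hhat a (f + g) = hhat a f + hhat a g.
Proof. by apply: J0P => k; rewrite serD !hhatE mulrDr. Qed.
Lemma hhatZ a c f : hhat a (c *: f) = c *: hhat a f.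
Proof. by apply: J0P => k; rewrite serZ !hhatE serZ mulrCA. Qed.
Lemma hhatA a b f : hhat a (hhat b f) = hhat (a + b) f.
Proof.
apply: J0P => k; transitivity (qpow a ^ k * (qpow b ^ k * f k)); first by [].
by rewrite mulrA -expfzMl -qpowD.
Qed.
Lemma hhat_exp0 f : hhat 0 f = f.
Proof. by apply: J0P => k; rewrite !hhatE qpow0 exp1rz mul1r. Qed.
Lemma hhatK a f : hhat (- a) (hhat a f) = f.
Proof. by rewrite hhatA addNr hhat_exp0. Qed.
Lemma hhatM a f g : hhat a (mulJ f g) = mulJ (hhat a f) (hhat a g).
Proof.
apply: J0P => k; rewrite hhatE /= mulr_fsumr.
apply: eq_fsbigr => i _.
have -> : qpow a ^ k = qpow a ^ i * qpow a ^ (k - i).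
  by rewrite -expfzDr ?qpow_neq0//; congr (_ ^ _); lia.
by rewrite mulrACA.
Qed.
Lemma hhat1 a : hhat a (oneJ R) = oneJ R.
Proof.
apply: J0P => k; rewrite hhatE /=; case: eqP => [->|_]; last by rewrite mulr0.
by rewrite expr0z mul1r.
Qed.
Lemma int_hhat a f : int_ (hhat a f) = int_ f.
Proof. by rewrite /int_ hhatE expr0z mul1r. Qed.

Let tau (i : int) := hhat i%:~R.
Let convD := @tconv (J0 R) (@mulJ R) tau.

Let tauD i f g : tau i (f + g) = tau i f + tau i g. Proof. exact: hhatD. Qed.
Let tauM i f g : tau i (mulJ f g) = mulJ (tau i f) (tau i g). Proof. exact: hhatM. Qed.
Let tauA i j f : tau i (tau j f) = tau (i + j) f.
Proof. by rewrite /tau hhatA rmorphD. Qed.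

Lemma mulDA A B D : mulD A (mulD B D) = mulD (mulD A B) D.
Proof.
have [N hN] := bndP A; have [M hM] := bndP B; have [P hP] := bndP D.
apply: serP => k.
exact: (@tconvA (J0 R) (@mulJ R) tau mulJDl mulJDr mulJA tauD tauM tauA N M P).
Qed.

Lemma mulDDl A B D : mulD (A + B) D = mulD A D + mulD B D.
Proof.
have [N hN] := bndP A; have [M hM] := bndP B; have [P hP] := bndP D.
apply: serP => k.
apply: (@tconvDl (J0 R) (@mulJ R) tau mulJDl mulJDr tauD (Num.max N M) P) => //.
- by move=> n hn; apply: hN; lia.
- by move=> n hn; apply: hM; lia.
Qed.

Lemma mulDDr A B D : mulD D (A + B) = mulD D A + mulD D B.
Proof.
have [N hN] := bndP A; have [M hM] := bndP B; have [P hP] := bndP D.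
apply: serP => k.
apply: (@tconvDr (J0 R) (@mulJ R) tau mulJDl mulJDr tauD P (Num.max N M)) => //.
- by move=> n hn; apply: hN; lia.
- by move=> n hn; apply: hM; lia.
Qed.

Lemma mulD_range N M a b A B n : zero_above N A -> zero_above M B -> a <= n - M -> N <= b ->
  mulD A B n = \sum_(i <- irange a b) mulJ (A i) (hhat i%:~R (B (n - i))).
Proof.
move=> hA hB ha hb; exact: (@tconv_range (J0 R) (@mulJ R) tau mulJDl mulJDr tauD N M).
Qed.

Lemma mulD_bnd N M A B : zero_above N A -> zero_above M B -> zero_above (N + M) (mulD A B).
Proof.
move=> hA hB; exact: (@tconv_bnd (J0 R) (@mulJ R) tau mulJDl mulJDr tauD).
Qed.

Lemma mulDZl c A B : mulD (c *: A) B = c *: mulD A B.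
Proof.
have [N hN] := bndP A; have [M hM] := bndP B.
have hcN : zero_above N (c *: A) by move=> n hn; rewrite serZ hN// scaler0.
apply: serP => n; rewrite serZ.
rewrite !(@mulD_range N M (n - M) N)// scaler_sumr.
by apply: eq_bigr => i _; rewrite mulJZl.
Qed.

Lemma mulDZr c A B : mulD A (c *: B) = c *: mulD A B.
Proof.
have [N hN] := bndP A; have [M hM] := bndP B.
have hcM : zero_above M (c *: B) by move=> n hn; rewrite serZ hM// scaler0.
apply: serP => n; rewrite serZ.
rewrite !(@mulD_range N M (n - M) N)// scaler_sumr.
by apply: eq_bigr => i _; rewrite hhatZ mulJZr.
Qed.

Lemma mulDNl A B : mulD (- A) B = - mulD A B.
Proof. by rewrite -scaleN1r mulDZl scaleN1r. Qed.
Lemma mulDNr A B : mulD A (- B) = - mulD A B.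
Proof. by rewrite -scaleN1r mulDZr scaleN1r. Qed.
Lemma mulDBl A B D : mulD (A - B) D = mulD A D - mulD B D.
Proof. by rewrite mulDDl mulDNl. Qed.
Lemma mulDBr A B D : mulD D (A - B) = mulD D A - mulD D B.
Proof. by rewrite mulDDr mulDNr. Qed.
Lemma mulD0l A : mulD 0 A = 0.
Proof. by rewrite -(scale0r 0) mulDZl !scale0r. Qed.
Lemma mulD0r A : mulD A 0 = 0.
Proof. by rewrite -(scale0r 0) mulDZr !scale0r. Qed.

Lemma mul_monom n f A m : mulD (monom n (f : (J0 R : lmodType C))) A m = mulJ f (hhat n%:~R (A (m - n))).
Proof.
rewrite /= (@fsumT1 _ n) ?eqxx// => i /negPf ->; exact: mulJ0l.
Qed.

Lemma mulDmonom n f A m : mulD A (monom n (f : (J0 R : lmodType C))) m = mulJ (A (m - n)) (hhat (m - n)%:~R f).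
Proof.
rewrite /= (@fsumT1 _ (m - n)).
  by have -> : (m - (m - n) == n) by lia.
move=> i hi; have /negPf -> : (m - i != n) by lia.
by rewrite hhat0 mulJ0r.
Qed.

Lemma mul1D A : mulD (oneD R) A = A.
Proof.
by apply: serP => n; rewrite mul_monom hhat_exp0 mul1J subr0.
Qed.
Lemma mulD1 A : mulD A (oneD R) = A.
Proof.
by apply: serP => n; rewrite mulDmonom hhat1 mulJ1 subr0.
Qed.

Lemma mulD_ofJ0l f A n : mulD (ofJ0 f) A n = mulJ f (A n).
Proof. by rewrite mul_monom hhat_exp0 subr0. Qed.
Lemma mulD_ofJ0r f A n : mulD A (ofJ0 f) n = mulJ (A n) (hhat n%:~R f).
Proof. by rewrite mulDmonom subr0. Qed.

Lemma ofJ0E f n : ofJ0 f n = if n == 0 then f else 0.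
Proof. by []. Qed.
Lemma ofJ0D f g : ofJ0 (f + g) = ofJ0 f + ofJ0 g.
Proof.
by apply: serP => n; rewrite serD !ofJ0E; case: eqP => //; rewrite addr0.
Qed.
Lemma ofJ0Z c f : ofJ0 (c *: f) = c *: ofJ0 f.
Proof.
by apply: serP => n; rewrite serZ !ofJ0E; case: eqP => //; rewrite scaler0.
Qed.
Lemma ofJ0N f : ofJ0 (- f) = - ofJ0 f.
Proof. by rewrite -scaleN1r ofJ0Z scaleN1r. Qed.

Lemma sigmaE b A n : sigma b A n = hhat b (A n).
Proof. by []. Qed.
Lemma sigmaD b A B : sigma b (A + B) = sigma b A + sigma b B.
Proof. by apply: serP => n; exact: hhatD. Qed.
Lemma sigmaZ b c A : sigma b (c *: A) = c *: sigma b A.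
Proof. by apply: serP => n; exact: hhatZ. Qed.
Lemma sigmaN b A : sigma b (- A) = - sigma b A.
Proof. by rewrite -scaleN1r sigmaZ scaleN1r. Qed.
Lemma sigmaB b A B : sigma b (A - B) = sigma b A - sigma b B.
Proof. by rewrite sigmaD sigmaN. Qed.
Lemma sigmaA a b A : sigma a (sigma b A) = sigma (a + b) A.
Proof. by apply: serP => n; exact: hhatA. Qed.
Lemma sigma0 A : sigma 0 A = A.
Proof. by apply: serP => n; exact: hhat_exp0. Qed.
Lemma sigmaKV a A : sigma a (sigma (- a) A) = A.
Proof. by rewrite sigmaA subrr sigma0. Qed.
Lemma sigma_ofJ0 a f : sigma a (ofJ0 f) = ofJ0 (hhat a f).
Proof.
by apply: serP => n; rewrite sigmaE !ofJ0E; case: eqP => // _; exact: hhat0.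
Qed.
Lemma sigma1 a : sigma a (oneD R) = oneD R.
Proof. by rewrite sigma_ofJ0 hhat1. Qed.
Lemma sigma_bnd N b A : zero_above N A -> zero_above N (sigma b A).
Proof. by move=> h n hn; rewrite sigmaE h// hhat0. Qed.
Lemma sigmaM b A B : sigma b (mulD A B) = mulD (sigma b A) (sigma b B).
Proof.
have [N hN] := bndP A; have [M hM] := bndP B.
apply: serP => n; rewrite sigmaE.
rewrite !(@mulD_range N M (n - M) N)//; try exact: sigma_bnd.
have hs (s : seq int) (F : int -> J0 R) : hhat b (\sum_(i <- s) F i) = \sum_(i <- s) hhat b (F i).
  by elim/big_rec2: _ => [|i x y _ <-]; rewrite ?hhat0 ?hhatD.
rewrite hs; apply: eq_bigr => i _.
by rewrite hhatM !sigmaE !hhatA addrC.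
Qed.

Lemma Dpow_sigma (m : int) A : mulD (Dpow R m) A = mulD (sigma m%:~R A) (Dpow R m).
Proof.
apply: serP => n.
by rewrite mul_monom mulDmonom hhat1 mul1J mulJ1.
Qed.
Lemma mulDpow A m n : mulD A (Dpow R m) n = A (n - m).
Proof. by rewrite mulDmonom hhat1 mulJ1. Qed.

Lemma TrD A B : Tr (A + B) = Tr A + Tr B. Proof. by rewrite /Tr /P0 serD int_D. Qed.
Lemma TrN A : Tr (- A) = - Tr A. Proof. by rewrite /Tr /P0 serN int_N. Qed.
Lemma TrB A B : Tr (A - B) = Tr A - Tr B. Proof. by rewrite /Tr /P0 serB int_B. Qed.
Lemma TrZ c A : Tr (c *: A) = c * Tr A. Proof. by rewrite /Tr /P0 serZ int_Z. Qed.
Lemma Tr_sigma a A : Tr (sigma a A) = Tr A.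
Proof. by rewrite /Tr /P0 sigmaE int_hhat. Qed.

(** The terms of the two sums correspond under i -> - i, up to the action of
    D^i, which preserves the integral. *)
Lemma TrC A B : Tr (mulD A B) = Tr (mulD B A).
Proof.
have [N hN] := bndP A; have [M hM] := bndP B.
have hs (s : seq int) (F : int -> J0 R) : int_ (\sum_(i <- s) F i) = \sum_(i <- s) int_ (F i).
  by elim/big_rec2: _ => [|i x y _ <-].
rewrite /Tr /P0 (@mulD_range N M (- M) N)//; last by rewrite sub0r.
rewrite (@mulD_range M N (- N) M)//; last by rewrite sub0r.
rewrite !hs.
rewrite -(@fsumT_irange _ (- M) N (fun i => int_ (mulJ (A i) (hhat i%:~R (B (0 - i)))))); last first.
  move=> i; rewrite negb_and => /orP[h|h].
    by rewrite hM ?hhat0 ?mulJ0r//; lia.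
  by rewrite hN ?mulJ0l//; lia.
rewrite -(@fsumT_irange _ (- N) M (fun i => int_ (mulJ (B i) (hhat i%:~R (A (0 - i)))))); last first.
  move=> i; rewrite negb_and => /orP[h|h].
    by rewrite hN ?hhat0 ?mulJ0r//; lia.
  by rewrite hM ?mulJ0l//; lia.
rewrite (@fsumT_reindex _ (fun i => - i)); last by exists (fun i => - i) => i; lia.
apply: eq_fsbigr => i _.
rewrite sub0r opprK -(int_hhat i%:~R) hhatM hhatA mulrNz subrr hhat_exp0 mulJC.
by rewrite sub0r.
Qed.

Lemma TrCA A B D : Tr (mulD A (mulD B D)) = Tr (mulD B (mulD D A)).
Proof. by rewrite TrC mulDA. Qed.

(** The element whose pairing with a symbol reads off one coefficient; hence
    the pairing is nondegenerate. *)
Definition dual (n k : int) : PsiD R :=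
  monom (- n) ((qpow n%:~R ^ k) *: monom (- k) (1 : C) : (J0 R : lmodType C)).

Lemma Tr_dual A n k : Tr (mulD A (dual n k)) = A n k.
Proof.
rewrite /Tr /P0 mulDmonom sub0r opprK hhatZ mulJZr int_Z /int_ /=.
rewrite (@fsumT1 _ k).
  rewrite sub0r eqxx mulr1 [X in _ * X]mulrC mulrA -expfzDr ?qpow_neq0//.
  by rewrite subrr expr0z mul1r.
by move=> i hi; rewrite sub0r eqr_opp (negPf hi) !mulr0.
Qed.

End Symbols.

(** * Grading, fixed points and exponentials *)

Section Graded.
Variables (R : realType) (lnq : CC R).
Local Notation C := (CC R).
Implicit Types (f g h : J0 R) (A B : PsiD R).
Local Notation qpow := (qpow lnq).
Local Notation hhat := (hhat lnq).
Local Notation mulD := (mulD lnq).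
Local Notation sigma := (sigma lnq).

Lemma zero_aboveW (V : zmodType) N M (f : int -> V) :
  zero_above N f -> N <= M -> zero_above M f.
Proof. by move=> h NM n hn; apply: h; apply: le_lt_trans NM hn. Qed.

Lemma JminusP A : Jminus A <-> zero_above (-1) A.
Proof. by split=> h n hn; apply: h; lia. Qed.
Lemma Jleq0P A : Jleq0 A <-> zero_above 0 A.
Proof. by []. Qed.
Lemma G0_above L : @G0 R L -> zero_above 0 L.
Proof. by case. Qed.
Lemma G0_0 L : @G0 R L -> L 0 = oneJ R.
Proof. by case. Qed.

Lemma JminusD A B : Jminus A -> Jminus B -> Jminus (A + B).
Proof. by move=> hA hB n hn; rewrite serD hA ?hB ?addr0. Qed.
Lemma JminusZ c A : Jminus A -> Jminus (c *: A).
Proof. by move=> hA n hn; rewrite serZ hA ?scaler0. Qed.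
Lemma G0D L X : @G0 R L -> Jminus X -> @G0 R (L + X).
Proof.
move=> hL hX; split; first by rewrite /P0 serD (G0_0 hL) hX ?addr0.
by move=> n hn; rewrite serD (G0_above hL)// hX ?addr0//; apply: ltW.
Qed.
Lemma G0B L L' : @G0 R L -> @G0 R L' -> Jminus (L - L').
Proof.
move=> hL hL' n; rewrite le_eqVlt => /orP[/eqP <-|hn].
  by rewrite serB !G0_0// subrr.
by rewrite serB !G0_above// subr0.
Qed.
Lemma oneG0 : @G0 R (oneD R).
Proof. by split=> // n hn; rewrite ofJ0E gt_eqF. Qed.

Lemma mulD_top n m A B : zero_above n A -> zero_above m B ->
  mulD A B (n + m) = mulJ (A n) (hhat n%:~R (B m)).
Proof.
move=> hA hB; rewrite (@mulD_range _ _ n m n n)//; last by lia.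
have -> : irange n n = [:: n].
  by rewrite /irange lexx subrr add0r /= addr0.
by rewrite big_seq1; have -> : n + m - n = m by lia.
Qed.

Lemma G0M L L' : @G0 R L -> @G0 R L' -> @G0 R (mulD L L').
Proof.
move=> hL hL'; split; last first.
  by move=> n hn; rewrite (mulD_bnd lnq (G0_above hL) (G0_above hL'))// addr0.
rewrite /P0 -[0](addr0 0) mulD_top; try exact: G0_above.
by rewrite !G0_0// hhat1 mulJ1.
Qed.

Lemma G0_sigma b L : @G0 R L -> @G0 R (sigma b L).
Proof.
move=> hL; split; first by rewrite /P0 sigmaE G0_0// hhat1.
by move=> n hn; rewrite sigmaE (G0_above hL)// hhat0.
Qed.

Lemma Jminus_sigma b A : Jminus A -> Jminus (sigma b A).
Proof. by move=> h n hn; rewrite sigmaE h// hhat0. Qed.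

Lemma JminusMr A B : Jminus A -> Jleq0 B -> Jminus (mulD A B).
Proof.
move=> /JminusP hA /Jleq0P hB; apply/JminusP.
by have := mulD_bnd lnq hA hB; rewrite addr0.
Qed.
Lemma JminusMl A B : Jleq0 A -> Jminus B -> Jminus (mulD A B).
Proof.
move=> /Jleq0P hA /JminusP hB; apply/JminusP.
by have := mulD_bnd lnq hA hB; rewrite add0r.
Qed.

(** Multiplication by an element of J_- lowers the degree, so that a
    coefficient of the product only depends on the higher coefficients of the
    other factor. *)
Lemma mulD_causall n X A B : Jminus X ->
  (forall m, n < m -> A m = B m) -> mulD X A n = mulD X B n.
Proof.
move=> hX hAB; rewrite /=; apply: eq_fsbigr => i _.
have [hi|hi] := leP 0 i; first by rewrite hX// !mulJ0l.
by rewrite hAB//; lia.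
Qed.

Lemma mulD_causalr n X A B : Jminus X ->
  (forall m, n < m -> A m = B m) -> mulD A X n = mulD B X n.
Proof.
move=> hX hAB; rewrite /=; apply: eq_fsbigr => i _.
have [hi|hi] := leP 0 (n - i); first by rewrite hX// hhat0 !mulJ0r.
by rewrite hAB//; lia.
Qed.

Section CausalFixpoint.
Variables (p : int) (Phi : PsiD R -> PsiD R).
Hypothesis Phi_above : forall A, zero_above p A -> zero_above p (Phi A).
Hypothesis Phi_causal : forall n A B, zero_above p A -> zero_above p B ->
  (forall m, n < m -> A m = B m) -> Phi A n = Phi B n.

Let it k := iter k Phi 0.

Let it_above k : zero_above p (it k).
Proof. by elim: k => [n hn //|k IH]; apply: Phi_above. Qed.

Let it_stable k n : p < n + k%:Z -> it k.+1 n = it k n.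
Proof.
elim: k n => [|k IH] n hn; first by rewrite it_above ?[RHS]it_above//; lia.
apply: (Phi_causal (it_above k.+1) (it_above k)) => m hm; apply: IH; lia.
Qed.

Let it_stableD k l n : p < n + k%:Z -> it (k + l) n = it k n.
Proof.
move=> hn; elim: l => [|l IH]; first by rewrite addn0.
by rewrite addnS it_stable// PoszD; lia.
Qed.

(** If each coefficient of the image only depends on the higher coefficients
    of the argument, iteration from 0 determines one more coefficient at each
    step. *)
Lemma causal_fixpoint : exists2 A : PsiD R, zero_above p A & Phi A = A.
Proof.
(* the coefficient of degree n is stable after p - n + 1 iterations *)
pose c n := it (absz (p - n)%R).+1 n.
have cb : c \in @ubounded C (J0 R : lmodType C).
  by apply/uboundedP; exists p => n hn; apply: it_above.
exists (Series cb) => [n hn|]; first exact: it_above.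
have hc k n : p < n + k%:Z -> c n = it k n.
  move=> hn; have [h|h] := ltP p n; first by rewrite /c !it_above.
  have [e|e] := leqP k (absz (p - n)%R).+1.
    by rewrite /c -(subnKC e) it_stableD.
  by rewrite /c -(subnKC (ltnW e)) it_stableD//; lia.
apply: serP => n /=; have [h|h] := ltP p n.
  by rewrite /c it_above// Phi_above// => m hm; apply: it_above.
pose k := absz (p - n + 1)%R.
rewrite (_ : c n = it k.+1 n); last by apply: hc; rewrite /k; lia.
have cz : zero_above p (Series cb) by move=> m hm; exact: it_above.
by apply: (Phi_causal cz (it_above k)) => m hm; apply: (hc k m); rewrite /k; lia.
Qed.
End CausalFixpoint.

(** The inverse of L is the fixed point of Y -> 1 + (1 - L) Y. *)
Lemma G0_rinv L : @G0 R L -> exists2 Y, @G0 R Y & mulD L Y = oneD R.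
Proof.
move=> hL; have hX := G0B oneG0 hL.
have [||Y hY eY] := @causal_fixpoint 0 (fun Y => oneD R + mulD (oneD R - L) Y).
- move=> A hA n hn; rewrite serD (G0_above oneG0)// add0r.
  by apply: (JminusMr hX hA); apply: ltW.
- move=> n A B _ _ hAB; rewrite !serD; congr (_ + _).
  exact: mulD_causall.
exists Y.
  rewrite -eY; apply: G0D; [exact: oneG0 | exact: JminusMr].
move: eY; rewrite mulDBl mul1D => /eqP.
by rewrite addrCA -subr_eq0 addrAC subrr add0r subr_eq0 => /eqP.
Qed.

Lemma G0_inv L : @G0 R L ->
  exists Y, [/\ @G0 R Y, mulD L Y = oneD R & mulD Y L = oneD R].
Proof.
move=> hL; have [Y hY eY] := G0_rinv hL; have [Z hZ eZ] := G0_rinv hY.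
exists Y; split=> //; suff -> : L = Z by [].
by rewrite -[L](mulD1 lnq) -eZ mulDA eY mul1D.
Qed.

(** A bound [p] for the degree in D and bounds [f n + k] for the degrees in z
    of the coefficients. A uniform bound of this kind makes the coefficients
    of a product finite sums with a fixed range. The shift [k] records how the
    bound moves with a parameter. *)
Definition ord_in (p : int) (f : int -> int) (k : int) A :=
  zero_above p A /\ forall n, zero_above (f n + k) (A n).

(** One bound that serves all the products f_i g_(n-i) that enter the
    coefficient of degree [n]. *)
Definition ord_conv (p q : int) (f g : int -> int) (n : int) : int :=
  \sum_(i <- irange (n - q) p) (`|f i| + `|g (n - i)|).

Lemma mulJ_above N M f g : zero_above N f -> zero_above M g -> zero_above (N + M) (mulJ f g).
Proof.
move=> hf hg; exact: (@tconv_bnd C *%R (fun _ => id) (@mulrDl C) (@mulrDr C) (fun _ _ _ => erefl)).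
Qed.
Lemma hhat_above N b f : zero_above N f -> zero_above N (hhat b f).
Proof. by move=> h k hk; rewrite hhatE h// mulr0. Qed.

Lemma ord_mulD p q (f g : int -> int) k l A B : ord_in p f k A -> ord_in q g l B ->
  ord_in (p + q) (ord_conv p q f g) (k + l) (mulD A B).
Proof.
move=> [hA fA] [hB gB]; split; first exact: mulD_bnd.
move=> n j hj; rewrite (@mulD_range _ _ p q (n - q) p)//.
have -> (s : seq int) (F : int -> J0 R) : (\sum_(i <- s) F i) j = \sum_(i <- s) F i j.
  by elim/big_rec2: _ => [|i x y _ <-].
rewrite big_seq big1// => i hi.
apply: (mulJ_above (fA i) (@hhat_above _ i%:~R _ (gB (n - i)))).
apply: le_lt_trans hj; rewrite addrACA lerD2r /ord_conv (big_rem i)//=.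
have h0 : 0 <= \sum_(y <- rem i (irange (n - q) p)) (`|f y| + `|g (n - y)|).
  by apply: sumr_ge0 => y _; apply: addr_ge0.
by apply: ler_wpDr => //; apply: lerD; apply: ler_norm.
Qed.

Lemma ord_inD p q (f g : int -> int) k A B : ord_in p f k A -> ord_in q g k B ->
  ord_in (Num.max p q) (fun n => Num.max (f n) (g n)) k (A + B).
Proof.
move=> [hA fA] [hB gB]; split=> [n hn|n j hj].
  by rewrite serD hA ?hB ?addr0//; lia.
by rewrite !serD fA ?gB ?addr0//; lia.
Qed.

Lemma ord_inZ p (f : int -> int) k c A : ord_in p f k A -> ord_in p f k (c *: A).
Proof.
move=> [hA fA]; split=> [n hn|n j hj]; first by rewrite serZ hA ?scaler0.
by rewrite !serZ fA ?scaler0.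
Qed.

Lemma ord_in_ex A : exists p (f : int -> int), ord_in p f 0 A.
Proof.
have [p hp] := bndP A.
have /choice[f hf] : forall n, exists N, zero_above N (A n) by move=> n; exact: bndP.
by exists p, f; split=> // n; rewrite addr0.
Qed.

Lemma ser_sum (I : Type) (s : seq I) (P : pred I) (F : I -> PsiD R) n :
  (\sum_(i <- s | P i) F i) n = \sum_(i <- s | P i) F i n.
Proof. by elim/big_rec2: _ => [|i x y _ <-]. Qed.

Lemma serJ_sum (I : Type) (s : seq I) (P : pred I) (F : I -> J0 R) n :
  (\sum_(i <- s | P i) F i) n = \sum_(i <- s | P i) F i n.
Proof. by elim/big_rec2: _ => [|i x y _ <-]. Qed.

Lemma mulJ_range a b f g m :
  (forall j, ~~ (a <= j <= b) -> f j * g (m - j) = 0) ->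
  mulJ f g m = \sum_(j <- irange a b) f j * g (m - j).
Proof. by move=> h; rewrite -(fsumT_irange h). Qed.

Lemma mulD_coef p q (f g : int -> int) A B n m : ord_in p f 0 A -> ord_in q g 0 B ->
  mulD A B n m = \sum_(i <- irange (n - q) p) \sum_(j <- irange (m - g (n - i)) (f i))
    A i j * (qpow i%:~R ^ (m - j) * B (n - i) (m - j)).
Proof.
move=> [hA fA] [hB gB]; rewrite (@mulD_range _ _ p q (n - q) p)//.
rewrite serJ_sum; apply: eq_bigr => i _; apply: mulJ_range => j.
rewrite hhatE negb_and => /orP[hj|hj].
  by rewrite gB ?mulr0//; move: (g _) hj => G hj; lia.
by rewrite fA ?mul0r//; lia.
Qed.

Lemma scaleCE (c : C) (x : (C : lmodType C)) : c *: x = c * x.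
Proof. by []. Qed.
Lemma diagZ (u : int -> C) c f : diag u (c *: f) = c *: diag u f.
Proof.
apply: J0P => k; rewrite serZ scaleCE -[LHS]/(u k * (c *: f) k).
by rewrite serZ scaleCE mulrCA.
Qed.
Lemma ubounded_cdiag (u : int -> C) A :
  (fun n : int => diag u (A n)) \in @ubounded C (J0 R : lmodType C).
Proof.
have [N hN] := bndP A; apply/uboundedP; exists N => n hn.
by apply: J0P => k; rewrite /= hN// mulr0.
Qed.
(** Operators that multiply z^k by a number, like sigma and the projection to
    constant coefficients. *)
Definition cdiag (u : int -> C) A : PsiD R := Series (ubounded_cdiag u A).

Lemma cdiagE u A n k : cdiag u A n k = u k * A n k.
Proof. by []. Qed.
Lemma sigma_cdiag b A : sigma b A = cdiag (fun k => qpow b ^ k) A.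
Proof. by apply: PsiP. Qed.
Lemma cdiagD u A B : cdiag u (A + B) = cdiag u A + cdiag u B.
Proof. by apply: PsiP => n k; rewrite !serD !cdiagE !serD mulrDr. Qed.
Lemma cdiagZ u c A : cdiag u (c *: A) = c *: cdiag u A.
Proof. by apply: serP => n; rewrite serZ -diagZ -serZ. Qed.
Lemma cdiagB u A B : cdiag u (A - B) = cdiag u A - cdiag u B.
Proof. by rewrite cdiagD -scaleN1r cdiagZ scaleN1r. Qed.
Lemma cdiag_above u p A : zero_above p A -> zero_above p (cdiag u A).
Proof. by move=> h n hn; apply: J0P => k; rewrite cdiagE h// mulr0. Qed.
Lemma ord_cdiag u p (f : int -> int) k A : ord_in p f k A -> ord_in p f k (cdiag u A).
Proof.
move=> [hA fA]; split; first exact: cdiag_above.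
by move=> n j hj; rewrite cdiagE fA// mulr0.
Qed.

(** Symbols with coefficients in C: they commute with each other and with
    powers of D. *)
Definition constc A := forall n k, k != 0 -> A n k = 0.

Lemma constcE A n : constc A -> A n = A n 0 *: (oneJ R).
Proof.
move=> hA; apply: J0P => k; rewrite serZ /=.
case: eqP => [->|/eqP hk]; first by rewrite /GRing.scale /= mulr1.
by rewrite hA// scaler0.
Qed.
Lemma constc_hhat b A n : constc A -> hhat b (A n) = A n.
Proof. by move=> hA; rewrite (constcE n hA) hhatZ hhat1. Qed.
Lemma constc_sigma b A : constc A -> sigma b A = A.
Proof. by move=> hA; apply: serP => n; rewrite sigmaE constc_hhat. Qed.
Lemma constc_mulDC A B : constc A -> constc B -> mulD A B = mulD B A.
Proof.
move=> hA hB; apply: serP => n /=; rewrite (@fsumT_reindex _ (fun i => n - i)); last first.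
  by exists (fun i => n - i) => i; lia.
apply: eq_fsbigr => i _; rewrite !constc_hhat// mulJC.
by have -> : n - (n - i) = i by lia.
Qed.
Lemma constc1 : constc (oneD R).
Proof. by move=> n k /negPf hk; rewrite ofJ0E; case: eqP => //= _; rewrite hk. Qed.
Lemma constcZ c A : constc A -> constc (c *: A).
Proof. by move=> hA n k hk; rewrite !serZ hA ?scaler0. Qed.
Lemma constc_mulD A B : constc A -> constc B -> constc (mulD A B).
Proof.
move=> hA hB n k hk; have [p hp] := bndP A; have [q hq] := bndP B.
rewrite (@mulD_range _ _ p q (n - q) p)//.
rewrite serJ_sum.
apply: big1 => i _; rewrite constc_hhat// (constcE i hA) (constcE _ hB).
rewrite mulJZl mulJZr mulJ1 !serZ /= (negPf hk).
by rewrite !scaler0.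
Qed.

Definition pw A (j : nat) : PsiD R := iter j (mulD A) (oneD R).

Lemma pwS A j : pw A j.+1 = mulD A (pw A j). Proof. by []. Qed.
Lemma pw1 A : pw A 1 = A. Proof. exact: mulD1. Qed.
Lemma constc_pw A j : constc A -> constc (pw A j).
Proof. by move=> hA; elim: j => [|j IH]; [exact: constc1|apply: constc_mulD]. Qed.
(** This makes the exponential series a finite sum in each degree. *)
Lemma pw_above A j : Jminus A -> zero_above (- j%:Z) (pw A j).
Proof.
move=> /JminusP hA; elim: j => [|j IH].
  by rewrite oppr0; apply: G0_above oneG0.
rewrite pwS; apply: zero_aboveW (mulD_bnd lnq hA IH) _; lia.
Qed.

(** Truncated exponential series. As a polynomial expression it can be
    differentiated, and in each degree it agrees with the exponential. *)
Definition exp_trunc (t : C) A (K : nat) : PsiD R :=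
  \sum_(j < K) (t ^+ j / (j`!)%:R) *: pw A j.

Definition expc (t : C) A (n : int) : J0 R := 
  if n <= 0 then exp_trunc t A (absz n).+1 n else 0.

Lemma ubounded_expc t A : expc t A \in @ubounded C (J0 R : lmodType C).
Proof.
by apply/uboundedP; exists 0 => n hn; rewrite /expc leNgt hn.
Qed.
Definition expJ t A : PsiD R := Series (ubounded_expc t A).

Lemma exp_truncE t A K n : Jminus A -> 0 < n + K%:Z -> exp_trunc t A K n = expJ t A n.
Proof.
move=> hA hn; rewrite /= /expc; case: (leP n 0) => hn0.
  have e : ((absz n).+1 <= K)%N by lia.
  rewrite /exp_trunc -(subnKC e) big_split_ord serD [X in _ + X]ser_sum [X in _ + X]big1 ?addr0//.
  by move=> j _; rewrite serZ pw_above ?scaler0//=; lia.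
rewrite ser_sum big1// => j _; rewrite serZ pw_above ?scaler0//; lia.
Qed.

Lemma expJ0 t A : Jminus A -> expJ t A 0 = oneJ R.
Proof.
move=> hA; rewrite -(@exp_truncE _ _ 1)// /exp_trunc big_ord_recl big_ord0 addr0.
by rewrite expr0 divr1 scale1r.
Qed.
Lemma G0_expJ t A : Jminus A -> @G0 R (expJ t A).
Proof.
by move=> hA; split; [exact: expJ0 | move=> n hn /=; rewrite /expc leNgt hn].
Qed.
Lemma constc_expJ t A : constc A -> constc (expJ t A).
Proof.
move=> hA n k hk; rewrite /= /expc; case: ifP => // _.
rewrite ser_sum serJ_sum big1// => j _; rewrite !serZ constc_pw ?scaler0//.
Qed.
Lemma expJ_0 A : expJ 0 A = oneD R.
Proof.
apply: serP => n; rewrite /= /expc /exp_trunc; case: ifP => hn; last by rewrite gt_eqF//; lia.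
rewrite big_ord_recl expr0 divr1 scale1r big1 ?addr0// => j _.
by rewrite expr0n /= mul0r scale0r.
Qed.

(** A^(j+1) - B^(j+1) is a sum of products of A - B with j factors in J_-.
    Hence only the linear term of the exponential feels a change in degree n. *)
Lemma pwB_above n A B j : Jminus A -> Jminus B -> zero_above n (A - B) ->
  zero_above (n - j%:Z) (pw A j.+1 - pw B j.+1).
Proof.
move=> hA hB hAB; elim: j => [|j IH].
  by rewrite subr0 !pw1.
have -> : pw A j.+2 - pw B j.+2 =
    mulD A (pw A j.+1 - pw B j.+1) + mulD (A - B) (pw B j.+1).
  by rewrite mulDBr mulDBl -!pwS addrA subrK.
move=> m hm; rewrite serD.
rewrite (mulD_bnd lnq ((JminusP _).1 hA) IH) ?add0r; last by lia.
by rewrite (mulD_bnd lnq hAB (@pw_above _ j.+1 hB)); last by lia.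
Qed.

Lemma expJB_top n t A B : Jminus A -> Jminus B -> zero_above n (A - B) ->
  zero_above n (expJ t A - expJ t B) /\
  (expJ t A - expJ t B) n = t *: (A - B) n.
Proof.
move=> hA hB hAB.
have key m K : 0 < m + K.+2%:Z -> n <= m -> (expJ t A - expJ t B) m = t *: (A - B) m.
  move=> hm hnm; rewrite serB -!(@exp_truncE _ _ K.+2)// /exp_trunc !big_ord_recl.
  rewrite !serD expr0 expr1 !divr1 !serZ !pw1.
  rewrite opprD addrACA subrr add0r opprD addrACA -!scalerBr.
  rewrite [X in _ + X = _](_ : _ = 0) ?addr0 ?serN// !ser_sum -sumrB big1// => j _.
  have := @pwB_above n A B j.+1 hA hB hAB m.
  rewrite serB !lift0 !serZ -scalerBr => ->; rewrite ?scaler0//; lia.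
split; last by apply: (key n (absz n)); lia.
by move=> m hm; rewrite (key m (absz m)) ?hAB ?scaler0//; lia.
Qed.

End Graded.

(** * Complex derivatives and the mean value inequality *)

Lemma is_derive_affine (K : numFieldType) (f : K -> K) (y t s df : K) :
  is_derive (y + s * t) (1 : K) f df ->
  is_derive s (1 : K) (fun s => f (y + s * t)) (t * df).
Proof.
move=> [dv dE]; pose a (s : K) : K := y + s * t.
have df0 : differentiable f (a s) := (derivable1_diffP _ _).1 dv.
have ha : is_diff s a (fun h => h * t).
  have -> : a = cst y + *:%R^~ t by apply/funext.
  apply: (is_diff_eq (is_diffD (is_diff_cst y s) (is_diff_scalel s t))).
  by apply/funext => u; rewrite [LHS]add0r.
have da : differentiable a s by apply: ex_diff.
have dfa : differentiable (f \o a) s := differentiable_comp da df0.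
have e1 : 'D_1 (f \o a) s = 'd f (a s) t.
  have -> : t = 'd a s 1 by case: ha => _ ->; rewrite mul1r.
  by rewrite (deriveE _ dfa) (diff_comp da df0).
have e2 : 'd f (a s) t = t * df.
  by rewrite -dE deriveE// -[t in LHS]mulr1 linearZ.
by apply: DeriveDef; [exact: (derivable1_diffP _ _).2 dfa | rewrite -e2 -e1].
Qed.

Section ComplexCalculus.
Variable (R : realType).
Local Notation C := (CC R).

Lemma is_derive_nearP (K : numFieldType) (f : K -> K) (x v df : K) :
  is_derive x v f df <->
  forall e : K, 0 < e -> \forall h \near 0^', `|df - h^-1 * (f (h * v + x) - f x)| < e.
Proof.
split=> [[dv dE] e e0|h].
  have /cvgrPdist_lt := dv; rewrite -/(derive f x v) dE => /(_ _ e0).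
  exact.
have hc : h^-1 *: ((f \o shift x) (h *: v) - f x) @[h --> 0^'] --> df.
  by apply/cvgrPdist_lt => e /h.
apply: DeriveDef; first by apply/cvg_ex; exists df.
exact: cvg_lim hc.
Qed.

(** Analysis along complex segments is reduced to the real mean value theorem. *)
Definition RtoC (s : R) : C := Complex s 0.
Lemma RtoCD s t : RtoC (s + t) = RtoC s + RtoC t.
Proof. by congr Complex; rewrite ?addr0. Qed.
Lemma RtoCM s t : RtoC (s * t) = RtoC s * RtoC t.
Proof. by congr Complex; ring. Qed.
Lemma RtoC0 : RtoC 0 = 0. Proof. by []. Qed.
Lemma RtoC1 : RtoC 1 = 1. Proof. by []. Qed.
Lemma RtoCV s : RtoC s^-1 = (RtoC s)^-1.
Proof.
have [->|s0] := eqVneq s 0; first by rewrite invr0 RtoC0 invr0.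
have z0 : RtoC s != 0 by rewrite eq_complex /= eqxx andbT.
by apply: (mulfI z0); rewrite mulfV// -RtoCM mulfV.
Qed.
Lemma RtoC_ge0 s : (0 <= RtoC s) = (0 <= s).
Proof. by rewrite [LHS]lecE /= eqxx. Qed.
Lemma RtoC_gt0 s : (0 < RtoC s) = (0 < s).
Proof. by rewrite [LHS]ltcE /= eqxx. Qed.
Lemma RtoC_norm s : `|RtoC s| = RtoC `|s|.
Proof. by rewrite normc_def /= expr0n /= addr0 sqrtr_sqr. Qed.
Lemma gt0_RtoC (e : C) : 0 < e -> e = RtoC (complex.Re e) /\ 0 < complex.Re e.
Proof.
case: e => a b; rewrite [_ < _]ltcE /= => /andP[/eqP -> h]; split => //.
Qed.

Lemma norm_Re_le (z : C) : RtoC `|complex.Re z| <= `|z|.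
Proof. exact: normc_ge_Re. Qed.

Lemma norm_le_ReIm (z : C) : `|z| <= RtoC (`|complex.Re z| + `|complex.Im z|).
Proof.
have e : z = RtoC (complex.Re z) + Complex 0 1 * RtoC (complex.Im z).
  by case: z => a b; congr Complex; rewrite /=; ring.
rewrite {1}e RtoCD -!RtoC_norm (le_trans (ler_normD _ _))// normrM.
have -> : `|Complex 0 1 : C| = 1 by rewrite normc_def /= expr0n /= expr1n add0r sqrtr1.
by rewrite mul1r.
Qed.

Lemma norm_Im_le (z : C) : RtoC `|complex.Im z| <= `|z|.
Proof.
have -> : complex.Im z = complex.Re (Complex 0 (-1) * z).
  by case: z => a b /=; ring.
rewrite (le_trans (norm_Re_le _))// normrM.
have -> : `|Complex 0 (-1) : C| = 1 by rewrite normc_def /= expr0n /= sqrrN expr1n add0r sqrtr1.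
by rewrite mul1r.
Qed.

Lemma near_RtoC (P : C -> Prop) : (\forall h \near (0 : C)^', P h) ->
  \forall s \near (0 : R)^', P (RtoC s).
Proof.
move=> /nbhs_ballP[/= d d0 hd]; have [de dr] := gt0_RtoC d0.
apply/nbhs_ballP; exists (complex.Re d) => //= s.
rewrite -!ball_normE /= sub0r normrN => hs s0; apply: hd.
  by rewrite -ball_normE /= sub0r normrN RtoC_norm de [_ < _]ltcE /= eqxx.
by rewrite /= eq_complex /= eqxx andbT.
Qed.

Lemma is_derive_Re (f : C -> C) (x v df : C) (s : R) :
  is_derive (x + RtoC s * v) v f df ->
  is_derive s (1 : R) (fun s => complex.Re (f (x + RtoC s * v))) (complex.Re df).
Proof.
move=> /is_derive_nearP h; apply/is_derive_nearP => e e0.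
have {}h := h (RtoC e); rewrite RtoC_gt0 in h; have {h} := near_RtoC (h e0).
apply: filterS => t ht; move: (le_lt_trans (norm_Re_le _) ht).
rewrite [_ < _]ltcE /= eqxx /=; congr (`|_| < _).
rewrite -RtoCV mulr1 RtoCD mulrDl addrCA.
move: (f _) (f _) => [a b] [c d]; move: df {ht} => [u w] /=; ring.
Qed.

(** The real mean value theorem applied to the real parts of f and of -i f,
    each giving a bound by e. *)
Lemma segment_mean_value (f : C -> C) (f' : R -> C) (e : C) :
  (forall s : R, 0 <= s <= 1 -> is_derive (RtoC s) (1 : C) f (f' s)) ->
  (forall s : R, 0 <= s <= 1 -> `|f' s| <= e) ->
  `|f 1 - f 0| <= 2 * e.
Proof.
move=> hf he.
have key (g : C -> C) (g' : R -> C) :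
    (forall s : R, 0 <= s <= 1 -> is_derive (RtoC s) (1 : C) g (g' s)) ->
    (forall s : R, 0 <= s <= 1 -> `|g' s| <= e) ->
    RtoC `|complex.Re (g 1 - g 0)| <= e.
  move=> hg he'.
  have hr (s : R) : 0 <= s <= 1 -> is_derive s (1 : R)
      (fun s => complex.Re (g (0 + RtoC s * 1))) (complex.Re (g' s)).
    by move=> hs; apply: is_derive_Re; rewrite add0r mulr1; apply: hg.
  have hr' (x : R) : x \in `]0, 1[%R -> is_derive x (1 : R)
      (fun s => complex.Re (g (0 + RtoC s * 1))) (complex.Re (g' x)).
    by rewrite in_itv /= => /andP[h1 h2]; apply: hr; rewrite !ltW.
  have hc' : {within `[0, 1], continuous (fun s => complex.Re (g (0 + RtoC s * 1)))}.
    apply: derivable_within_continuous => x; rewrite in_itv /= => hx.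
    by have [] := hr x hx.
  have [c hc] := @MVT R _ (fun s => complex.Re (g' s)) 0 1 ltr01 hr' hc'.
  rewrite subr0 !mulr1 !add0r RtoC1 RtoC0 => h.
  have -> : complex.Re (g 1 - g 0) = complex.Re (g' c).
    by rewrite -h; case: (g 1) => ? ?; case: (g 0).
  apply: le_trans (norm_Re_le _) (he' c _).
  by move: hc; rewrite in_itv /= => /andP[h1 h2]; rewrite !ltW.
have k1 := key f f' hf he.
pose j : C := Complex 0 (-1).
have k2 : RtoC `|complex.Re (j * f 1 - j * f 0)| <= e.
  apply: (key (fun z => j * f z) (fun s => j * f' s)) => s hs.
    exact: (@is_deriveZ _ _ _ f j _ _ _ (hf s hs)).
  rewrite normrM (_ : `|j| = 1) ?mul1r ?he//.
  by rewrite normc_def /= expr0n /= sqrrN expr1n add0r sqrtr1.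
apply: le_trans (norm_le_ReIm _) _; rewrite RtoCD mulr2n mulrDl mul1r lerD//.
apply: le_trans k2; rewrite -mulrBr; case: (f 1 - f 0) => a b /=.
by rewrite mul0r mulN1r add0r opprK.
Qed.

Lemma mean_value (f f' : C -> C) (y t e : C) :
  (forall s : R, 0 <= s <= 1 -> is_derive (y + RtoC s * t) (1 : C) f (f' (y + RtoC s * t))) ->
  (forall s : R, 0 <= s <= 1 -> `|f' (y + RtoC s * t)| <= e) ->
  `|f (y + t) - f y| <= 2 * e * `|t|.
Proof.
move=> h1 h2.
have := @segment_mean_value (fun s => f (y + s * t)) (fun s => t * f' (y + RtoC s * t)) (e * `|t|).
rewrite mul1r mul0r addr0 mulrA; apply=> s hs.
  by apply: is_derive_affine; apply: h1.
by rewrite normrM mulrC ler_wpM2r// h2.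
Qed.

(** The mean value inequality with bound 0. It gives uniqueness for the
    differential equation of the complex powers. *)
Lemma is_derive0_const (f : C -> C) :
  (forall t, is_derive t (1 : C) f 0) -> forall t, f t = f 0.
Proof.
move=> h t; apply/eqP; rewrite -subr_eq0 -normr_le0.
have := @mean_value f (fun _ => 0) 0 t 0; rewrite add0r mulr0 mul0r; apply=> s _.
by rewrite normr0.
Qed.

End ComplexCalculus.

(** * The complex exponential *)

Section ComplexExponential.
Variable (R : realType).
Local Notation C := (CC R).

Lemma expand_near (f : R -> R) (df e : R) : is_derive 0 (1 : R) f df -> 0 < e ->
  \forall s \near 0, `|f s - f 0 - s * df| <= e * `|s|.
Proof.
move=> /is_derive_nearP h e0; have {h} := h e e0.
rewrite !near_withinE; apply: filterS => s hs.
have [->|s0] := eqVneq s 0; first by rewrite subrr mul0r subrr !normr0 mulr0.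
move: (hs s0); rewrite mulr1 addr0 => {}hs.
have -> : f s - f 0 - s * df = - (s * (df - s^-1 * (f s - f 0))).
  by rewrite mulrBr mulrA divff// mul1r opprB.
by rewrite normrN normrM mulrC ler_wpM2r// ltW.
Qed.

(** At 0 the error of the linear approximation is e^a cos b - 1 - a + i (e^a
    sin b - b), and first-order expansions of the three real functions bound
    it by a small multiple of |a| + |b|. *)
Lemma is_derive_cexp0 : is_derive (0 : C) (1 : C) (@cexp R) 1.
Proof.
apply/is_derive_nearP => e he; have [ee e0] := gt0_RtoC he.
(* the error below adds up to 6 d |h|, which is less than e |h| *)
pose d := complex.Re e / 8; have d0 : 0 < d by rewrite divr_gt0.
have h1 := @expand_near expR 1 d _ d0.
have h2 := @expand_near cos 0 d _ d0.
have h3 := @expand_near sin 1 d _ d0.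
have {}h1 := h1 (is_derive_eq (is_derive_expR 0) (expR0 R)).
have {}h2 : \forall s \near (0:R), `|cos s - 1| <= d * `|s|.
  have : is_derive (0 : R) 1 cos 0.
    by apply: (is_derive_eq (is_derive_cos 0)); rewrite sin0 oppr0.
  by move=> /h2; apply: filterS => s; rewrite mulr0 subr0 cos0.
have {}h3 : \forall s \near (0:R), `|sin s - s| <= d * `|s|.
  have : is_derive (0 : R) 1 sin 1.
    by apply: (is_derive_eq (is_derive_sin 0)); rewrite cos0.
  by move=> /h3; apply: filterS => s; rewrite mulr1 sin0 subr0.
have {}h1 : \forall s \near (0:R), `|expR s - 1 - s| <= d * `|s|.
  by move: h1; apply: filterS => s; rewrite mulr1 expR0.
have h4 : \forall s \near (0:R), `|expR s - 1| <= Num.min d 1.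
  have := @continuous_expR R 0; rewrite /continuous_at expR0 => /cvgrPdist_le.
  move=> /(_ (Num.min d 1)); rewrite lt_min d0 ltr01 => /(_ isT).
  by apply: filterS => s; rewrite distrC.
have [r /= r0 hr] := (nbhs_ballP _ _).1 (filterI (filterI h1 h2) (filterI h3 h4)).
rewrite near_withinE; apply/nbhs_ballP; exists (RtoC r); first by rewrite /= RtoC_gt0.
move=> [a b]; rewrite -ball_normE /= sub0r normrN => hab ab0.
have ha : `|a| < r.
  by move: (le_lt_trans (norm_Re_le _) hab); rewrite [_ < _]ltcE /= eqxx.
have hb : `|b| < r.
  by move: (le_lt_trans (norm_Im_le _) hab); rewrite [_ < _]ltcE /= eqxx.
have [[a1 a2] [a3 a4]] : ((fun s => `|expR s - 1 - s| <= d * `|s|) `&` (fun s => `|cos s - 1| <= d * `|s|) `&`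
  ((fun s => `|sin s - s| <= d * `|s|) `&` (fun s => `|expR s - 1| <= Num.min d 1))) a.
  by apply: hr; rewrite -ball_normE /= sub0r normrN.
have [[b1 b2] [b3 b4]] : ((fun s => `|expR s - 1 - s| <= d * `|s|) `&` (fun s => `|cos s - 1| <= d * `|s|) `&`
  ((fun s => `|sin s - s| <= d * `|s|) `&` (fun s => `|expR s - 1| <= Num.min d 1))) b.
  by apply: hr; rewrite -ball_normE /= sub0r normrN.
move: a4; rewrite le_min => /andP[a4 a5].
have ea : `|expR a| <= 2.
  by rewrite -[expR a](subrK 1) (le_trans (ler_normD _ _))// normr1; lra.
set h : C := Complex a b.
have h0 : 0 < `|h| by rewrite normr_gt0.
rewrite -(ltr_pM2l h0) -normrM mulrBr mulr1 mulrA divff// mul1r addr0 cexp0 distrC.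
apply: le_lt_trans (norm_le_ReIm _) _.
have na := norm_Re_le h; have nb := norm_Im_le h; rewrite /= in na nb.
rewrite /cexp /=.
have -> : expR a * cos b - 1 - a = expR a * (cos b - 1) + (expR a - 1 - a) by ring.
have -> : expR a * sin b - 0 - b = expR a * (sin b - b) + b * (expR a - 1) by ring.
have n1 : `|expR a * (cos b - 1) + (expR a - 1 - a)| <= 2 * (d * `|b|) + d * `|a|.
  by rewrite (le_trans (ler_normD _ _))// normrM lerD// ler_pM.
have n2 : `|expR a * (sin b - b) + b * (expR a - 1)| <= 2 * (d * `|b|) + `|b| * d.
  by rewrite (le_trans (ler_normD _ _))// !normrM lerD// ?ler_pM// ler_wpM2l.
have := lerD n1 n2 => n3.
apply: le_lt_trans (_ : RtoC (5 * d) * RtoC `|b| + RtoC d * RtoC `|a| < _).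
  rewrite -!RtoCM -RtoCD [_ <= _]lecE /= eqxx /=; apply: le_trans n3 _; lra.
apply: le_lt_trans (_ : RtoC (6 * d) * `|h| < _).
  have -> : RtoC (6 * d) = RtoC (5 * d) + RtoC d by rewrite -RtoCD; congr RtoC; ring.
  by rewrite [X in _ <= X]mulrDl; apply: lerD; apply: ler_wpM2l => //; rewrite RtoC_ge0; lra.
rewrite mulrC ltr_pM2l// ee [_ < _]ltcE /= eqxx /= /d; lra.
Qed.

Lemma is_derive_cexp (c s : C) :
  is_derive s (1 : C) (fun s => cexp (s * c)) (c * cexp (s * c)).
Proof.
have h : is_derive (- (s * c) + s * c) (1 : C) (@cexp R) 1.
  by rewrite addNr; apply: is_derive_cexp0.
have := is_derive_affine h => {}h.
have := @is_deriveZ _ _ _ _ (cexp (s * c)) _ _ _ h; rewrite mulr1 => {}h.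
have e : (cexp (s * c) \*: (fun s0 => cexp (- (s * c) + s0 * c))) = (fun s => cexp (s * c)).
  by apply/funext => u; transitivity (cexp (s * c) * cexp (- (s * c) + u * c)); [|rewrite -cexpD addrA subrr add0r].
by rewrite e in h; apply: (is_derive_eq h); apply: mulrC.
Qed.

(** The modulus gives Re z = 0. After subtraction of a multiple of 2 pi the
    imaginary part is in [0, 2 pi[, where sin vanishes at 0 and pi only and
    cos pi = -1. *)
Lemma cexp_eq1 (z : C) : cexp z = 1 -> exists n : int, z = n%:~R * Complex 0 (2 * pi).
Proof.
case: z => a b; rewrite /cexp /= => -[h1 h2].
have a0 : a = 0.
  have h3 : expR a ^+ 2 = 1.
    rewrite -[LHS]mulr1 -(cos2Dsin2 b) mulrDr -!exprMn h1 h2 expr1n expr0n /= addr0.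
    by rewrite cos2Dsin2.
  have : expR a = expR 0 :> R; last exact: expR_inj.
  rewrite expR0; apply/eqP; rewrite -(@eqrXn2 _ 2)// ?h3 ?expr1n// expR_ge0.
move: h1 h2; rewrite a0 expR0 !mul1r => h1 h2.
have cosn (n : nat) (x : R) : cos (x + pi *+ 2 *+ n) = cos x /\ sin (x + pi *+ 2 *+ n) = sin x.
  by rewrite (periodicn (@cosD2pi R)) (periodicn (@sinD2pi R)).
have pi0 : 0 < (2 * pi : R) by rewrite mulr_gt0// pi_gt0.
have cosz (n : int) : cos (b - n%:~R * (2 * pi)) = 1 /\ sin (b - n%:~R * (2 * pi)) = 0.
  suff : cos (b - n%:~R * (2 * pi)) = cos b /\ sin (b - n%:~R * (2 * pi)) = sin b.
    by rewrite h1 h2.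
  case: n => m.
    have [e1 e2] := cosn m (b - m%:~R * (2 * pi)).
    by rewrite -e1 -e2; split; congr (_ _); rewrite -[_ *+ m]mulr_natl -(mulr_natl pi 2) pmulrn; ring.
  have [e1 e2] := cosn m.+1 b; rewrite -e1 -e2.
  by split; congr (_ _); rewrite -[_ *+ _]mulr_natl -(mulr_natl pi 2) NegzE mulrNz pmulrn; ring.
pose n := Num.floor (b / (2 * pi)); pose r := b - n%:~R * (2 * pi).
have [cr sr] : cos r = 1 /\ sin r = 0 by exact: cosz.
have r0 : 0 <= r by rewrite subr_ge0 -ler_pdivlMr// floor_le.
have r2 : r < 2 * pi.
  rewrite ltrBlDr -[X in _ < X + _]mul1r -mulrDl -ltr_pdivrMr// addrC.
  by have := floorD1_gt (b / (2 * pi)); rewrite intrD.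
have rz : r = 0.
  apply/eqP; apply: contraT => rn0.
  have rp : 0 < r by rewrite lt_def rn0.
  have [rpi|rpi|rpi] := ltgtP r pi.
  - have : 0 < sin r by apply: sin_gt0_pi; rewrite rp.
    by rewrite sr ltxx.
  - have : 0 < sin (r - pi) by apply: sin_gt0_pi; lra.
    by rewrite -[sin _]opprK -sinDpi subrK sr oppr0 ltxx.
  - by move: cr; rewrite rpi cospi => /eqP; rewrite eq_sym -subr_eq0 opprK; lra.
exists n; have {rz} : b = n%:~R * (2 * pi) by move/eqP: rz; rewrite subr_eq0 => /eqP.
move=> ->.
have hz (m : int) : (m%:~R : C) = RtoC (m%:~R).
  by rewrite /RtoC -[RHS]/((m%:~R)%:C%C) rmorph_int.
by rewrite hz; congr Complex => /=; ring.
Qed.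

End ComplexExponential.

(** * Smooth functions of finitely many complex variables *)

Section GenericDiff.
Variables (K : numFieldType) (V : normedModType K).
Implicit Types (F G : V -> K) (x v : V).

Lemma line_derive (F : V -> K) x v t : differentiable F (x + t *: v) ->
  is_derive t (1 : K) (fun t => F (x + t *: v)) ('d F (x + t *: v) v).
Proof.
move=> df; pose a (t : K) : V := x + t *: v.
have ha : is_diff t a (fun h => h *: v).
  have -> : a = cst x + *:%R^~ v by apply/funext.
  apply: (is_diff_eq (is_diffD (is_diff_cst x t) (is_diff_scalel t v))).
  by apply/funext => u; rewrite [LHS]add0r.
have da : differentiable a t by apply: ex_diff.
have dfa : differentiable (F \o a) t := differentiable_comp da df.
have e1 : 'D_1 (F \o a) t = 'd F (a t) v.
  have -> : v = 'd a t 1 by case: ha => _ ->; rewrite scale1r.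
  by rewrite (deriveE _ dfa) (diff_comp da df).
by apply: DeriveDef; [exact: (derivable1_diffP _ _).2 dfa | rewrite -e1].
Qed.

Lemma differentiable_add F G x : differentiable F x -> differentiable G x ->
  differentiable (fun y => F y + G y) x.
Proof. exact: differentiableD. Qed.
Lemma diff_add F G x v : differentiable F x -> differentiable G x ->
  'd (fun y => F y + G y) x v = 'd F x v + 'd G x v.
Proof. by move=> dF dG; have := diffD dF dG => /(congr1 (fun f => f v)). Qed.
Lemma differentiable_mul F G x : differentiable F x -> differentiable G x ->
  differentiable (fun y => F y * G y) x.
Proof. exact: differentiableM. Qed.
Lemma diff_mul F G x v : differentiable F x -> differentiable G x ->
  'd (fun y => F y * G y) x v = F x * 'd G x v + G x * 'd F x v.
Proof. by move=> dF dG; have := diffM dF dG => /(congr1 (fun f => f v)). Qed.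
Lemma diff_const (c : K) x v : 'd (fun _ : V => c) x v = 0.
Proof. by have := diff_cst c x => /(congr1 (fun f => f v)). Qed.

End GenericDiff.

Section Selection.
Variables (K : numFieldType) (n m : nat) (g : 'I_n -> 'I_m).

(** Selecting coordinates lets functions of different finite sets of
    coordinates be combined as functions of one common set. *)
Definition sel (x : 'rV[K]_m) : 'rV[K]_n := \row_j x 0 (g j).

Lemma sel_linear : linear sel.
Proof. by move=> c x y; apply/rowP => j; rewrite !mxE. Qed.
HB.instance Definition _ := GRing.isLinear.Build K 'rV[K]_m 'rV[K]_n _ sel sel_linear.

Lemma sel_continuous : continuous sel.
Proof.
move=> x P [Q hQ QP]; have hy : \forall y \near x, forall ij : 'I_1 * 'I_n, Q ij.1 ij.2 (sel y ij.1 ij.2).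
  apply: (@filter_forall _ _ _ (nbhs x) (nbhs_filter x)) => -[i j]; have := hQ i j; rewrite /= !mxE => h.
  have h2 : nbhs x ((fun M : 'rV[K]_m => M 0 (g j)) @^-1` Q i j) := coord_continuous h.
  by apply: (@filterS _ (nbhs x) (nbhs_filter x) _ _ _ h2) => y; rewrite /= !mxE.
by apply: filterS hy => y hy; apply: QP => i j; apply: (hy (i, j)).
Qed.

Lemma differentiable_sel (F : 'rV[K]_n -> K) x :
  differentiable F (sel x) -> differentiable (fun y => F (sel y)) x.
Proof.
by move=> dF; apply: (@differentiable_comp _ _ _ _ sel F) => //; apply: linear_differentiable; apply: sel_continuous.
Qed.

Lemma diff_sel (F : 'rV[K]_n -> K) x v : differentiable F (sel x) ->
  'd (fun y => F (sel y)) x v = 'd F (sel x) (sel v).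
Proof.
move=> dF; have ds : differentiable sel x by apply: linear_differentiable; apply: sel_continuous.
have := diff_comp ds dF => /(congr1 (fun f => f v)) /= ->.
by congr ('d F (sel x) _); rewrite diff_lin//; apply: sel_continuous.
Qed.

Lemma diff_coord (j : 'I_m) (x v : 'rV[K]_m) : 'd (fun y : 'rV[K]_m => y 0 j) x v = v 0 j.
Proof.
pose f (y : 'rV[K]_m) := y 0 j.
have lf : linear f by move=> c y z; rewrite /f !mxE.
pose fl := GRing.isLinear.Build _ _ _ _ _ lf.
pose fL : {linear 'rV[K]_m -> K} := HB.pack f fl.
have := @diff_lin K _ _ fL x; rewrite /= => -> //.
exact: coord_continuous.
Qed.
End Selection.

Section SmoothMaps.
Variable (R : realType).
Local Notation C := (CC R).

Lemma differentiable_nW k n (F : 'rV[C]_n -> C) :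
  differentiable_n k.+1 F -> differentiable_n k F.
Proof.
elim: k F => [|k IH] F [dF hF].
  by move=> x; apply: differentiable_continuous; apply: dF.
by split=> // v; apply: IH; apply: hF.
Qed.

Lemma differentiable_n_cst k n (c : C) : @differentiable_n R k n (fun=> c).
Proof.
elim: k c => [|k IH] c; first by move=> x; apply: cst_continuous.
split=> [x|v]; first exact: differentiable_cst.
have -> : (fun x : 'rV[C]_n => 'd (fun=> c) x v) = (fun=> 0); last exact: IH.
by apply/funext => x; apply: (@diff_const C).
Qed.

Lemma differentiable_n_coord k n (j : 'I_n) : @differentiable_n R k n (fun x => x 0 j).
Proof.
case: k => [|k]; first exact: coord_continuous.
split=> [x|v]; first exact: differentiable_coord.
have -> : (fun x : 'rV[C]_n => 'd (fun y : 'rV[C]_n => y 0 j) x v) = (fun=> v 0 j).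
  by apply/funext => x; apply: (@diff_coord C).
exact: differentiable_n_cst.
Qed.

Lemma differentiable_nD k n (F G : 'rV[C]_n -> C) :
  differentiable_n k F -> differentiable_n k G -> differentiable_n k (fun x => F x + G x).
Proof.
elim: k F G => [|k IH] F G; first by move=> cF cG x; apply: continuousD; [apply: cF|apply: cG].
move=> [dF hF] [dG hG]; split=> [x|v].
  exact: (@differentiable_add C _ F G x (dF x) (dG x)).
have -> : (fun x => 'd (fun x => F x + G x) x v) = (fun x => 'd F x v + 'd G x v).
  by apply/funext => x; exact: (@diff_add C _ F G x v (dF x) (dG x)).
by apply: IH; [apply: hF|apply: hG].
Qed.

Lemma differentiable_nM k n (F G : 'rV[C]_n -> C) :
  differentiable_n k F -> differentiable_n k G -> differentiable_n k (fun x => F x * G x).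
Proof.
elim: k F G => [|k IH] F G; first by move=> cF cG x; apply: continuousM; [apply: cF|apply: cG].
move=> hF' hG'; have [dF hF] := hF'; have [dG hG] := hG'; split=> [x|v].
  exact: (@differentiable_mul C _ F G x (dF x) (dG x)).
have -> : (fun x => 'd (fun x => F x * G x) x v) = (fun x => F x * 'd G x v + G x * 'd F x v).
  by apply/funext => x; exact: (@diff_mul C _ F G x v (dF x) (dG x)).
apply: differentiable_nD.
  exact: (IH F _ (@differentiable_nW k n F hF') (hG v)).
exact: (IH G _ (@differentiable_nW k n G hG') (hF v)).
Qed.

Lemma differentiable_n_sel k n m (g : 'I_n -> 'I_m) (F : 'rV[C]_n -> C) :
  differentiable_n k F -> differentiable_n k (fun x => F (sel g x)).
Proof.
elim: k F => [|k IH] F.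
  move=> cF x; apply: (@continuous_comp _ _ _ (sel g) F x (@sel_continuous C n m g x)); apply: cF.
move=> [dF hF]; split=> [x|v].
  exact: (@differentiable_sel C n m g F x (dF _)).
have -> : (fun x => 'd (fun x => F (sel g x)) x v) = (fun x => 'd F (sel g x) (sel g v)).
  by apply/funext => x; exact: (@diff_sel C n m g F x v (dF _)).
exact: (IH (fun y => 'd F y (sel g v)) (hF _)).
Qed.

Lemma smooth_nD n (F G : 'rV[C]_n -> C) : smooth_n F -> smooth_n G -> smooth_n (fun x => F x + G x).
Proof. by move=> hF hG k; apply: differentiable_nD. Qed.
Lemma smooth_nM n (F G : 'rV[C]_n -> C) : smooth_n F -> smooth_n G -> smooth_n (fun x => F x * G x).
Proof. by move=> hF hG k; apply: differentiable_nM. Qed.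
Lemma smooth_n_sel n m (g : 'I_n -> 'I_m) (F : 'rV[C]_n -> C) :
  smooth_n F -> smooth_n (fun x => F (sel g x)).
Proof. by move=> hF k; apply: differentiable_n_sel. Qed.
Lemma smooth_n_diff n (F : 'rV[C]_n -> C) v : smooth_n F -> smooth_n (fun x => 'd F x v).
Proof. by move=> hF k; have [_] := hF k.+1; apply. Qed.
Lemma smooth_n_differentiable n (F : 'rV[C]_n -> C) x : smooth_n F -> differentiable F x.
Proof. by move=> hF; have [h _] := hF 1%N; apply: h. Qed.
Lemma smooth_n_continuous n (F : 'rV[C]_n -> C) : smooth_n F -> continuous F.
Proof. by move=> hF; have := hF 0%N. Qed.

Lemma RtoC_nat (n : nat) : RtoC (n%:R : R) = n%:R.
Proof. by elim: n => [//|n IH]; rewrite -natr1 RtoCD IH RtoC1 natr1. Qed.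

(** Two applications of the mean value inequality, first in the direction v
    and then in the direction u, compare the second difference with the mixed
    derivative. *)
Lemma second_difference n (F Du Duv : 'rV[C]_n -> C) (x u v : 'rV[C]_n) (d e : R) :
  (forall y, differentiable F y) -> (forall y, Du y = 'd F y u) ->
  (forall y, differentiable Du y) -> (forall y, Duv y = 'd Du y v) ->
  (forall r s : R, 0 <= r <= 1 -> 0 <= s <= 1 ->
    `|Duv (x + RtoC (r * d) *: u + RtoC (s * d) *: v) - Duv x| <= RtoC e) ->
  `|F (x + RtoC d *: u + RtoC d *: v) - F (x + RtoC d *: u)
    - (F (x + RtoC d *: v) - F x) - RtoC d * (RtoC d * Duv x)|
  <= 2 * (2 * RtoC e * `|RtoC d|) * `|RtoC d|.
Proof.
move=> dF hDu dDu hDuv hb; set D : C := RtoC d; set c := Duv x.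
have inner (r : R) : 0 <= r <= 1 ->
    `|Du (x + RtoC (r * d) *: u + D *: v) - Du (x + RtoC (r * d) *: u) - D * c| <= 2 * RtoC e * `|D|.
  move=> hr; set y := x + RtoC (r * d) *: u.
  pose h (t : C) := Du (y + t *: v) - t * c.
  have hh (t : C) : is_derive t (1 : C) h (Duv (y + t *: v) - c).
    apply: is_deriveB; first by rewrite hDuv; apply: (@line_derive C _ Du).
    have := @is_deriveM C C id (cst c) t 1 1 0 (is_derive_id _ _) (is_derive_cst _ _ _).
    by move=> h0; apply: (is_derive_eq h0); rewrite scaler0 add0r; apply: mulr1.
  have := @mean_value R h (fun t => Duv (y + t *: v) - c) 0 D (RtoC e).
  rewrite /h !add0r scale0r addr0 mul0r subr0 => mv.
  have -> : Du (y + D *: v) - Du y - D * c = Du (y + D *: v) - D * c - Du y by rewrite addrAC.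
  apply: mv => s hs.
  by rewrite add0r -RtoCM; apply: hb.
pose g (t : C) := F (x + t *: u + D *: v) - F (x + t *: u) - t * (D * c).
have hg (t : C) : is_derive t (1 : C) g (Du (x + t *: u + D *: v) - Du (x + t *: u) - D * c).
  apply: is_deriveB; first apply: is_deriveB.
  - have := @line_derive C _ F (x + D *: v) u t (dF _).
    rewrite -hDu addrAC => h0.
    have -> : (fun x0 : C => F (x + x0 *: u + D *: v)) = (fun x0 : C => F (x + D *: v + x0 *: u)).
      by apply/funext => t'; rewrite addrAC.
    exact: h0.
  - by rewrite hDu; apply: (@line_derive C _ F).
  - have := @is_deriveM C C id (cst (D * c)) t 1 1 0 (is_derive_id _ _) (is_derive_cst _ _ _).
    by move=> h0; apply: (is_derive_eq h0); rewrite scaler0 add0r; apply: mulr1.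
have := @mean_value R g (fun t => Du (x + t *: u + D *: v) - Du (x + t *: u) - D * c) 0 D (2 * RtoC e * `|D|).
rewrite /g !add0r scale0r addr0 mul0r subr0 => mv.
rewrite addrAC; apply: mv => s hs.
by rewrite add0r -RtoCM; apply: inner.
Qed.

Lemma near_plane n (G : 'rV[C]_n -> C) (x u v : 'rV[C]_n) (e : R) : 0 < e ->
  {for x, continuous G} -> exists2 d : R, 0 < d &
  forall a b : R, 0 <= a <= d -> 0 <= b <= d ->
    `|G (x + RtoC a *: u + RtoC b *: v) - G x| <= RtoC e.
Proof.
move=> e0 cG; have := cG => /cvgrPdist_le /(_ (RtoC e)); rewrite RtoC_gt0 => /(_ e0).
move=> /nbhs_ballP[r /= r0 hr]; have [er rr0] := gt0_RtoC r0.
have nR (w : 'rV[C]_n) : exists2 m : R, 0 <= m & `|w| = RtoC m.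
  have := normr_ge0 w; case: (`|w|) => a b; rewrite lecE /= => /andP[/eqP -> a0].
  by exists a.
have [m1 m10 em1] := nR u; have [m2 m20 em2] := nR v.
have mp : 0 < m1 + m2 + 1 by lra.
exists (complex.Re r / (m1 + m2 + 1) / 2); first by rewrite !divr_gt0.
set d := _ / 2; have d0 : 0 < d by rewrite !divr_gt0.
move=> a b /andP[a0 ad] /andP[b0 bd].
rewrite distrC; apply: hr; rewrite -ball_normE /= -addrA opprD addrA subrr add0r normrN.
apply: le_lt_trans (ler_normD _ _) _; rewrite !normrZ em1 em2 !RtoC_norm -!RtoCM -RtoCD er.
rewrite [_ < _]ltcE /= eqxx /= !ger0_norm//.
have h1 : a * m1 <= d * m1 by rewrite ler_wpM2r.
have h2 : b * m2 <= d * m2 by rewrite ler_wpM2r.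
apply: le_lt_trans (lerD h1 h2) _; rewrite -mulrDr.
apply: le_lt_trans (_ : d * (m1 + m2 + 1) < _); first by rewrite ler_wpM2l ?ltW//; lra.
by rewrite /d mulrAC divfK ?gt_eqF//; lra.
Qed.

(** The second difference is symmetric in u and v, and divided by d^2 it is
    close to either mixed derivative. *)
Lemma schwarz n (F : 'rV[C]_n -> C) (x u v : 'rV[C]_n) : smooth_n F ->
  'd (fun y => 'd F y u) x v = 'd (fun y => 'd F y v) x u.
Proof.
move=> hF; pose Du y := 'd F y u; pose Dv y := 'd F y v.
pose Duv y := 'd Du y v; pose Dvu y := 'd Dv y u.
have hDu : smooth_n Du := smooth_n_diff u hF.
have hDv : smooth_n Dv := smooth_n_diff v hF.
have hDuv : smooth_n Duv := smooth_n_diff v hDu.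
have hDvu : smooth_n Dvu := smooth_n_diff u hDv.
suff key (e : R) : 0 < e -> `|Duv x - Dvu x| <= RtoC (8 * e).
  apply/eqP; rewrite -subr_eq0 -normr_eq0; apply/negPn/negP => h0.
  have hp : 0 < `|Duv x - Dvu x| by rewrite lt_def h0 normr_ge0.
  have [ep p0] := gt0_RtoC hp; set p := complex.Re _ in ep p0.
  have := key (p / 16); rewrite ep divr_gt0// => /(_ isT).
  rewrite [_ <= _]lecE /= eqxx /=; lra.
move=> e0.
have [d1 d10 h1] := near_plane u v e0 (@smooth_n_continuous n Duv hDuv x).
have [d2 d20 h2] := near_plane v u e0 (@smooth_n_continuous n Dvu hDvu x).
pose d := Num.min d1 d2.
have d0 : 0 < d by rewrite lt_min d10.
have dr (r : R) : 0 <= r <= 1 -> 0 <= r * d <= d1 /\ 0 <= r * d <= d2.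
  move=> /andP[r0 r1]; have hd : r * d <= d by rewrite ler_piMl// ltW.
  have hr : 0 <= r * d by rewrite mulr_ge0// ltW.
  move: hd; rewrite {2}/d le_min => /andP[hd1 hd2].
  by rewrite hr hd1 hd2.
have k1 := @second_difference n F Du Duv x u v d e
  (fun y => @smooth_n_differentiable n F y hF) (fun=> erefl)
  (fun y => @smooth_n_differentiable n Du y hDu) (fun=> erefl)
  (fun r s hr hs => h1 _ _ (dr r hr).1 (dr s hs).1).
have k2 := @second_difference n F Dv Dvu x v u d e
  (fun y => @smooth_n_differentiable n F y hF) (fun=> erefl)
  (fun y => @smooth_n_differentiable n Dv y hDv) (fun=> erefl)
  (fun r s hr hs => h2 _ _ (dr r hr).2 (dr s hs).2).
have D0 : 0 < RtoC d by rewrite RtoC_gt0.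
set D := RtoC d in k1 k2 D0; rewrite !(gtr0_norm D0) in k1 k2.
have eqd : F (x + D *: u + D *: v) - F (x + D *: u) - (F (x + D *: v) - F x) =
    F (x + D *: v + D *: u) - F (x + D *: v) - (F (x + D *: u) - F x).
  rewrite [x + _ + _]addrAC; ring.
rewrite eqd in k1.
set A := F (x + D *: v + D *: u) - F (x + D *: v) - (F (x + D *: u) - F x) in k1 k2.
have := le_trans (ler_normB _ _) (lerD k2 k1).
have -> : A - D * (D * Dvu x) - (A - D * (D * Duv x)) = D * D * (Duv x - Dvu x) by ring.
have -> : 2 * (2 * RtoC e * D) * D + 2 * (2 * RtoC e * D) * D = D * D * (8 * RtoC e) by ring.
rewrite normrM (ger0_norm (_ : 0 <= D * D)); last by rewrite mulr_ge0// ltW.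
rewrite ler_pM2l ?mulr_gt0// => h; apply: le_trans h _.
have -> : RtoC (8 * e) = 8 * RtoC e; last by [].
by rewrite RtoCM (RtoC_nat 8).
Qed.

End SmoothMaps.

(** * Smooth functionals and their differentials *)

Section SmoothFunctionals.
Variables (R : realType) (lnq : CC R).
Local Notation C := (CC R).
Local Notation Psi := (PsiD R).
Implicit Types (phi chi psi : functional R) (L X Y : PsiD R).
Local Notation qpow := (qpow lnq).
Local Notation pair := (pair lnq).

Definition coords n (c : 'I_n -> int * int) (L : Psi) : 'rV[C]_n :=
  \row_j L (c j).1 (c j).2.

Lemma coordsD n (c : 'I_n -> int * int) L X : coords c (L + X) = coords c L + coords c X.
Proof. by apply/rowP => j; rewrite !mxE !serD. Qed.
Lemma coordsZ n (c : 'I_n -> int * int) (a : C) X : coords c (a *: X) = a *: coords c X.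
Proof. by apply/rowP => j; rewrite !mxE !serZ. Qed.

(** The condition of smoothness for one bound [N]; constructions are carried
    out one bound at a time. *)
Definition smooth_on (N : int -> int) phi : Prop :=
  exists (n : nat) (c : 'I_n -> int * int) (F : 'rV[C]_n -> C), smooth_n F /\
    forall L, G0 L -> ord_le N L -> phi L = F (coords c L).

Lemma smoothP phi : smooth phi <-> forall N, smooth_on N phi.
Proof. by []. Qed.

Definition cat_coords n1 n2 (c1 : 'I_n1 -> int * int) (c2 : 'I_n2 -> int * int)
  (j : 'I_(n1 + n2)) := match fintype.split j with inl a => c1 a | inr b => c2 b end.

Lemma sel_lshift n1 n2 (c1 : 'I_n1 -> int * int) (c2 : 'I_n2 -> int * int) L :
  sel (@lshift n1 n2) (coords (cat_coords c1 c2) L) = coords c1 L.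
Proof.
apply/rowP => j; rewrite !mxE /cat_coords.
by case: fintype.splitP => k /= h; [rewrite (_ : k = j)//; apply/val_inj|have := ltn_ord j; rewrite h; lia].
Qed.
Lemma sel_rshift n1 n2 (c1 : 'I_n1 -> int * int) (c2 : 'I_n2 -> int * int) L :
  sel (@rshift n1 n2) (coords (cat_coords c1 c2) L) = coords c2 L.
Proof.
apply/rowP => j; rewrite !mxE /cat_coords.
by case: fintype.splitP => k /= h; [have := ltn_ord k; rewrite -h; lia|rewrite (_ : k = j)//; apply/val_inj => /=; lia].
Qed.

Lemma smooth_on_ext N phi chi : (forall L, G0 L -> ord_le N L -> phi L = chi L) ->
  smooth_on N phi -> smooth_on N chi.
Proof.
move=> e [n [c [F [sF hF]]]]; exists n, c, F; split=> // L hL oL.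
by rewrite -e// hF.
Qed.

Lemma smooth_on_cst N (a : C) : smooth_on N (fun=> a).
Proof.
exists 0%N, (fun=> (0, 0)), (fun=> a); split=> // k; exact: differentiable_n_cst.
Qed.

Lemma smooth_on_coef N n k : smooth_on N (fun L => L n k).
Proof.
exists 1%N, (fun=> (n, k)), (fun x => x 0 0); split=> [j|L _ _].
  exact: differentiable_n_coord.
by rewrite mxE.
Qed.

Lemma smooth_onD N phi chi : smooth_on N phi -> smooth_on N chi ->
  smooth_on N (fun L => phi L + chi L).
Proof.
move=> [n1 [c1 [F1 [s1 h1]]]] [n2 [c2 [F2 [s2 h2]]]].
exists (n1 + n2)%N, (cat_coords c1 c2),
  (fun x => F1 (sel (@lshift n1 n2) x) + F2 (sel (@rshift n1 n2) x)); split=> [|L hL oL].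
  by apply: smooth_nD; apply: smooth_n_sel.
by rewrite sel_lshift sel_rshift h1// h2.
Qed.

Lemma smooth_onM N phi chi : smooth_on N phi -> smooth_on N chi ->
  smooth_on N (fun L => phi L * chi L).
Proof.
move=> [n1 [c1 [F1 [s1 h1]]]] [n2 [c2 [F2 [s2 h2]]]].
exists (n1 + n2)%N, (cat_coords c1 c2),
  (fun x => F1 (sel (@lshift n1 n2) x) * F2 (sel (@rshift n1 n2) x)); split=> [|L hL oL].
  by apply: smooth_nM; apply: smooth_n_sel.
by rewrite sel_lshift sel_rshift h1// h2.
Qed.

Lemma smooth_onZ N (a : C) phi : smooth_on N phi -> smooth_on N (fun L => a * phi L).
Proof. by move=> h; apply: smooth_onM => //; apply: smooth_on_cst. Qed.

Lemma smooth_on_sum N (I : Type) (s : seq I) (f : I -> functional R) :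
  (forall i, smooth_on N (f i)) -> smooth_on N (fun L => \sum_(i <- s) f i L).
Proof.
move=> h; elim: s => [|i s IH].
  apply: (@smooth_on_ext N (fun=> 0)) => [L _ _|]; first by rewrite big_nil.
  exact: smooth_on_cst.
apply: (@smooth_on_ext N (fun L => f i L + \sum_(i <- s) f i L)) => [L _ _|].
  by rewrite big_cons.
exact: smooth_onD.
Qed.

Lemma ord_le_ex L : exists N, ord_le N L.
Proof.
have /choice[N hN] : forall n : int, exists N, zero_above N (L n) by move=> n; exact: bndP.
by exists N => n k _; apply: hN.
Qed.
Lemma ord_leW N N' L : (forall n, N n <= N' n) -> ord_le N L -> ord_le N' L.
Proof. by move=> NN h n k hn hk; apply: h => //; apply: le_lt_trans hk. Qed.
Lemma ord_leD N L X : ord_le N L -> ord_le N X -> ord_le N (L + X).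
Proof. by move=> h1 h2 n k hn hk; rewrite !serD h1 ?h2 ?addr0. Qed.
Lemma ord_leZ N (a : C) X : ord_le N X -> ord_le N (a *: X).
Proof. by move=> h n k hn hk; rewrite !serZ h ?scaler0. Qed.
Definition bound_max (N N' : int -> int) n := Num.max (N n) (N' n).
Lemma bound_maxl N N' n : N n <= bound_max N N' n. Proof. by rewrite /bound_max le_max lexx. Qed.
Lemma bound_maxr N N' n : N' n <= bound_max N N' n. Proof. by rewrite /bound_max le_max lexx orbT. Qed.
Lemma ord_le_ex3 L X Y : exists N, [/\ ord_le N L, ord_le N X & ord_le N Y].
Proof.
have [N1 o1] := ord_le_ex L; have [N2 o2] := ord_le_ex X; have [N3 o3] := ord_le_ex Y.
exists (bound_max (bound_max N1 N2) N3); split.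
- by apply: ord_leW o1 => n; apply: le_trans (bound_maxl _ _ n) (bound_maxl _ _ n).
- by apply: ord_leW o2 => n; apply: le_trans (bound_maxr _ _ n) (bound_maxl _ _ n).
- by apply: ord_leW o3 => n; exact: bound_maxr.
Qed.

Definition dirD phi X L : C := 'D_1 (fun t : C => phi (L + t *: X)) (0 : C).

Lemma line_on N n (c : 'I_n -> int * int) (F : 'rV[C]_n -> C) phi L X :
  (forall L, G0 L -> ord_le N L -> phi L = F (coords c L)) ->
  G0 L -> ord_le N L -> Jminus X -> ord_le N X ->
  (fun t : C => phi (L + t *: X)) = (fun t => F (coords c L + t *: coords c X)).
Proof.
move=> h hL oL hX oX; apply/funext => t.
rewrite h ?coordsD ?coordsZ//; first by apply: G0D => //; apply: JminusZ.
by apply: ord_leD => //; apply: ord_leZ.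
Qed.

Lemma dirD_on N n (c : 'I_n -> int * int) (F : 'rV[C]_n -> C) phi L X :
  smooth_n F -> (forall L, G0 L -> ord_le N L -> phi L = F (coords c L)) ->
  G0 L -> ord_le N L -> Jminus X -> ord_le N X ->
  is_derive (0 : C) (1 : C) (fun t : C => phi (L + t *: X)) ('d F (coords c L) (coords c X)).
Proof.
move=> sF h hL oL hX oX; rewrite (line_on h)//.
have := @line_derive C _ F (coords c L) (coords c X) 0.
by rewrite scale0r addr0; apply; apply: smooth_n_differentiable.
Qed.

Lemma dirDE N n (c : 'I_n -> int * int) (F : 'rV[C]_n -> C) phi L X :
  smooth_n F -> (forall L, G0 L -> ord_le N L -> phi L = F (coords c L)) ->
  G0 L -> ord_le N L -> Jminus X -> ord_le N X ->
  dirD phi X L = 'd F (coords c L) (coords c X).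
Proof. by move=> sF h hL oL hX oX; have [_] := dirD_on sF h hL oL hX oX. Qed.

Lemma smooth_is_derive phi L X : smooth phi -> G0 L -> Jminus X ->
  is_derive (0 : C) (1 : C) (fun t : C => phi (L + t *: X)) (dirD phi X L).
Proof.
move=> sp hL hX; have [N [oL oX _]] := ord_le_ex3 L X X.
have [n [c [F [sF hF]]]] := sp N.
by have [dh _] := dirD_on sF hF hL oL hX oX; apply: derivableP.
Qed.

Lemma is_derive_unique (f : C -> C) (t a b : C) :
  is_derive t (1 : C) f a -> is_derive t (1 : C) f b -> a = b.
Proof. by move=> [_ <-] [_ <-]. Qed.

Definition elt (n k : int) : Psi := monom n (monom k (1 : C) : (J0 R : lmodType C)).
Lemma eltE n k m j : elt n k m j = if (m == n) && (j == k) then 1 else 0.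
Proof. by rewrite /=; case: eqP. Qed.
Lemma elt_Jminus n k : n < 0 -> Jminus (elt n k).
Proof.
by move=> hn m hm; apply: J0P => j; rewrite eltE; case: eqP => //= e; move: hn hm; rewrite e; lia.
Qed.
Lemma elt_ord_le N n k : k <= N n -> ord_le N (elt n k).
Proof.
move=> hk m j _ hj; rewrite eltE; case: eqP => //= e; case: eqP => // e'.
by move: hj; rewrite e e'; lia.
Qed.
Lemma pair_elt n k G : pair (elt n k) G = qpow n%:~R ^ (- k) * G (- n) (- k).
Proof.
rewrite /Defs.pair /Tr /P0 mul_monom sub0r /int_ /= (@fsumT1 _ k).
  by rewrite eqxx mul1r sub0r.
by move=> i /negPf ->; rewrite mul0r.
Qed.

Lemma pair_dual X n k : pair X (dual lnq n k) = X n k.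
Proof. exact: Tr_dual. Qed.

(** The pairing with an X of bounded order only sees the coefficients of G
    that are opposite to the coefficients that X may have. *)
Lemma pair_ord N X (G : Psi) : Jminus X -> ord_le N X ->
  (forall m j, 0 < m -> - N (- m) <= j -> G m j = 0) -> pair X G = 0.
Proof.
move=> hX oX hG; have [p hp] := bndP X; have [q hq] := bndP G.
rewrite /Defs.pair /Tr /P0 /int_ (@mulD_range _ _ p q (0 - q) p)// serJ_sum big1// => i _.
have [hi|hi] := leP 0 i; first by rewrite hX// mulJ0l.
rewrite /=; apply: fsbig1 => j _; rewrite sub0r.
have [hj|hj] := ltP (N i) j; first by rewrite oX// mul0r.
by rewrite sub0r hG ?mulr0// ?opprK ?lerN2//; lia.
Qed.

Lemma pairDl X X' G : pair (X + X') G = pair X G + pair X' G.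
Proof. by rewrite /Defs.pair mulDDl TrD. Qed.
Lemma pairDr X G G' : pair X (G + G') = pair X G + pair X G'.
Proof. by rewrite /Defs.pair mulDDr TrD. Qed.
Lemma pairZl a X G : pair (a *: X) G = a * pair X G.
Proof. by rewrite /Defs.pair mulDZl TrZ. Qed.
Lemma pairZr a X G : pair X (a *: G) = a * pair X G.
Proof. by rewrite /Defs.pair mulDZr TrZ. Qed.
Lemma pairBr X G G' : pair X (G - G') = pair X G - pair X G'.
Proof. by rewrite /Defs.pair mulDBr TrB. Qed.
Lemma pairBl X X' G : pair (X - X') G = pair X G - pair X' G.
Proof. by rewrite /Defs.pair mulDBl TrB. Qed.
Lemma pairNl X G : pair (- X) G = - pair X G.
Proof. by rewrite /Defs.pair mulDNl TrN. Qed.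
Lemma pair_sumr I (s : seq I) X (G : I -> Psi) : pair X (\sum_(i <- s) G i) = \sum_(i <- s) pair X (G i).
Proof.
elim: s => [|i s IH]; last by rewrite !big_cons pairDr IH.
by rewrite !big_nil -(scale0r 0) pairZr mul0r.
Qed.

Lemma diff_coords n (c : 'I_n -> int * int) (F : 'rV[C]_n -> C) x X :
  'd F x (coords c X) = \sum_(j <- enum 'I_n) X (c j).1 (c j).2 * 'd F x (delta_mx 0 j).
Proof.
rewrite big_enum /= {1}(row_sum_delta (coords c X)) linear_sum.
by apply: eq_bigr => j _; rewrite linearZ /= mxE.
Qed.

(** The coefficients of the differential are the derivatives in the elementary
    directions. For each bound [N] only finitely many of the latter with order
    at most [N] are nonzero: applied to suitable bounds this shows that the
    coefficients form a series in z^-1 in each degree and are bounded in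
    degree, and that pairing with X gives a finite sum. *)
Lemma grad_exists phi L : smooth phi -> G0 L -> exists G, is_grad lnq phi L G.
Proof.
move=> sp hL; have [N0 o0] := ord_le_ex L.
pose del n k := dirD phi (elt n k) L.
pose g (m j : int) : C := if 0 < m then (qpow (- m)%:~R ^ j)^-1 * del (- m) (- j) else 0.
have van N : (forall n, N0 n <= N n) -> exists M : int,
    forall n k, n < 0 -> k <= N n -> (n < - M) || (k < - M) -> del n k = 0.
  move=> hN; have [n [c [F [sF hF]]]] := sp N.
  pose M : int := \sum_(j < n) (`|(c j).1| + `|(c j).2|).
  have hM j : `|(c j).1| + `|(c j).2| <= M.
    rewrite /M (bigD1 j)//= lerDl; apply: sumr_ge0 => i _; exact: addr_ge0.
  exists M => m k hm hk hmk.
  rewrite /del (dirDE sF hF)//; [|exact: ord_leW o0|exact: elt_Jminus|exact: elt_ord_le].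
  rewrite (_ : coords c (elt m k) = 0) ?linear0//; apply/rowP => j; rewrite !mxE eltE.
  case: andP => // -[/eqP e1 /eqP e2]; have := hM j; rewrite e1 e2.
  by case/orP: hmk => h; lia.
have gb m : g m \in @ubounded C (C : lmodType C).
  apply/uboundedP; have [M hM] := van (bound_max N0 (fun=> 0)) (bound_maxl _ _).
  exists (Num.max M 0) => j hj; rewrite /g; case: ifP => // hm.
  rewrite hM ?mulr0//; first by lia.
    by apply: le_trans (bound_maxr _ _ _); lia.
  by apply/orP; right; lia.
have Gb : (fun m => Series (gb m) : J0 R) \in @ubounded C (J0 R : lmodType C).
  (* a bound that admits a nonzero derivative in every degree that has one, so
     that only finitely many degrees do *)
  have /choice[K hK] : forall n, exists k, (exists k', del n k' <> 0) -> del n k <> 0.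
    move=> n; have [[k hk]|h] := pselect (exists k', del n k' <> 0); first by exists k.
    by exists 0 => /h.
  have [M hM] := van (bound_max N0 K) (bound_maxl _ _).
  apply/uboundedP; exists M => m hm; apply: J0P => j; rewrite /= /g; case: ifP => // m0.
  have [->|e] := eqVneq (del (- m) (- j)) 0; first by rewrite mulr0.
  have : del (- m) (K (- m)) <> 0 by apply: hK; exists (- j); apply/eqP.
  by case; apply: hM; [lia|exact: bound_maxr|apply/orP; left; lia].
exists (Series Gb) => X hX.
have [N [oL oX _]] := ord_le_ex3 L X X; have [n [c [F [sF hF]]]] := sp N.
apply: (is_derive_eq (dirD_on sF hF hL oL hX oX)).
pose GN := \sum_(j <- enum 'I_n) 'd F (coords c L) (delta_mx 0 j) *: dual lnq (c j).1 (c j).2.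
have hGN Y : pair Y GN = 'd F (coords c L) (coords c Y).
  rewrite diff_coords pair_sumr; apply: eq_bigr => j _.
  by rewrite pairZr pair_dual mulrC.
rewrite -hGN; apply/eqP; rewrite -subr_eq0 -pairBr; apply/eqP.
apply: (pair_ord hX oX) => m j m0 hj; rewrite !serB.
apply/eqP; rewrite subr_eq0 /= /g m0; apply/eqP.
have -> : del (- m) (- j) = pair (elt (- m) (- j)) GN.
  rewrite hGN /del (dirDE sF hF)//; first by apply: elt_Jminus; lia.
  by apply: elt_ord_le; lia.
by rewrite pair_elt !opprK mulKf// expfz_neq0// qpow_neq0.
Qed.

End SmoothFunctionals.

(** * Differentiable curves and smooth maps of symbols *)

Section ScalarDerivatives.
Variable K : numFieldType.

Lemma is_derive_mulE (f g : K -> K) (t df dg : K) :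
  is_derive t (1 : K) f df -> is_derive t (1 : K) g dg ->
  is_derive t (1 : K) (fun s => f s * g s) (df * g t + f t * dg).
Proof.
move=> hf hg; apply: (is_derive_eq (is_deriveM hf hg)).
by rewrite addrC [g t *: df]mulrC.
Qed.
Lemma is_derive_addE (f g : K -> K) (t df dg : K) :
  is_derive t (1 : K) f df -> is_derive t (1 : K) g dg ->
  is_derive t (1 : K) (fun s => f s + g s) (df + dg).
Proof. by move=> hf hg; apply: (is_deriveD hf hg). Qed.
Lemma is_derive_cstE (c t : K) : is_derive t (1 : K) (fun _ : K => c) 0.
Proof. exact: is_derive_cst. Qed.
Lemma is_derive_scaleE (c : K) (f : K -> K) (t df : K) :
  is_derive t (1 : K) f df -> is_derive t (1 : K) (fun s => c * f s) (c * df).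
Proof.
move=> hf; apply: (is_derive_eq (is_derive_mulE (is_derive_cstE c t) hf)).
by rewrite mul0r add0r.
Qed.
Lemma is_derive_sumE (I : Type) (s : seq I) (f : I -> K -> K) (t : K) (df : I -> K) :
  (forall i, is_derive t (1 : K) (f i) (df i)) ->
  is_derive t (1 : K) (fun u => \sum_(i <- s) f i u) (\sum_(i <- s) df i).
Proof.
move=> h; elim: s => [|i s IH].
  rewrite big_nil (_ : (fun _ => _) = (fun=> 0)); first exact: is_derive_cstE.
  by apply/funext => u; rewrite big_nil.
rewrite big_cons (_ : (fun _ => _) = (fun u => f i u + \sum_(j <- s) f j u)).
  exact: is_derive_addE.
by apply/funext => u; rewrite big_cons.
Qed.
Lemma is_derive_idE (t : K) : is_derive t (1 : K) (fun s : K => s) 1.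
Proof. exact: is_derive_id. Qed.
End ScalarDerivatives.

Section Fields.
Variables (R : realType) (lnq : CC R).
Local Notation C := (CC R).
Local Notation Psi := (PsiD R).
Implicit Types (phi chi psi : functional R) (L X Y : PsiD R).
Local Notation qpow := (qpow lnq).
Local Notation mulD := (mulD lnq).
Local Notation pair := (pair lnq).

Lemma ord_restr p (f : int -> int) k (P : pred int) (A : Psi) : ord_in p f k A -> ord_in p f k (restr P A).
Proof.
move=> [hA fA]; split=> [n hn|n j hj] /=; case: ifP => // _; [exact: hA|exact: fA].
Qed.

Lemma ord_G0 N L : G0 L -> ord_le N L -> ord_in 0 (fun n => if n < 0 then N n else 0) 0 L.
Proof.
move=> hL oL; split; first exact: G0_above.
move=> n; rewrite addr0; case: ltP => hn j hj; first exact: oL.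
have [hn0|hn0] := ltP 0 n; first by rewrite (G0_above hL).
have -> : n = 0 by lia.
by rewrite (G0_0 hL) /= gt_eqF.
Qed.

Lemma ord_in_add p (f : int -> int) k (A B : Psi) :
  ord_in p f k A -> ord_in p f k B -> ord_in p f k (A + B).
Proof.
move=> [hA fA] [hB fB]; split=> [n hn|n j hj]; first by rewrite serD hA ?hB ?addr0.
by rewrite !serD fA ?fB ?addr0.
Qed.

Lemma ord_dual n k : ord_in (- n) (fun=> 0) (- k) (dual lnq n k).
Proof.
split=> [m hm|m j hj]; first by rewrite /= gt_eqF.
rewrite /dual /=; case: eqP => // _; rewrite serZ /= gt_eqF ?scaler0//; lia.
Qed.

(** Coefficientwise differentiability alone is not preserved by products,
    whose coefficients are sums over a range that depends on the parameter;
    the uniform bound fixes the range. *)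
Definition dcurve (A : C -> Psi) (t : C) (A' : Psi) : Prop :=
  (exists p (f : int -> int), (forall s, ord_in p f 0 (A s)) /\ ord_in p f 0 A') /\
  forall n k, is_derive t (1 : C) (fun s => A s n k) (A' n k).

Lemma dcurve_cst A t : dcurve (fun=> A) t 0.
Proof.
split=> [|n k]; last exact: (@is_derive_cstE C).
have [p [f h]] := ord_in_ex A; exists p, f; split=> //; split=> // n j _.
Qed.

Lemma dcurveD A B t A' B' : dcurve A t A' -> dcurve B t B' ->
  dcurve (fun s => A s + B s) t (A' + B').
Proof.
move=> [[p [f [hA hA']]] dA] [[q [g [hB hB']]] dB]; split.
  exists (Num.max p q), (fun n => Num.max (f n) (g n)).
  by split=> [s|]; apply: ord_inD.
move=> n k; rewrite !serD (_ : (fun s => _) = (fun s => A s n k + B s n k)); last first.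
  by apply/funext => s; rewrite !serD.
exact: (@is_derive_addE C _ _ t _ _ (dA n k) (dB n k)).
Qed.

Lemma dcurveZ (c : C) A t A' : dcurve A t A' -> dcurve (fun s => c *: A s) t (c *: A').
Proof.
move=> [[p [f [hA hA']]] dA]; split.
  by exists p, f; split=> [s|]; apply: ord_inZ.
move=> n k; rewrite !serZ (_ : (fun s => _) = (fun s => c * A s n k)); last first.
  by apply/funext => s; rewrite !serZ.
exact: (@is_derive_scaleE C c _ t _ (dA n k)).
Qed.

Lemma dcurve_cdiag (u : int -> C) A t A' : dcurve A t A' ->
  dcurve (fun s => cdiag u (A s)) t (cdiag u A').
Proof.
move=> [[p [f [hA hA']]] dA]; split.
  by exists p, f; split=> [s|]; apply: ord_cdiag.
by move=> n k; exact: (@is_derive_scaleE C (u k) _ t _ (dA n k)).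
Qed.

Lemma dcurve_mulD A B t A' B' : dcurve A t A' -> dcurve B t B' ->
  dcurve (fun s => mulD (A s) (B s)) t (mulD A' (B t) + mulD (A t) B').
Proof.
move=> [[p [f [hA hA']]] dA] [[q [g [hB hB']]] dB]; split.
  exists (p + q), (ord_conv p q f g); split=> [s|].
    by have h := ord_mulD lnq (hA s) (hB s); rewrite addr0 in h.
  have h1 := ord_mulD lnq hA' (hB t); have h2 := ord_mulD lnq (hA t) hB'.
  by rewrite addr0 in h1 h2; exact: (ord_in_add h1 h2).
move=> n m; rewrite !serD (mulD_coef lnq n m hA' (hB t)) (mulD_coef lnq n m (hA t) hB').
rewrite (_ : (fun s => _) = (fun s => \sum_(i <- irange (n - q) p)
   \sum_(j <- irange (m - g (n - i)) (f i)) A s i j * (qpow i%:~R ^ (m - j) * B s (n - i) (m - j)))); last first.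
  by apply/funext => s; rewrite (mulD_coef lnq n m (hA s) (hB s)).
rewrite -big_split /=; apply: (@is_derive_sumE C) => i.
rewrite -big_split /=; apply: (@is_derive_sumE C) => j.
by apply: (@is_derive_mulE C _ _ t) => //; apply: (@is_derive_scaleE C).
Qed.

Lemma dcurve_eq A t A' A'' : dcurve A t A' -> A' = A'' -> dcurve A t A''.
Proof. by move=> h <-. Qed.

Lemma dcurve_unique A t A' A'' : dcurve A t A' -> dcurve A t A'' -> A' = A''.
Proof.
move=> [_ h1] [_ h2]; apply: PsiP => n k; exact: (is_derive_unique (h1 n k) (h2 n k)).
Qed.

Lemma dcurve_zero A t A' n k : dcurve A t A' -> (forall s, A s n k = 0) -> A' n k = 0.
Proof.
move=> [_ h] h0; apply: (is_derive_unique (h n k)).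
have -> : (fun s => A s n k) = (fun=> 0) by apply/funext.
exact: (@is_derive_cstE C).
Qed.

Lemma dcurve_Jminus A t A' : (forall s, Jminus (A s)) -> dcurve A t A' -> Jminus A'.
Proof. by move=> jA dA n hn; apply: J0P => k; apply: (dcurve_zero dA) => s; rewrite jA. Qed.

Lemma dcurve_line L X : dcurve (fun t => L + t *: X) 0 X.
Proof.
have [p [f hf]] := ord_in_ex L; have [q [g hg]] := ord_in_ex X; split.
  exists (Num.max p q), (fun n => Num.max (f n) (g n)); split=> [s|].
    by apply: ord_inD => //; apply: ord_inZ.
  split=> [n hn|n j hj]; first by apply: hg.1; lia.
  by apply: (hg.2 n j); lia.
move=> n k; have h := @is_derive_addE C _ _ 0 _ _ (@is_derive_cstE C (L n k) 0)
  (@is_derive_mulE C _ _ 0 _ _ (@is_derive_idE C 0) (@is_derive_cstE C (X n k) 0)).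
rewrite (_ : (fun s => _) = (fun s : C => L n k + s * X n k)); last first.
  by apply/funext => s; rewrite !serD !serZ.
by apply: (is_derive_eq h); rewrite add0r mul1r mul0r addr0.
Qed.

Lemma dcurve_coef A t A' n k : dcurve A t A' -> is_derive t (1 : C) (fun s => A s n k) (A' n k).
Proof. by case=> _; apply. Qed.

(** As for curves, the bound, uniform on {L | ord_z a_i <= N_i}, makes
    products of smooth maps smooth. *)
Definition smap_on (N : int -> int) (Y : Psi -> Psi) : Prop :=
  (exists p (f : int -> int), forall L, G0 L -> ord_le N L -> ord_in p f 0 (Y L)) /\
  forall n k, smooth_on N (fun L => Y L n k).

Lemma smap_cst N A : smap_on N (fun=> A).
Proof.
split=> [|n k]; last exact: smooth_on_cst.
by have [p [f h]] := ord_in_ex A; exists p, f.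
Qed.
Lemma smap_id N : smap_on N id.
Proof.
split=> [|n k]; last exact: smooth_on_coef.
by exists 0, (fun n => if n < 0 then N n else 0) => L hL oL; apply: ord_G0 hL oL.
Qed.
Lemma smap_D N (Y Z : Psi -> Psi) : smap_on N Y -> smap_on N Z -> smap_on N (fun L => Y L + Z L).
Proof.
move=> [[p [f hf]] sY] [[q [g hg]] sZ]; split=> [|n k].
  exists (Num.max p q), (fun n => Num.max (f n) (g n)) => L hL oL.
  by apply: ord_inD; [exact: hf|exact: hg].
apply: (smooth_on_ext _ (smooth_onD (sY n k) (sZ n k))) => L _ _.
by rewrite !serD.
Qed.
Lemma smap_Z N (c : C) (Y : Psi -> Psi) : smap_on N Y -> smap_on N (fun L => c *: Y L).
Proof.
move=> [[p [f hf]] sY]; split=> [|n k].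
  by exists p, f => L hL oL; apply: ord_inZ; apply: hf.
apply: (smooth_on_ext _ (smooth_onZ c (sY n k))) => L _ _.
by rewrite !serZ.
Qed.
Lemma smap_B N (Y Z : Psi -> Psi) : smap_on N Y -> smap_on N Z -> smap_on N (fun L => Y L - Z L).
Proof.
move=> hY hZ; have := smap_D hY (smap_Z (-1) hZ).
by under [X in smap_on N X -> _]eq_fun do rewrite scaleN1r.
Qed.
Lemma smap_cdiag N (u : int -> C) (Y : Psi -> Psi) : smap_on N Y -> smap_on N (fun L => cdiag u (Y L)).
Proof.
move=> [[p [f hf]] sY]; split=> [|n k].
  by exists p, f => L hL oL; apply: ord_cdiag; apply: hf.
exact: (smooth_onZ (u k) (sY n k)).
Qed.
Lemma smap_restr N (P : pred int) (Y : Psi -> Psi) : smap_on N Y -> smap_on N (fun L => restr P (Y L)).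
Proof.
move=> [[p [f hf]] sY]; split=> [|n k].
  by exists p, f => L hL oL; apply: ord_restr; apply: hf.
by rewrite /=; case: (P n); [apply: sY|apply: smooth_on_cst].
Qed.
Lemma smap_mulD N (Y Z : Psi -> Psi) : smap_on N Y -> smap_on N Z -> smap_on N (fun L => mulD (Y L) (Z L)).
Proof.
move=> [[p [f hf]] sY] [[q [g hg]] sZ]; split=> [|n m].
  exists (p + q), (ord_conv p q f g) => L hL oL.
  by have := ord_mulD lnq (hf L hL oL) (hg L hL oL); rewrite addr0; apply.
apply: (@smooth_on_ext _ N (fun L => \sum_(i <- irange (n - q) p)
   \sum_(j <- irange (m - g (n - i)) (f i)) Y L i j * (qpow i%:~R ^ (m - j) * Z L (n - i) (m - j)))).
  by move=> L hL oL; rewrite (mulD_coef lnq n m (hf L hL oL) (hg L hL oL)).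
apply: smooth_on_sum => i; apply: smooth_on_sum => j.
by apply: smooth_onM => //; apply: smooth_onZ.
Qed.

Lemma smap_dcurve (Y : Psi -> Psi) L X : (forall N, smap_on N Y) -> G0 L -> Jminus X ->
  exists Y', dcurve (fun t => Y (L + t *: X)) 0 Y'.
Proof.
move=> sY hL hX; have [N [oL oX _]] := ord_le_ex3 L X X.
have [[p [f hf]] _] := sY N.
have bt t : ord_in p f 0 (Y (L + t *: X)).
  by apply: hf; [apply: G0D => //; apply: JminusZ|apply: ord_leD => //; apply: ord_leZ].
have sc n k : smooth (fun L => Y L n k) by move=> N'; have [_] := sY N'; apply.
pose y n k := dirD (fun L => Y L n k) X L.
have hy n k := smooth_is_derive (sc n k) hL hX.
have y0 n k : (forall t : C, Y (L + t *: X) n k = 0) -> y n k = 0.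
  move=> h0; apply: (is_derive_unique (hy n k)).
  have -> : (fun t : C => Y (L + t *: X) n k) = (fun=> 0) by apply/funext.
  exact: (@is_derive_cstE C).
have yb n : y n \in @ubounded C (C : lmodType C).
  by apply/uboundedP; exists (f n + 0) => k hk; apply: y0 => t; apply: (bt t).2.
have Yb : (fun n => Series (yb n) : J0 R) \in @ubounded C (J0 R : lmodType C).
  apply/uboundedP; exists p => n hn; apply: J0P => k; apply: y0 => t.
  by rewrite (bt t).1.
exists (Series Yb); split=> //; exists p, f; split=> //; split=> [n hn|n k hk].
  by apply: J0P => k; apply: y0 => t; rewrite (bt t).1.
by apply: y0 => t; apply: (bt t).2.
Qed.

Lemma smooth_dirD psi (Y : Psi -> Psi) : smooth psi -> (forall N, smap_on N Y) ->
  (forall L, G0 L -> Jminus (Y L)) -> smooth (fun L => dirD psi (Y L) L).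
Proof.
move=> sp sY hY N; have [[p [f hf]] cY] := sY N.
have [n [c [F [sF hF]]]] := sp (bound_max N f).
apply: (@smooth_on_ext _ N (fun L => \sum_(j <- enum 'I_n)
   Y L (c j).1 (c j).2 * 'd F (coords c L) (delta_mx 0 j))).
  move=> L hL oL; rewrite -diff_coords; apply/esym/(dirDE sF hF) => //; last 2 first.
  - exact: hY.
  - by move=> m k hm hk; apply: (hf L hL oL).2; have := bound_maxr N f m; lia.
  by apply: ord_leW oL; exact: bound_maxl.
apply: smooth_on_sum => j; apply: smooth_onM; first exact: cY.
exists n, c, (fun x => 'd F x (delta_mx 0 j)); split=> //.
exact: smooth_n_diff.
Qed.

Lemma dirD2E N n (c : 'I_n -> int * int) (F : 'rV[C]_n -> C) psi L X Y :
  smooth_n F -> (forall L, G0 L -> ord_le N L -> psi L = F (coords c L)) ->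
  G0 L -> ord_le N L -> Jminus X -> ord_le N X -> Jminus Y -> ord_le N Y ->
  dirD (dirD psi X) Y L = 'd (fun y => 'd F y (coords c X)) (coords c L) (coords c Y).
Proof.
move=> sF hF hL oL hX oX hY oY; rewrite {1}/dirD.
rewrite (_ : (fun t : C => _) = (fun t => (fun y => 'd F y (coords c X)) (coords c L + t *: coords c Y))); last first.
  apply/funext => t; rewrite (dirDE sF hF) ?coordsD ?coordsZ//.
    by apply: G0D => //; apply: JminusZ.
  by apply: ord_leD => //; apply: ord_leZ.
have sG := smooth_n_diff (coords c X) sF.
have := @line_derive C _ (fun y => 'd F y (coords c X)) (coords c L) (coords c Y) 0 (@smooth_n_differentiable R n _ _ sG).
by rewrite !scale0r !addr0 => -[].
Qed.

(** Chain rule for the derivative of psi along the field Z: the first term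
    differentiates psi with Z frozen, after an exchange of the derivatives
    along X and Z L. *)
Lemma dirD_dirD psi L X (Z : Psi -> Psi) Z' : smooth psi -> G0 L -> Jminus X ->
  (forall N, smap_on N Z) -> (forall L, G0 L -> Jminus (Z L)) ->
  dcurve (fun t => Z (L + t *: X)) 0 Z' ->
  is_derive (0 : C) (1 : C) (fun t : C => dirD psi (Z (L + t *: X)) (L + t *: X))
    (dirD (dirD psi (Z L)) X L + dirD psi Z' L).
Proof.
move=> sp hL hX sZ hZ dZ.
have gt t : G0 (L + t *: X) by apply: G0D => //; apply: JminusZ.
have hZ' := dcurve_Jminus (fun t => hZ _ (gt t)) dZ.
have [N [oL oX oZ']] := ord_le_ex3 L X Z'.
have [[p [f hf]] _] := sZ N; pose N' := bound_max N f.
have NN' n : N n <= N' n by exact: bound_maxl.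
have [n [c [F [sF hF]]]] := sp N'.
have ot t : ord_le N (L + t *: X) by apply: ord_leD => //; apply: ord_leZ.
have oZ t : ord_le N' (Z (L + t *: X)).
  move=> m k hm hk; apply: (hf _ (gt t) (ot t)).2; rewrite addr0.
  by apply: le_lt_trans hk; exact: bound_maxr.
have L0 : L + (0 : C) *: X = L by rewrite scale0r addr0.
pose x := coords c L; pose u := coords c X; pose z0 := coords c (Z L).
have e2 t : dirD psi (Z (L + t *: X)) (L + t *: X) = \sum_(j <- enum 'I_n)
    Z (L + t *: X) (c j).1 (c j).2 * 'd F (x + t *: u) (delta_mx 0 j).
  by rewrite (dirDE sF hF (gt t) (ord_leW NN' (ot t)) (hZ _ (gt t)) (oZ t)) coordsD coordsZ diff_coords.
rewrite (_ : (fun t : C => _) = (fun t => \sum_(j <- enum 'I_n)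
    Z (L + t *: X) (c j).1 (c j).2 * 'd F (x + t *: u) (delta_mx 0 j))); last exact/funext.
have hj (j : 'I_n) : is_derive (0 : C) (1 : C)
   (fun t : C => Z (L + t *: X) (c j).1 (c j).2 * 'd F (x + t *: u) (delta_mx 0 j))
   (Z' (c j).1 (c j).2 * 'd F x (delta_mx 0 j)
    + Z L (c j).1 (c j).2 * 'd (fun y => 'd F y (delta_mx 0 j)) x u).
  have sG := smooth_n_diff (delta_mx 0 j) sF.
  have h1 := @line_derive C _ (fun y => 'd F y (delta_mx 0 j)) x u 0 (@smooth_n_differentiable R n _ _ sG).
  have h2 := dcurve_coef (c j).1 (c j).2 dZ.
  have h := @is_derive_mulE C _ _ 0 _ _ h2 h1.
  by move: h; rewrite L0 !scale0r !addr0.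
apply: (is_derive_eq (@is_derive_sumE C _ (enum 'I_n) _ 0 _ hj)).
rewrite big_split /= addrC; congr (_ + _).
  have oZ0 : ord_le N' (Z L) by have := oZ 0; rewrite L0.
  have -> : dirD (dirD psi (Z L)) X L = 'd (fun y => 'd F y z0) x u.
    exact: (dirD2E sF hF hL (ord_leW NN' oL) (hZ L hL) oZ0 hX (ord_leW NN' oX)).
  apply/esym; transitivity ('d (fun y => 'd F y u) x z0); first by exact: (@schwarz R n F x z0 u sF).
  apply: (etrans (@diff_coords R n c (fun y => 'd F y u) x (Z L))).
  apply: eq_bigr => j _; congr (_ * _).
  exact: (@schwarz R n F x u (delta_mx 0 j) sF).
rewrite (dirDE sF hF)//; last 2 first.
- exact: ord_leW NN' oL.
- exact: ord_leW NN' oZ'.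
by rewrite diff_coords.
Qed.

Lemma dirD_sym psi L X Y : smooth psi -> G0 L -> Jminus X -> Jminus Y ->
  dirD (dirD psi X) Y L = dirD (dirD psi Y) X L.
Proof.
move=> sp hL hX hY.
have [N [oL oX oY]] := ord_le_ex3 L X Y.
have [n [c [F [sF hF]]]] := sp N.
have sw := @schwarz R n F (coords c L) (coords c X) (coords c Y) sF.
exact: (etrans (dirD2E sF hF hL oL hX oX hY oY) (etrans sw (esym (dirD2E sF hF hL oL hY oY hX oX)))).
Qed.

Lemma smooth_pair V : smooth (fun L => pair L V).
Proof.
move=> N; have := (smap_mulD (smap_id N) (smap_cst N V)).2 0 0; exact.
Qed.

Lemma dirD_pair V L X : dirD (fun L => pair L V) X L = pair X V.
Proof.
have h := dcurve_coef 0 0 (dcurve_mulD (dcurve_line L X) (dcurve_cst V 0)).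
move: h; rewrite mulD0r addr0 => -[_ h]; exact: h.
Qed.

End Fields.

(** * The r-matrix *)

Section Bracket.
Variables (R : realType) (lnq : CC R).
Local Notation C := (CC R).
Local Notation Psi := (PsiD R).
Implicit Types (A B L U V W X Y Z : PsiD R) (x y z w f g h : J0 R).
Local Notation hhat := (hhat lnq).
Local Notation mulD := (mulD lnq).
Local Notation sigma := (sigma lnq).
Local Notation pair := (pair lnq).

Lemma halves (u : J0 R) : 2^-1 *: u + 2^-1 *: u = u.
Proof. by rewrite -scalerDl -[2^-1]mul1r -splitr scale1r. Qed.

Lemma rmatE X : rmat X = Pgeq0 X - 2^-1 *: X - 2^-1 *: ofJ0 (P0 X).
Proof.
apply: serP => n; rewrite !serB !serZ serB /= /P0.
have [hn|hn|->] := ltgtP n 0.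
- by rewrite !sub0r scalerN scaler0 subr0.
- by rewrite !subr0 scaler0 subr0 -{2}(halves (X n)) addrK.
- by rewrite subrr scaler0 -{1}(halves (X 0)) addrK subrr.
Qed.

Lemma rmatD X Y : rmat (X + Y) = rmat X + rmat Y.
Proof.
have hp P (A B : Psi) : restr P (A + B) = restr P A + restr P B.
  by apply: serP => n; rewrite !serD /=; case: ifP => //; rewrite addr0.
by rewrite /rmat /Pplus /Pminus !hp opprD addrACA scalerDr.
Qed.
Lemma rmatZ c X : rmat (c *: X) = c *: rmat X.
Proof.
have hp P (A : Psi) : restr P (c *: A) = c *: restr P A.
  by apply: serP => n; rewrite !serZ /=; case: ifP => //; rewrite scaler0.
by rewrite /rmat /Pplus /Pminus !hp -scalerBr !scalerA mulrC.
Qed.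
Lemma rmat_sigma b X : rmat (sigma b X) = sigma b (rmat X).
Proof.
have hp P (A : Psi) : restr P (sigma b A) = sigma b (restr P A).
  by apply: serP => n; rewrite !sigmaE /=; case: ifP => //; rewrite hhat0.
by rewrite /rmat /Pplus /Pminus !hp sigmaZ sigmaB.
Qed.

Definition Jgeq0 A := forall n : int, n < 0 -> A n = 0.

Lemma mulD_0 A B : (forall i : int, i != 0 -> A i = 0 \/ B (- i) = 0) ->
  mulD A B 0 = mulJ (A 0) (B 0).
Proof.
move=> h; rewrite /= (@fsumT1 _ 0) ?subr0 ?hhat_exp0// => i /h.
by rewrite sub0r => -[] ->; rewrite ?mulJ0l ?hhat0 ?mulJ0r.
Qed.
Lemma Jgeq0_mulD0 A B : Jgeq0 A -> Jgeq0 B -> mulD A B 0 = mulJ (A 0) (B 0).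
Proof.
move=> hA hB; apply: mulD_0 => i hi.
by have [h|h] := ltP i 0; [left; apply: hA|right; apply: hB; lia].
Qed.
Lemma Jleq0_mulD0 A B : Jleq0 A -> Jleq0 B -> mulD A B 0 = mulJ (A 0) (B 0).
Proof.
move=> hA hB; apply: mulD_0 => i hi.
by have [h|h] := ltP 0 i; [left; apply: hA|right; apply: hB; lia].
Qed.
Lemma Jgeq0M A B : Jgeq0 A -> Jgeq0 B -> Jgeq0 (mulD A B).
Proof.
move=> hA hB n hn; rewrite /=; apply: fsbig1 => i _.
have [h|h] := ltP i 0; first by rewrite hA ?mulJ0l.
by rewrite hB ?hhat0 ?mulJ0r//; lia.
Qed.
Lemma Jleq0M A B : Jleq0 A -> Jleq0 B -> Jleq0 (mulD A B).
Proof.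
move=> hA hB n hn; rewrite /=; apply: fsbig1 => i _.
have [h|h] := ltP 0 i; first by rewrite hA ?mulJ0l.
by rewrite hB ?hhat0 ?mulJ0r//; lia.
Qed.

Lemma pair_ofJ0 f A : pair (ofJ0 f) A = int_ (mulJ f (P0 A)).
Proof. by rewrite /Defs.pair /Tr /P0 mulD_ofJ0l. Qed.
Lemma pair_sigma b A B : pair (sigma b A) (sigma b B) = pair A B.
Proof. by rewrite /Defs.pair -sigmaM Tr_sigma. Qed.
Lemma pairC A B : pair A B = pair B A.
Proof. exact: TrC. Qed.
Lemma pairA A B D : pair A (mulD B D) = pair (mulD A B) D.
Proof. by rewrite /Defs.pair mulDA. Qed.
Lemma pairCA A B D : pair A (mulD B D) = pair (mulD D A) B.
Proof. by rewrite /Defs.pair mulDA TrC mulDA. Qed.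

Lemma rmat_up X : Jgeq0 (rmat X + 2^-1 *: X).
Proof.
move=> n hn; rewrite serD /rmat !serZ serB /= hn ltNge ltW//=.
by rewrite sub0r scalerN addNr.
Qed.
Lemma rmat_down X : Jleq0 (rmat X - 2^-1 *: X).
Proof.
move=> n hn; rewrite serB /rmat !serZ serB /= hn ltNge ltW//=.
by rewrite subr0 subrr.
Qed.
Lemma rmat_0 X : rmat X 0 = 0.
Proof. by rewrite /rmat serZ serB /= subrr scaler0. Qed.

(** Since r + 1/2 and r - 1/2 map to J_{>=0} and J_{<=0}, the element r X + f
    is (P + Q)/2 for X = P - Q with P and Q in these two subalgebras, for any
    f in J_0. *)
Lemma rmat_halves X f : exists P Q : Psi, [/\ Jgeq0 P, Jleq0 Q,
  rmat X + ofJ0 f = 2^-1 *: (P + Q), X = P + (-1) *: Q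
  & P 0 = f + 2^-1 *: X 0 /\ Q 0 = f - 2^-1 *: X 0].
Proof.
exists (rmat X + 2^-1 *: X + ofJ0 f), (rmat X - 2^-1 *: X + ofJ0 f); split.
- by move=> n hn; rewrite serD (@rmat_up X n hn) add0r ofJ0E lt_eqF.
- by move=> n hn; rewrite serD (@rmat_down X n hn) add0r ofJ0E gt_eqF.
- rewrite addrACA [X in 2^-1 *: (X + _)]addrACA subrr addr0 addrACA scalerDr.
  by apply: serP => n; rewrite [RHS]serD !serZ halves.
- rewrite scaleN1r opprD addrACA subrr addr0 opprB (addrC (rmat X)) addrACA subrr addr0.
  by apply: serP => n; rewrite serD serZ halves.
- move: (rmat X) (rmat_0 X) => r r0.
  by rewrite !serD serN !serZ r0 !add0r !ofJ0E eqxx ![_ + f]addrC.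
Qed.

Lemma pair_rmat A B : pair (rmat A) B = - pair A (rmat B).
Proof.
have core (P Q P' Q' : Psi) : pair P P' = pair Q Q' ->
    pair (2^-1 *: (P + Q)) (P' + (-1) *: Q') = - pair (P + (-1) *: Q) (2^-1 *: (P' + Q')).
  by move=> e; rewrite !(pairZl, pairZr, pairDl, pairDr) e; field.
have [P [Q [hP hQ er eX [P0 Q0]]]] := rmat_halves A 0.
have [P' [Q' [hP' hQ' er' eX' [P'0 Q'0]]]] := rmat_halves B 0.
have z : ofJ0 (0 : J0 R) = 0 by rewrite -(scale0r 0) ofJ0Z !scale0r.
rewrite z addr0 in er; rewrite z addr0 in er'.
rewrite er er' [in LHS]eX' [in RHS]eX; apply: core.
rewrite /Defs.pair /Tr /Defs.P0 (Jgeq0_mulD0 hP hP') (Jleq0_mulD0 hQ hQ') P0 P'0 Q0 Q'0.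
by rewrite !sub0r !add0r mulJNl mulJNr opprK.
Qed.

(** The invariant trilinear form Tr([A, B] D). *)
Definition tri A B D : C := Tr (mulD (mulD A B) D) - Tr (mulD (mulD B A) D).

Lemma tri_cyc A B D : tri A B D = tri B D A.
Proof. by rewrite /tri -(mulDA lnq A) (TrC lnq A) (TrC lnq (mulD B A)) mulDA. Qed.
Lemma triDl A A' B D : tri (A + A') B D = tri A B D + tri A' B D.
Proof. rewrite /tri !mulDDl mulDDr mulDDl !TrD; ring. Qed.
Lemma triZl c A B D : tri (c *: A) B D = c * tri A B D.
Proof. rewrite /tri !mulDZl mulDZr mulDZl !TrZ; ring. Qed.
Lemma triDm A B B' D : tri A (B + B') D = tri A B D + tri A B' D.
Proof. by rewrite tri_cyc triDl -!(tri_cyc A). Qed.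
Lemma triZm c A B D : tri A (c *: B) D = c * tri A B D.
Proof. by rewrite tri_cyc triZl -(tri_cyc A). Qed.
Lemma triDr A B D D' : tri A B (D + D') = tri A B D + tri A B D'.
Proof. by rewrite -tri_cyc triDl !(tri_cyc _ A B). Qed.
Lemma triZr c A B D : tri A B (c *: D) = c * tri A B D.
Proof. by rewrite -tri_cyc triZl (tri_cyc _ A B). Qed.

(** The constant term of a product in this subalgebra is the product of the
    constant terms, and J_0 is commutative. *)
Lemma tri_geq0 A B D : Jgeq0 A -> Jgeq0 B -> Jgeq0 D -> tri A B D = 0.
Proof.
move=> hA hB hD; rewrite /tri /Tr /P0 !Jgeq0_mulD0//; try exact: Jgeq0M.
by rewrite (mulJC (A 0)) subrr.
Qed.
Lemma tri_leq0 A B D : Jleq0 A -> Jleq0 B -> Jleq0 D -> tri A B D = 0.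
Proof.
move=> hA hB hD; rewrite /tri /Tr /P0 !Jleq0_mulD0//; try exact: Jleq0M.
by rewrite (mulJC (A 0)) subrr.
Qed.

(** The modified Yang-Baxter identity, paired with Z. Expand all entries by
    the two halves P and Q: the terms with three P or three Q vanish, and each
    of the other terms appears with coefficient -1/4 times its sign in Tr([X,
    Y] Z). *)
Lemma jacobi_rmat X Y Z f g h :
  tri (rmat X + ofJ0 f) (rmat Y + ofJ0 g) Z
  + tri (rmat Y + ofJ0 g) (rmat Z + ofJ0 h) X
  + tri (rmat Z + ofJ0 h) (rmat X + ofJ0 f) Y
  = - 4^-1 * tri X Y Z.
Proof.
have linear_p a b c (P1 P2 P3 M1 M2 M3 : Psi) :
    tri P1 P2 P3 = 0 -> tri M1 M2 M3 = 0 ->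
    a = P1 + (-1) *: M1 -> b = P2 + (-1) *: M2 -> c = P3 + (-1) *: M3 ->
  tri (2^-1 *: (P1 + M1)) (2^-1 *: (P2 + M2)) c
  + tri (2^-1 *: (P2 + M2)) (2^-1 *: (P3 + M3)) a
  + tri (2^-1 *: (P3 + M3)) (2^-1 *: (P1 + M1)) b = - 4^-1 * tri a b c.
  move=> hP hM -> -> ->.
  rewrite (tri_cyc (2^-1 *: (P3 + M3))) -(tri_cyc (P1 + -1 *: M1)).
  rewrite !(triZl, triZm, triZr, triDl, triDm, triDr) hP hM.
  by field.
have [P1 [Q1 [hP1 hQ1 er1 eX1 _]]] := rmat_halves X f.
have [P2 [Q2 [hP2 hQ2 er2 eX2 _]]] := rmat_halves Y g.
have [P3 [Q3 [hP3 hQ3 er3 eX3 _]]] := rmat_halves Z h.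
rewrite er1 er2 er3.
exact: (linear_p _ _ _ _ _ _ _ _ _ (tri_geq0 hP1 hP2 hP3) (tri_leq0 hQ1 hQ2 hQ3) eX1 eX2 eX3).
Qed.

Section Operators.
Variables (alpha : C) (M : opmatrix R).
Local Notation h := (hhat alpha).
Local Notation h' := (hhat (- alpha)).

(** The J_0-parts of the two components of the formula, after conjugation of
    the second one by D^alpha. *)
Definition f1 x y : J0 R := opa M x + opb M (h' y).
Definition f2 x y : J0 R := h (opc M x + opd M (h' y)).
(** The formula as a bilinear form in the pairs (L U, U L) and (L V, V L), for
    which linearity and skew symmetry take a simple form. *)
Definition Omega (P1 P2 Q1 Q2 : Psi) : C :=
  pair (rmat P1 + ofJ0 (f1 (P0 P1) (P0 P2))) Q1 -
  pair (rmat P2 + ofJ0 (f2 (P0 P1) (P0 P2))) Q2.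
Local Notation star := (star lnq alpha M).

Lemma starE L U V : star L U V = Omega (mulD L U) (mulD U L) (mulD L V) (mulD V L).
Proof.
rewrite /Defs.star /Omega /nablal /nablar -addrA -ofJ0D; congr (_ - _).
have e : P0 (sigma (- alpha) (mulD U L)) = h' (P0 (mulD U L)) by [].
rewrite e addrCA -ofJ0D rmat_sigma -[LHS](pair_sigma alpha) sigmaD !sigmaKV sigma_ofJ0.
by [].
Qed.

Hypothesis admM : admissible M.

Let la : linear (opa M). Proof. by case: admM => -[]. Qed.
Let lb : linear (opb M). Proof. by case: admM => -[]. Qed.
Let lc : linear (opc M). Proof. by case: admM => -[]. Qed.
Let ld : linear (opd M). Proof. by case: admM => -[]. Qed.
Let linD (u : J0 R -> J0 R) : linear u -> forall x y, u (x + y) = u x + u y.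
Proof. by move=> lu x y; have := lu 1 x y; rewrite !scale1r. Qed.
Let lin0 (u : J0 R -> J0 R) : linear u -> u 0 = 0.
Proof. by move=> lu; apply: (addrI (u 0)); rewrite -(linD lu) !addr0. Qed.
Let linZ (u : J0 R -> J0 R) : linear u -> forall c x, u (c *: x) = c *: u x.
Proof. by move=> lu c x; have := lu c x 0; rewrite (lin0 lu) !addr0. Qed.

Lemma f1D x x' y y' : f1 (x + x') (y + y') = f1 x y + f1 x' y'.
Proof. by rewrite /f1 hhatD (linD la) (linD lb) addrACA. Qed.
Lemma f2D x x' y y' : f2 (x + x') (y + y') = f2 x y + f2 x' y'.
Proof. by rewrite /f2 -hhatD (linD lc) (hhatD lnq (- alpha) y y') (linD ld) addrACA. Qed.
Lemma f1Z c x y : f1 (c *: x) (c *: y) = c *: f1 x y.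
Proof. by rewrite /f1 hhatZ (linZ la) (linZ lb) scalerDr. Qed.
Lemma f2Z c x y : f2 (c *: x) (c *: y) = c *: f2 x y.
Proof. by rewrite /f2 hhatZ (linZ lc) (linZ ld) -scalerDr hhatZ. Qed.

Lemma OmegaDl P1 P2 P1' P2' Q1 Q2 :
  Omega (P1 + P1') (P2 + P2') Q1 Q2 = Omega P1 P2 Q1 Q2 + Omega P1' P2' Q1 Q2.
Proof.
rewrite /Omega /P0 !serD f1D f2D !rmatD !ofJ0D.
rewrite !pairDl; ring.
Qed.
Lemma OmegaZl c P1 P2 Q1 Q2 : Omega (c *: P1) (c *: P2) Q1 Q2 = c * Omega P1 P2 Q1 Q2.
Proof.
by rewrite /Omega /P0 !serZ f1Z f2Z !rmatZ !ofJ0Z -!scalerDr !pairZl mulrBr.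
Qed.

Lemma Omega_anti P1 P2 Q1 Q2 : Omega P1 P2 Q1 Q2 = - Omega Q1 Q2 P1 P2.
Proof.
have [_ adj_a adj_d adj_c] := admM.
have ha x x' : int_ (mulJ (opa M x) x') = - int_ (mulJ (opa M x') x).
  by rewrite adj_a mulJC -[- opa M x']scaleN1r mulJZl int_Z mulN1r.
have hd x x' : int_ (mulJ (opd M x) x') = - int_ (mulJ (opd M x') x).
  by rewrite adj_d mulJC -[- opd M x']scaleN1r mulJZl int_Z mulN1r.
have hc x x' : int_ (mulJ (opc M x) x') = int_ (mulJ (opb M x') x).
  by rewrite adj_c mulJC.
have hh x x' : int_ (mulJ (h x) x') = int_ (mulJ x (h' x')).
  by rewrite -[LHS](int_hhat lnq (- alpha)) hhatM hhatK.
rewrite /Omega /f1 /f2; move: (hhat alpha) (hhat (- alpha)) hh => H H' hh.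
rewrite !pairDl.
rewrite !pair_ofJ0.
rewrite (hh (opc M (P0 P1) + opd M (H' (P0 P2))) (P0 Q2)).
rewrite (hh (opc M (P0 Q1) + opd M (H' (P0 Q2))) (P0 P2)).
rewrite !mulJDl.
rewrite !int_D.
rewrite (pair_rmat P1) (pair_rmat P2).
rewrite (pairC P1) (pairC P2).
rewrite ha.
rewrite hd.
rewrite hc.
rewrite -(hc (P0 Q1)).
ring.
Qed.
End Operators.

End Bracket.

(** * Hamiltonian fields and the Jacobi identity for linear functionals *)

#[local] Opaque Defs.mulD Defs.mulJ Defs.hhat cexp rmat.

Section BracketTheory.
Variables (R : realType) (lnq : CC R) (alpha : CC R).
Local Notation C := (CC R).
Local Notation Psi := (PsiD R).
Implicit Types (A B L U V W X Y Z : PsiD R) (x y z w f g : J0 R).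
Local Notation hhat := (hhat lnq).
Local Notation mulD := (mulD lnq).
Local Notation sigma := (sigma lnq).
Local Notation pair := (pair lnq).
Local Notation tri := (tri lnq).
Local Notation h := (hhat alpha).

(** One of the three groups of terms of the Jacobi sum, with the A_i and B_i
    taken from the fields of two of the differentials. The terms in which L
    stands between a first and a second component cancel. *)
Lemma cross_tri L W A1 A2 B1 B2 :
  (pair B1 (mulD (mulD A1 L - mulD L A2) W) - pair B2 (mulD W (mulD A1 L - mulD L A2)))
  - (pair A1 (mulD (mulD B1 L - mulD L B2) W) - pair A2 (mulD W (mulD B1 L - mulD L B2)))
  = - (tri A1 B1 (mulD L W) - tri A2 B2 (mulD W L)).
Proof.
have e1 P Q : pair P (mulD (mulD Q L) W) = Tr (mulD (mulD P Q) (mulD L W)).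
  by rewrite /Defs.pair -(mulDA lnq Q) mulDA.
have e2 P Q : pair P (mulD (mulD L Q) W) = Tr (mulD (mulD P L) (mulD Q W)).
  by rewrite /Defs.pair -(mulDA lnq L) mulDA.
have e3 P Q : pair P (mulD W (mulD Q L)) = Tr (mulD (mulD Q L) (mulD P W)).
  by rewrite /Defs.pair (mulDA lnq P) TrC.
have e4 P Q : pair P (mulD W (mulD L Q)) = Tr (mulD (mulD Q P) (mulD W L)).
  by rewrite /Defs.pair (mulDA lnq W) (mulDA lnq P) TrC (mulDA lnq Q).
have s1 (P Q S : Psi) : pair P (mulD (mulD Q L - mulD L S) W) =
    Tr (mulD (mulD P Q) (mulD L W)) - Tr (mulD (mulD P L) (mulD S W)).
  by rewrite mulDBl pairBr (e1 P Q) (e2 P S).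
have s2 (P Q S : Psi) : pair P (mulD W (mulD Q L - mulD L S)) =
    Tr (mulD (mulD Q L) (mulD P W)) - Tr (mulD (mulD S P) (mulD W L)).
  by rewrite mulDBr pairBr (e3 P Q) (e4 P S).
rewrite (s1 B1 A1 A2) (s2 B2 A1 A2) (s1 A1 B1 B2) (s2 A2 B1 B2) /tri.
ring.
Qed.

Lemma tri_rotate L U V W : tri (mulD L U) (mulD L V) (mulD L W) = tri (mulD U L) (mulD V L) (mulD W L).
Proof.
have e P Q S : Tr (mulD (mulD (mulD L P) (mulD L Q)) (mulD L S))
    = Tr (mulD (mulD (mulD P L) (mulD Q L)) (mulD S L)).
  by rewrite -!mulDA TrC -!mulDA.
by rewrite /tri (e U V W) (e V U W).
Qed.

Section Operators.
Variable (M : opmatrix R).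
Local Notation f1 := (f1 lnq alpha M).
Local Notation f2 := (f2 lnq alpha M).
Local Notation Omega := (Omega lnq alpha M).
Local Notation star := (star lnq alpha M).

Definition fieldA1 L U := rmat (mulD L U) + ofJ0 (f1 (P0 (mulD L U)) (P0 (mulD U L))).
Definition fieldA2 L U := rmat (mulD U L) + ofJ0 (f2 (P0 (mulD L U)) (P0 (mulD U L))).
(** With [star_hamfield] and nondegeneracy, the bar of the Hamiltonian field
    of a functional with differential U. *)
Definition hamfield L U := mulD (fieldA1 L U) L - mulD L (fieldA2 L U).

Lemma star_hamfield L U V : star L U V = pair (hamfield L U) V.
Proof.
by rewrite starE /hamfield pairBl -pairA -(pairCA lnq _ V).
Qed.

Lemma OmegaDr P1 P2 Q1 Q2 Q1' Q2' :
  Omega P1 P2 (Q1 + Q1') (Q2 + Q2') = Omega P1 P2 Q1 Q2 + Omega P1 P2 Q1' Q2'.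
Proof. by rewrite /Omega !pairDr; ring. Qed.
Lemma OmegaZr c P1 P2 Q1 Q2 : Omega P1 P2 (c *: Q1) (c *: Q2) = c * Omega P1 P2 Q1 Q2.
Proof. by rewrite /Omega !pairZr mulrBr. Qed.

Hypothesis admM : admissible M.

Lemma star_anti L U V : star L U V = - star L V U.
Proof. by rewrite !starE Omega_anti. Qed.
Lemma starDl L U U' V : star L (U + U') V = star L U V + star L U' V.
Proof. by rewrite !starE mulDDl mulDDr OmegaDl. Qed.
Lemma starZl L c U V : star L (c *: U) V = c * star L U V.
Proof. by rewrite !starE mulDZl mulDZr OmegaZl. Qed.
Lemma starDr L U V V' : star L U (V + V') = star L U V + star L U V'.
Proof. by rewrite star_anti starDl opprD -!star_anti. Qed.

(** The derivative at t = 0 of the bracket of V and W at L + t X. *)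
Definition dstar L X V W : C :=
  Omega (mulD L V) (mulD V L) (mulD X W) (mulD W X)
  - Omega (mulD L W) (mulD W L) (mulD X V) (mulD V X).

(** The bracket is quadratic in L. *)
Lemma star_line L X V W :
  is_derive (0 : C) (1 : C) (fun t : C => star (L + t *: X) V W) (dstar L X V W).
Proof.
pose c0 := Omega (mulD L V) (mulD V L) (mulD L W) (mulD W L).
pose c2 := Omega (mulD X V) (mulD V X) (mulD X W) (mulD W X).
have e (t : C) : star (L + t *: X) V W = c0 + t * (dstar L X V W + t * c2).
  rewrite starE !mulDDl !mulDDr !mulDZl !mulDZr !OmegaDl// !OmegaDr.
  rewrite !OmegaZl// !OmegaZr /dstar (Omega_anti lnq alpha admM (mulD L W)).
  rewrite -/c0 -/c2; ring.
rewrite (_ : (fun t : C => _) = (fun t => c0 + t * (dstar L X V W + t * c2))); last exact/funext.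
have h0 := @is_derive_idE C 0.
have h2 := @is_derive_addE C _ _ 0 _ _ (@is_derive_cstE C (dstar L X V W) 0)
   (@is_derive_mulE C _ _ 0 _ _ h0 (@is_derive_cstE C c2 0)).
have h3 := @is_derive_addE C _ _ 0 _ _ (@is_derive_cstE C c0 0) (@is_derive_mulE C _ _ 0 _ _ h0 h2).
by apply: (is_derive_eq h3); rewrite !mul0r !addr0 add0r mul1r.
Qed.

Lemma dstarE L X V W : dstar L X V W =
  (pair (fieldA1 L V) (mulD X W) - pair (fieldA2 L V) (mulD W X))
  - (pair (fieldA1 L W) (mulD X V) - pair (fieldA2 L W) (mulD V X)).
Proof. by []. Qed.

(** Each cyclic pair of terms is a difference of two trilinear forms, and
    their sums are -1/4 Tr([X, Y] Z) for X = L U, Y = L V, Z = L W and for X =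
    U L, Y = V L, Z = W L; these agree by cyclicity. *)
Lemma jacobi_linear L U V W :
  dstar L (hamfield L U) V W + dstar L (hamfield L V) W U + dstar L (hamfield L W) U V = 0.
Proof.
rewrite !dstarE /hamfield.
have c1 := cross_tri L W (fieldA1 L U) (fieldA2 L U) (fieldA1 L V) (fieldA2 L V).
have c2 := cross_tri L U (fieldA1 L V) (fieldA2 L V) (fieldA1 L W) (fieldA2 L W).
have c3 := cross_tri L V (fieldA1 L W) (fieldA2 L W) (fieldA1 L U) (fieldA2 L U).
have j1 := jacobi_rmat lnq (mulD L U) (mulD L V) (mulD L W)
  (f1 (P0 (mulD L U)) (P0 (mulD U L))) (f1 (P0 (mulD L V)) (P0 (mulD V L))) (f1 (P0 (mulD L W)) (P0 (mulD W L))).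
have j2 := jacobi_rmat lnq (mulD U L) (mulD V L) (mulD W L)
  (f2 (P0 (mulD L U)) (P0 (mulD U L))) (f2 (P0 (mulD L V)) (P0 (mulD V L))) (f2 (P0 (mulD L W)) (P0 (mulD W L))).
rewrite -tri_rotate in j2.
rewrite -!/(fieldA1 _ _) -!/(fieldA2 _ _) in j1 j2.
have cyc (a b c d e g p1 p2 p3 m1 m2 m3 t : C) :
   a - b = - (p1 - m1) -> c - d = - (p2 - m2) -> e - g = - (p3 - m3) ->
   p1 + p2 + p3 = - 4^-1 * t -> m1 + m2 + m3 = - 4^-1 * t ->
   a - g + (c - b) + (e - d) = 0.
  move=> e1 e2 e3 k1 k2.
  have -> : a - g + (c - b) + (e - d) = (a - b) + (c - d) + (e - g) by ring.
  rewrite e1 e2 e3 (_ : _ + _ + _ = (m1 + m2 + m3) - (p1 + p2 + p3)); last by ring.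
  by rewrite k1 k2 subrr.
exact: (cyc _ _ _ _ _ _ _ _ _ _ _ _ _ c1 c2 c3 j1 j2).
Qed.

(** Equivalent to independence of the J_{(-)}-components of the differentials. *)
Definition wd_rel := exists lam : J0 R -> C, forall y,
  f1 y y + 2^-1 *: y = lam y *: oneJ R /\ f2 y y + 2^-1 *: y = lam y *: oneJ R.
(** The condition on the operators under which the Hamiltonians H_m generate
    the Lax equations. *)
Definition lax_rel := exists mu : J0 R -> C, forall w,
  f1 w (h w) - 2^-1 *: w = mu w *: oneJ R /\ f2 w (h w) - 2^-1 *: h w = mu w *: oneJ R.

Lemma rmat_leq0 X : Jleq0 X -> rmat X = 2^-1 *: ofJ0 (P0 X) - 2^-1 *: X.
Proof.
move=> hX; have e : Pgeq0 X = ofJ0 (P0 X).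
  apply: serP => n; rewrite ofJ0E /=; have [hn|hn|->] := ltgtP n 0 => //.
  by rewrite hX.
rewrite rmatE e addrAC; congr (_ - _).
by apply: serP => n; rewrite serB !serZ -{1}(halves (ofJ0 (P0 X) n)) addrK.
Qed.

(** For Y in J_{(-)} also L Y and Y L are in J_{(-)}, with the same
    J_0-component as Y because L starts with 1, and there r is half the
    J_0-component minus 1/2. The contributions of - Y/2 cancel by cyclicity. *)
Lemma star_leq0 L Y V : G0 L -> Jleq0 Y ->
  star L Y V = pair (ofJ0 (f1 (P0 Y) (P0 Y) + 2^-1 *: P0 Y)) (mulD L V)
             - pair (ofJ0 (f2 (P0 Y) (P0 Y) + 2^-1 *: P0 Y)) (mulD V L).
Proof.
move=> hL hY.
have hLY : Jleq0 (mulD L Y) by apply: Jleq0M => //; case: hL.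
have hYL : Jleq0 (mulD Y L) by apply: Jleq0M => //; case: hL.
have e1 : P0 (mulD L Y) = P0 Y.
  by rewrite /P0 Jleq0_mulD0// ?(G0_0 hL) ?mul1J//; case: hL.
have e2 : P0 (mulD Y L) = P0 Y.
  by rewrite /P0 Jleq0_mulD0// ?(G0_0 hL) ?mulJ1//; case: hL.
rewrite starE /Omega (rmat_leq0 hLY) (rmat_leq0 hYL) e1 e2.
move: (f1 _ _) (f2 _ _) => F1 F2; rewrite !ofJ0D !ofJ0Z !(pairDl, pairNl, pairZl).
have -> : pair (mulD L Y) (mulD L V) = pair (mulD Y L) (mulD V L).
  by rewrite /Defs.pair -!mulDA TrC -!mulDA.
ring.
Qed.

Lemma int_zero A B : int_ (P0 (mulD A B)) = int_ (P0 (mulD B A)).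
Proof. exact: TrC. Qed.

Lemma pair_const c A : pair (ofJ0 (c *: oneJ R)) A = c * Tr A.
Proof. by rewrite pair_ofJ0 mulJZl mul1J int_Z. Qed.

Lemma wd_rel_star L Y V : wd_rel -> G0 L -> Jleq0 Y -> star L Y V = 0.
Proof.
move=> [lam hlam] hL hY; rewrite star_leq0//; have [-> ->] := hlam (P0 Y).
by rewrite !pair_const (TrC lnq L) subrr.
Qed.

Lemma wd_rel_well_defined : wd_rel -> well_defined lnq alpha M.
Proof.
move=> hw L U V Y Z hL hY hZ; rewrite starDl !starDr.
rewrite !(wd_rel_star _ hw hL hY) (star_anti L U Z) (wd_rel_star _ hw hL hZ).
by rewrite oppr0 !addr0.
Qed.

Lemma hamfield_Jminus L U : wd_rel -> G0 L -> Jminus (hamfield L U).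
Proof.
move=> hw hL n hn; apply: J0P => k; rewrite -(pair_dual lnq) -star_hamfield star_anti.
rewrite (wd_rel_star _ hw hL) ?oppr0// => m hm /=.
by rewrite gt_eqF//; lia.
Qed.

(** The hypotheses hold for W = L^(m/alpha) and G = L^-1 W. Since r = P_{(+)}
    - 1/2 - P_0/2, the first term gives the commutator, the second one cancels
    as W commutes with L, and the third one joins f1 and f2. *)
Lemma star_lax L W G V : mulD L G = W -> mulD G L = sigma alpha W ->
  mulD W L = mulD L (sigma alpha W) ->
  star L G V = pair (commutator lnq alpha (Pgeq0 W) L) V
    + (pair (ofJ0 (f1 (P0 W) (h (P0 W)) - 2^-1 *: P0 W)) (mulD L V)
      - pair (ofJ0 (f2 (P0 W) (h (P0 W)) - 2^-1 *: h (P0 W))) (mulD V L)).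
Proof.
move=> e1 e2 e3; rewrite starE /Omega e1 e2 rmat_sigma rmatE.
have -> : P0 (sigma alpha W) = h (P0 W) by [].
rewrite !sigmaB !sigmaZ sigma_ofJ0 /commutator pairBl -pairA -(pairCA lnq _ V).
move: (f1 _ _) (f2 _ _) => F1 F2.
have e4 : pair W (mulD L V) = pair (sigma alpha W) (mulD V L).
  by rewrite pairA pairCA e3.
rewrite !ofJ0D !ofJ0N !ofJ0Z !(pairDl, pairNl, pairZl) e4.
ring.
Qed.

End Operators.
End BracketTheory.

(** * Determination of the operators *)

Section Uniqueness.
Variables (R : realType) (lnq : CC R) (alpha : CC R).
Local Notation C := (CC R).
Local Notation Psi := (PsiD R).
Implicit Types (A B L U V W X Y Z : PsiD R) (x y z w f g : J0 R).
Local Notation qpow := (qpow lnq).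
Local Notation hhat := (hhat lnq).
Local Notation mulD := (mulD lnq).
Local Notation pair := (pair lnq).
Local Notation h := (hhat alpha).

Hypothesis qpow_int : forall k : int, k != 0 -> qpow k%:~R != 1.
Hypothesis qpow_alpha : forall k : int, k != 0 -> qpow alpha ^ k != 1.

Lemma int_monom e k : int_ (mulJ e (monom (- k) (1 : C))) = e k.
Proof.
rewrite mulJC; transitivity (\sum_(i \in [set: int]) ((monom (- k) (1 : C) : J0 R) i * e (0 - i) : C)); first by [].
rewrite (@fsumT1 _ (- k)); first by rewrite /= eqxx mul1r sub0r opprK.
by move=> i /negPf hi; rewrite /= hi mul0r.
Qed.

(** The coefficient of D^-1 is free; the coefficient 1 of D^-2 makes the
    commutant in J_0 trivial. *)
Definition probe a : Psi :=
  oneD R + (monom (-1) (a : (J0 R : lmodType C)) + monom (-2) (oneJ R : (J0 R : lmodType C))).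

Lemma probe_G0 a : G0 (probe a).
Proof.
apply: G0D; first exact: oneG0.
by move=> n hn; rewrite serD /= !gt_eqF ?addr0//; lia.
Qed.

(** By nondegeneracy e1 L = L e2. In degree 0 this gives e1 = e2, and in
    degree -2 that e1 is invariant under \hat h^2, hence constant as q is not
    a root of unity. *)
Lemma probe_const a e1 e2 :
  (forall V, pair (ofJ0 e1) (mulD (probe a) V) = pair (ofJ0 e2) (mulD V (probe a))) ->
  exists c : C, e1 = c *: oneJ R /\ e2 = c *: oneJ R.
Proof.
move=> hV.
have p0 : probe a 0 = oneJ R by exact: G0_0 (probe_G0 a).
have p2 : probe a (-2) = oneJ R by rewrite /probe !serD ofJ0E /= add0r add0r.
have e12 : e1 = e2.
  apply: J0P => k; rewrite -!int_monom; have := hV (ofJ0 (monom (- k) (1 : C))).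
  by rewrite !pair_ofJ0 /P0 mulD_ofJ0r mulD_ofJ0l p0 mul1J mulJ1 hhat_exp0.
exists (e2 0); rewrite e12.
suff -> : e2 = e2 0 *: oneJ R by rewrite serZ scaleCE /= mulr1.
apply: J0P => k; rewrite serZ scaleCE /=; case: eqP => [->|/eqP k0]; first by rewrite mulr1.
rewrite mulr0; have := hV (monom 2 (monom (- k) (1 : C) : (J0 R : lmodType C))).
rewrite !pair_ofJ0 /P0 mulDmonom mul_monom sub0r p2 hhat1 mul1J mulJ1 e12.
rewrite -(int_hhat lnq 2%:~R) hhatM hhatA -rmorphD /= addrN hhat_exp0 !int_monom hhatE => /eqP.
rewrite -subr_eq0 -{2}[e2 k]mul1r -mulrBl mulf_eq0 subr_eq0 => /orP[|/eqP//].
rewrite qpow_exp -intrM => h2; have := qpow_int (k := k * 2).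
by rewrite h2 mulf_neq0// => /(_ isT).
Qed.

Section Rel.
Variable (M : opmatrix R).
Hypothesis admM : admissible M.
Local Notation f1 := (f1 lnq alpha M).
Local Notation f2 := (f2 lnq alpha M).
Local Notation star := (star lnq alpha M).

Lemma star0l L V : star L 0 V = 0.
Proof. by rewrite -(scale0r 0) starZl// mul0r. Qed.

Lemma well_defined_wd_rel : well_defined lnq alpha M -> wd_rel lnq alpha M.
Proof.
move=> wd; suff /choice[lam hlam] : forall y, exists c : C,
    f1 y y + 2^-1 *: y = c *: oneJ R /\ f2 y y + 2^-1 *: y = c *: oneJ R by exists lam.
move=> y; apply: (@probe_const 0) => V.
have hY : Jleq0 (ofJ0 y) by move=> n hn; rewrite ofJ0E gt_eqF.
have hZ : Jleq0 (0 : Psi) by [].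
have := wd (probe 0) 0 V (ofJ0 y) 0 (probe_G0 0) hY hZ.
rewrite add0r addr0 star0l star_leq0//; last exact: probe_G0.
by rewrite (_ : P0 (ofJ0 y) = y)// => /eqP; rewrite subr_eq0 => /eqP.
Qed.

(** The only pairs to which f1 and f2 are applied have equal integrals. They
    are spanned by the pairs on which the two relations prescribe f1 and f2:
    take w = (1 - h)^-1 (x - y). *)
Lemma rel_split x y : int_ x = int_ y -> exists u w, x = u + w /\ y = u + h w.
Proof.
move=> exy; pose w : J0 R := diag (fun k => if k == 0 then 0 else (1 - qpow alpha ^ k)^-1) (x - y).
exists (x - w), w; split; first by rewrite subrK.
apply: J0P => k; rewrite serD serB -[h w k]/(qpow alpha ^ k * w k) /w.
rewrite -[diag _ _ k]/((if k == 0 then 0 else (1 - qpow alpha ^ k)^-1) * (x - y) k) serB.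
case: eqP => [->|/eqP k0]; first by rewrite mul0r mulr0 subr0 addr0 -/(int_ x) exy.
have h0 : 1 - qpow alpha ^ k != 0 by rewrite subr_eq0 eq_sym qpow_alpha.
by field.
Qed.

Lemma rel_formula x y : wd_rel lnq alpha M -> lax_rel lnq alpha M -> int_ x = int_ y ->
  forall u w, x = u + w -> y = u + h w -> exists nu : C,
    f1 x y = 2^-1 *: w - 2^-1 *: u + nu *: oneJ R /\
    f2 x y = 2^-1 *: h w - 2^-1 *: u + nu *: oneJ R.
Proof.
move=> [lam hl] [mu hm] exy u w -> ->; exists (lam u + mu w).
rewrite (f1D lnq alpha admM) (f2D lnq alpha admM).
have [a1 a2] := hl u; have [b1 b2] := hm w.
have ac (l p m r : J0 R) : (l - p) + (m + r) = r - p + (l + m).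
  by rewrite addrACA [RHS]addrC [- p + r]addrC.
have ea1 : f1 u u = lam u *: oneJ R - 2^-1 *: u by rewrite -a1 addrK.
have ea2 : f2 u u = lam u *: oneJ R - 2^-1 *: u by rewrite -a2 addrK.
have eb1 : f1 w (h w) = mu w *: oneJ R + 2^-1 *: w by rewrite -b1 subrK.
have eb2 : f2 w (h w) = mu w *: oneJ R + 2^-1 *: h w by rewrite -b2 subrK.
by rewrite ea1 ea2 eb1 eb2 scalerDl; split; apply: ac.
Qed.

End Rel.

Lemma star_unique (M M' : opmatrix R) L U V : admissible M -> admissible M' ->
  wd_rel lnq alpha M -> lax_rel lnq alpha M -> wd_rel lnq alpha M' -> lax_rel lnq alpha M' ->
  star lnq alpha M L U V = star lnq alpha M' L U V.
Proof.
move=> aM aM' w1 l1 w2 l2; rewrite !starE /Omega.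
have exy : int_ (P0 (mulD L U)) = int_ (P0 (mulD U L)) by exact: int_zero.
have [u [w [ex ey]]] := rel_split exy.
have [n1 [e1 e2]] := rel_formula aM w1 l1 exy ex ey.
have [n2 [e3 e4]] := rel_formula aM' w2 l2 exy ex ey.
rewrite e1 e2 e3 e4 !ofJ0D !pairDl !pair_const (TrC lnq L V); ring.
Qed.

End Uniqueness.

Section ExplicitOperators.
Variables (R : realType) (lnq : CC R) (alpha : CC R).
Local Notation C := (CC R).
Implicit Types (A B L U V W X Y Z : PsiD R) (x y z w f g : J0 R).
Local Notation qpow := (qpow lnq).
Local Notation mulD := (mulD lnq).
Hypothesis qpow_alpha : forall k : int, k != 0 -> qpow alpha ^ k != 1.
Local Notation M0 := (explicit_ops lnq alpha).
Local Notation u k := (qpow alpha ^ k).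

(** The eigenvalues of a, b and c on z^k. *)
Definition wa (k : int) : C := if k == 0 then 0 else 2^-1 * ((1 + u k) / (1 - u k)).
Definition wb (k : int) : C := if k == 0 then 2^-1 else - (u k / (1 - u k)).
Definition wc (k : int) : C := if k == 0 then 2^-1 else (1 - u k)^-1.

Lemma P0'E f (k : int) : P0' f k = if k == 0 then 0 else f k.
Proof.
rewrite /P0' /P00 serB serZ scaleCE /=; case: eqP => [->|_].
  by rewrite mulr1 subrr.
by rewrite mulr0 subr0.
Qed.
Lemma P00E f (k : int) : P00 f k = if k == 0 then f k else 0.
Proof.
rewrite /P00 serZ scaleCE /=; case: eqP => [->|_]; first by rewrite mulr1.
by rewrite mulr0.
Qed.
Lemma diagE (v : int -> C) f k : diag v f k = v k * f k.
Proof. by []. Qed.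
Lemma hcalcE (F : C -> C) f (k : int) : hcalc lnq F alpha f k = F (u k) * f k.
Proof. by []. Qed.

Lemma opa_diag f : opa M0 f = diag wa f.
Proof.
apply: J0P => k; rewrite diagE /wa -[LHS]/((2^-1 *: hcalc lnq (fun u => (1 + u) / (1 - u)) alpha (P0' f)) k) serZ scaleCE hcalcE P0'E.
by case: eqP => _; rewrite ?mulr0 ?mul0r// mulrA.
Qed.
Lemma opd_diag f : opd M0 f = diag (fun k => - wa k) f.
Proof.
apply: J0P => k; rewrite diagE mulNr -diagE -opa_diag.
by [].
Qed.
Lemma opb_diag f : opb M0 f = diag wb f.
Proof.
apply: J0P => k; rewrite diagE /wb -[LHS]/((- hcalc lnq (fun u => u / (1 - u)) alpha (P0' f) + 2^-1 *: P00 f) k) serD serN serZ scaleCE hcalcE P0'E P00E.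
by case: eqP => _; rewrite ?mulr0 ?oppr0 ?add0r ?addr0 ?mulNr.
Qed.
Lemma opc_diag f : opc M0 f = diag wc f.
Proof.
apply: J0P => k; rewrite diagE /wc -[LHS]/((hcalc lnq (fun u => (1 - u)^-1) alpha (P0' f) + 2^-1 *: P00 f) k) serD serZ scaleCE hcalcE P0'E P00E.
by case: eqP => _; rewrite ?mulr0 ?add0r ?addr0.
Qed.

Lemma diag_linear (v : int -> C) : linear (diag v).
Proof.
move=> c f g; apply: J0P => k; rewrite diagE !serD !serZ !scaleCE !diagE; ring.
Qed.
Lemma diag_adjoint (v v' : int -> C) : (forall k, v' (- k) = v k) -> adjoint (diag v) (diag v').
Proof.
move=> hv f g; rewrite /int_ -![mulJ _ _ 0]/(\sum_(i \in [set: int]) _).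
apply: eq_fsbigr => i _; rewrite !diagE sub0r hv; ring.
Qed.

Lemma u_neq (k : int) : k != 0 -> 1 - u k != 0.
Proof. by move=> k0; rewrite subr_eq0 eq_sym qpow_alpha. Qed.
Lemma u_neq0 (k : int) : u k != 0.
Proof. by rewrite expfz_neq0// qpow_neq0. Qed.
Lemma u_opp (k : int) : u (- k) = (u k)^-1.
Proof. by rewrite invr_expz. Qed.

Lemma wa_odd k : wa (- k) = - wa k.
Proof.
rewrite /wa oppr_eq0; case: eqP => [_|/eqP k0]; first by rewrite oppr0.
have := u_neq k0; have := u_neq0 k; rewrite u_opp; move: (u k) => v v0 v1.
field.
by rewrite v1 v0 -opprB oppr_eq0 v1.
Qed.
Lemma wb_wc k : wb (- k) = wc k.
Proof.
rewrite /wb /wc oppr_eq0; case: eqP => [//|/eqP k0].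
have := u_neq k0; have := u_neq0 k; rewrite u_opp; move: (u k) => v v0 v1.
field.
by rewrite v1 v0 -opprB oppr_eq0 v1.
Qed.

Lemma explicit_admissible : admissible M0.
Proof.
have ea : opa M0 = diag wa by apply/funext => f; exact: opa_diag.
have eb : opb M0 = diag wb by apply/funext => f; exact: opb_diag.
have ec : opc M0 = diag wc by apply/funext => f; exact: opc_diag.
have ed : opd M0 = diag (fun k => - wa k) by apply/funext => f; exact: opd_diag.
have opp (v : int -> C) f : - diag v f = diag (fun k => - v k) f.
  by apply: J0P => k; rewrite serN !diagE mulNr.
split.
- by rewrite ea eb ec ed; split; apply: diag_linear.
- rewrite ea (_ : (fun f => - diag wa f) = diag (fun k => - wa k)); last by apply/funext => f.
  by apply: diag_adjoint => k; rewrite wa_odd opprK.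
- rewrite ed (_ : (fun f => - diag _ f) = diag wa); last first.
    by apply/funext => f; apply: J0P => k; rewrite serN !diagE mulNr opprK.
  by apply: diag_adjoint => k; rewrite wa_odd.
- by rewrite ec eb; apply: diag_adjoint => k; rewrite wb_wc.
Qed.

Lemma f1_diag x y k : f1 lnq alpha M0 x y k = wa k * x k + wb k * ((u k)^-1 * y k).
Proof.
rewrite /f1 serD opa_diag opb_diag (diagE wa) (diagE wb) (hhatE lnq (- alpha)).
by rewrite qpowN exprz_inv -u_opp.
Qed.
Lemma f2_diag x y k : f2 lnq alpha M0 x y k = u k * (wc k * x k - wa k * ((u k)^-1 * y k)).
Proof.
rewrite /f2 (hhatE lnq alpha) serD opc_diag opd_diag (diagE wc) (diagE (fun k => - wa k)) (hhatE lnq (- alpha)).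
by rewrite qpowN exprz_inv -u_opp mulNr.
Qed.

(** A rational identity in q^(alpha k) for each power of z; likewise for the
    Lax relation. *)
Lemma explicit_wd_rel : wd_rel lnq alpha M0.
Proof.
exists (fun y => int_ y) => y.
by split; apply: J0P => k; rewrite serD !serZ !scaleCE (f1_diag, f2_diag) /wa /wb /wc /=;
  (case: eqP => [->|/eqP k0]; first by rewrite expr0z invr1 /int_; field);
  have := u_neq k0; have := u_neq0 k; move: (u k) => v v0 v1; field; rewrite v0 v1.
Qed.

Lemma explicit_lax_rel : lax_rel lnq alpha M0.
Proof.
exists (fun=> 0) => w; rewrite scale0r.
by split; apply: J0P => k; rewrite serB serZ scaleCE (f1_diag, f2_diag) /wa /wb /wc hhatE ser0;
  (case: eqP => [->|/eqP k0]; first by rewrite expr0z invr1; field);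
  have := u_neq k0; have := u_neq0 k; move: (u k) => v v0 v1; field; rewrite v0 v1.
Qed.

Lemma f1_cdiag A B : ofJ0 (f1 lnq alpha M0 (P0 A) (P0 B)) =
  cdiag wa (restr (fun n => n == 0) A) + cdiag (fun k => wb k * (u k)^-1) (restr (fun n => n == 0) B).
Proof.
apply: PsiP => n k; rewrite !serD !cdiagE ofJ0E /=; case: eqP => [->|_].
  by rewrite f1_diag mulrA.
by rewrite !mulr0 addr0.
Qed.
Lemma f2_cdiag A B : ofJ0 (f2 lnq alpha M0 (P0 A) (P0 B)) =
  cdiag (fun k => u k * wc k) (restr (fun n => n == 0) A)
  + cdiag (fun k => - wa k) (restr (fun n => n == 0) B).
Proof.
apply: PsiP => n k; rewrite !serD !cdiagE ofJ0E /=; case: eqP => [->|_].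
  by rewrite f2_diag; have := u_neq0 k; move: (u k) => v v0; field.
by rewrite !mulr0 addr0.
Qed.

(** The expression of the field by operations that preserve smoothness and
    bounds on orders. *)
Lemma hamfieldE L U : hamfield lnq alpha M0 L U =
  mulD (2^-1 *: (Pplus (mulD L U) - Pminus (mulD L U))
     + (cdiag wa (restr (fun n => n == 0) (mulD L U))
        + cdiag (fun k => wb k * (u k)^-1) (restr (fun n => n == 0) (mulD U L)))) L
  - mulD L (2^-1 *: (Pplus (mulD U L) - Pminus (mulD U L))
     + (cdiag (fun k => u k * wc k) (restr (fun n => n == 0) (mulD L U))
        + cdiag (fun k => - wa k) (restr (fun n => n == 0) (mulD U L)))).
Proof. by rewrite /hamfield /fieldA1 /fieldA2 f1_cdiag f2_cdiag. Qed.

Lemma smap_hamfield N U : smap_on N (fun L => hamfield lnq alpha M0 L U).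
Proof.
have s1 : smap_on N (fun L => mulD L U) by apply: smap_mulD; [exact: smap_id|exact: smap_cst].
have s2 : smap_on N (fun L => mulD U L) by apply: smap_mulD; [exact: smap_cst|exact: smap_id].
rewrite (funext (fun L => hamfieldE L U)).
apply: smap_B; apply: smap_mulD; try exact: smap_id.
all: apply: smap_D; last by apply: smap_D; apply: smap_cdiag; apply: smap_restr.
all: by apply: smap_Z; apply: smap_B; apply: smap_restr.
Qed.

Lemma ord_inB p (f : int -> int) k A B p' (f' : int -> int) : ord_in p f k A -> ord_in p' f' k B ->
  ord_in (Num.max p p') (fun n => Num.max (f n) (f' n)) k (A - B).
Proof. by move=> hA hB; rewrite -scaleN1r; apply: ord_inD => //; apply: ord_inZ. Qed.

(** The larger k, the lower is the order in z of the field of the coordinate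
    that reads the coefficient of z^k; this bounds the orders of Hamiltonian
    fields. *)
Lemma hamfield_dual_ord N n : exists p (f : int -> int), forall k L, G0 L -> ord_le N L ->
  ord_in p f (- k) (hamfield lnq alpha M0 L (dual lnq n k)).
Proof.
pose fL : int -> int := fun n => if n < 0 then N n else 0.
eexists; eexists; move=> k L hL oL; have hLo := ord_G0 hL oL.
have hd := ord_dual lnq n k.
have h1 := ord_mulD lnq hLo hd; rewrite !add0r in h1.
have h2 := ord_mulD lnq hd hLo; rewrite !addr0 in h2.
rewrite hamfieldE.
have hB1 := ord_mulD lnq (ord_inD (ord_inZ 2^-1 (ord_inB (ord_restr (fun n => 0 < n) h1) (ord_restr (fun n => n < 0) h1)))
  (ord_inD (ord_cdiag wa (ord_restr (fun n => n == 0) h1))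
    (ord_cdiag (fun k => wb k * (u k)^-1) (ord_restr (fun n => n == 0) h2)))) hLo.
have hB2 := ord_mulD lnq hLo (ord_inD (ord_inZ 2^-1 (ord_inB (ord_restr (fun n => 0 < n) h2) (ord_restr (fun n => n < 0) h2)))
  (ord_inD (ord_cdiag (fun k => u k * wc k) (ord_restr (fun n => n == 0) h1))
    (ord_cdiag (fun k => - wa k) (ord_restr (fun n => n == 0) h2)))).
rewrite !addr0 in hB1; rewrite !add0r in hB2.
exact: (ord_inB hB1 hB2).
Qed.

End ExplicitOperators.

(** * The bracket and its Poisson property *)

Section PoissonBracket.
Variables (R : realType) (lnq : CC R) (alpha : CC R).
Local Notation C := (CC R).
Local Notation Psi := (PsiD R).
Implicit Types (A B L U V W X Y Z : PsiD R) (phi chi psi : functional R).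
Local Notation qpow := (qpow lnq).
Local Notation pair := (pair lnq).
Hypothesis qpow_alpha : forall k : int, k != 0 -> qpow alpha ^ k != 1.
Local Notation M0 := (explicit_ops lnq alpha).
Local Notation star := (star lnq alpha M0).
Local Notation hamfield := (hamfield lnq alpha M0).
Local Notation dstar := (dstar lnq alpha M0).
Let adm := explicit_admissible qpow_alpha.
Let wd := explicit_wd_rel qpow_alpha.

Let star_swap L U V : star L U V = - star L V U.
Proof. exact: (@star_anti R lnq alpha M0 adm L U V). Qed.

Definition grad phi L : Psi := xget 0 [set G | is_grad lnq phi L G].
(** The differential is only defined modulo J_{(-)}; since the formula does
    not depend on its representative, one is chosen. *)
Definition bracket0 : bracket R := fun phi psi L => star L (grad phi L) (grad psi L).
Definition flow phi L : Psi := hamfield L (grad phi L).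

Lemma gradP phi L : smooth phi -> G0 L -> is_grad lnq phi L (grad phi L).
Proof.
move=> sp hL; have [G hG] := grad_exists lnq sp hL.
exact: (@xgetPex _ 0 [set G | is_grad lnq phi L G] (ex_intro _ G hG)).
Qed.

Lemma pair_grad phi L X G : smooth phi -> G0 L -> Jminus X -> is_grad lnq phi L G ->
  pair X G = dirD phi X L.
Proof.
move=> sp hL hX hG; exact: (is_derive_unique (hG X hX) (smooth_is_derive sp hL hX)).
Qed.

Lemma hamfieldJ L U : G0 L -> Jminus (hamfield L U).
Proof. exact: (@hamfield_Jminus R lnq alpha M0 adm L U wd). Qed.
Lemma flowJ phi L : G0 L -> Jminus (flow phi L).
Proof. exact: hamfieldJ. Qed.

Lemma star_gradr phi L U G : smooth phi -> G0 L -> is_grad lnq phi L G ->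
  star L U G = dirD phi (hamfield L U) L.
Proof.
by move=> sp hL hG; rewrite star_hamfield (pair_grad sp hL (hamfieldJ U hL) hG).
Qed.

Lemma bracket0E phi psi L : smooth phi -> smooth psi -> G0 L ->
  bracket0 phi psi L = dirD psi (flow phi L) L.
Proof. by move=> sp ss hL; apply: (star_gradr _ ss hL (gradP ss hL)). Qed.

Lemma bracket0_form : of_star_form lnq alpha M0 bracket0.
Proof.
move=> phi psi sp ss L G G' hL hG hG'.
rewrite /bracket0 (star_gradr _ ss hL (gradP ss hL)) -(star_gradr _ ss hL hG').
rewrite (star_swap _ _ G') (star_swap L G G') (star_gradr _ sp hL (gradP sp hL)).
by rewrite (star_gradr _ sp hL hG).
Qed.

Lemma bracket0_anti phi psi L : bracket0 phi psi L = - bracket0 psi phi L.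
Proof. exact: star_swap. Qed.

(** By skew symmetry a coefficient of the Hamiltonian field of phi is minus
    the derivative of phi along the field of that coefficient; hence it is a
    smooth functional. *)
Lemma flow_coef phi L n k : smooth phi -> G0 L ->
  flow phi L n k = - dirD phi (hamfield L (dual lnq n k)) L.
Proof.
move=> sp hL; rewrite -(pair_dual lnq) -star_hamfield star_swap.
by rewrite (star_gradr _ sp hL (gradP sp hL)).
Qed.

(** For the bound on the orders: on a set of bounded orders phi depends on
    finitely many coordinates, and the field of a coefficient with large k has
    none of these. *)
Lemma smap_flow phi N : smooth phi -> smap_on N (flow phi).
Proof.
move=> sp; split; last first.
  move=> n k; apply: (@smooth_on_ext _ N (fun L => - 1 * dirD phi (hamfield L (dual lnq n k)) L)).
    by move=> L hL _; rewrite (flow_coef _ _ sp hL) mulN1r.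
  apply: smooth_onZ; apply: (@smooth_dirD _ phi (fun L => hamfield L (dual lnq n k)) sp).
    by move=> N'; exact: smap_hamfield.
  by move=> L hL; apply: hamfieldJ.
have /choice[K hK] : forall n : int, exists K : int, forall k L, K < k -> G0 L -> ord_le N L ->
    flow phi L n k = 0.
  move=> n; have [p [f hf]] := hamfield_dual_ord lnq alpha N n.
  have [m [c [F [sF hF]]]] := sp (bound_max N f).
  (* beyond K the field of the coefficient k vanishes in all the coordinates c
     j *)
  pose K : int := \sum_(j < m) (`|f (c j).1| + `|(c j).2|).
  have hKj j : `|f (c j).1| + `|(c j).2| <= K.
    rewrite /K (bigD1 j)//= lerDl; apply: sumr_ge0 => i _; exact: addr_ge0.
  have K0 : 0 <= K by apply: sumr_ge0 => i _; exact: addr_ge0.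
  exists K => k L hk hL oL; rewrite (flow_coef _ _ sp hL).
  have hH := hf k L hL oL; have jH := hamfieldJ (dual lnq n k) hL.
  have oH : ord_le (bound_max N f) (hamfield L (dual lnq n k)).
    move=> i j hi hj; apply: hH.2; apply: le_lt_trans hj.
    by apply: le_trans (bound_maxr N f i); rewrite gerDl; lia.
  rewrite (dirDE sF hF hL (ord_leW (bound_maxl N f) oL) jH oH).
  rewrite (_ : coords c (hamfield L (dual lnq n k)) = 0) ?linear0 ?oppr0//; apply/rowP => j; rewrite !mxE.
  apply: hH.2; have := hKj j; move: (f _) (c j).2 => a b; lia.
exists (-1), K => L hL oL; split=> [n hn|n k hk].
  by apply: flowJ => //; lia.
by apply: hK => //; rewrite addr0 in hk.
Qed.

Lemma smooth_bracket0 phi psi : smooth phi -> smooth psi -> smooth (bracket0 phi psi).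
Proof.
move=> sp ss N; apply: (@smooth_on_ext _ N (fun L => dirD psi (flow phi L) L)).
  by move=> L hL _; rewrite bracket0E.
apply: (@smooth_dirD _ psi (flow phi) ss) => [N'|L hL]; first exact: smap_flow.
exact: flowJ.
Qed.

Lemma smooth_lin (c : C) phi chi : smooth phi -> smooth chi -> smooth (fun A => c * phi A + chi A).
Proof. by move=> sp sc N; apply: smooth_onD => //; apply: smooth_onZ. Qed.
Lemma smooth_mul phi chi : smooth phi -> smooth chi -> smooth (fun A => phi A * chi A).
Proof. by move=> sp sc N; apply: smooth_onM. Qed.

Lemma dirD_lin (c : C) phi chi L X : smooth phi -> smooth chi -> G0 L -> Jminus X ->
  dirD (fun A => c * phi A + chi A) X L = c * dirD phi X L + dirD chi X L.
Proof.
move=> sp sc hL hX; apply: (is_derive_unique (smooth_is_derive (smooth_lin c sp sc) hL hX)).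
have h1 := smooth_is_derive sp hL hX; have h2 := smooth_is_derive sc hL hX.
exact: (@is_derive_addE C _ _ 0 _ _ (@is_derive_scaleE C c _ 0 _ h1) h2).
Qed.
Lemma dirD_mul phi chi L X : smooth phi -> smooth chi -> G0 L -> Jminus X ->
  dirD (fun A => phi A * chi A) X L = phi L * dirD chi X L + chi L * dirD phi X L.
Proof.
move=> sp sc hL hX; apply: (is_derive_unique (smooth_is_derive (smooth_mul sp sc) hL hX)).
have h1 := smooth_is_derive sp hL hX; have h2 := smooth_is_derive sc hL hX.
have h := @is_derive_mulE C _ _ 0 _ _ h1 h2.
by apply: (is_derive_eq h); rewrite scale0r addr0 addrC (mulrC (dirD phi X L)).
Qed.

(** The bracket is differentiated through chi, through psi and through the
    explicit dependence of the formula on L. The first two contributions are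
    second derivatives. *)
Lemma dirD_bracket0 chi psi L X : smooth chi -> smooth psi -> G0 L -> Jminus X ->
  dirD (bracket0 chi psi) X L
  = dirD (dirD psi (flow chi L)) X L - dirD (dirD chi (flow psi L)) X L
    + dstar L X (grad chi L) (grad psi L).
Proof.
move=> sc ss hL hX.
set V := grad chi L; set W := grad psi L.
have gt t : G0 (L + t *: X) by apply: G0D => //; apply: JminusZ.
have L0 : L + (0 : C) *: X = L by rewrite scale0r addr0.
have sf N : smap_on N (flow chi) by exact: smap_flow.
have sh N : smap_on N (fun L => hamfield L W) by exact: smap_hamfield.
have [Z' dZ] := smap_dcurve sf hL hX.
have [H' dH] := smap_dcurve sh hL hX.
have jZ' : Jminus Z' by apply: (dcurve_Jminus _ dZ) => s; exact: flowJ.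
have jH' : Jminus H' by apply: (dcurve_Jminus _ dH) => s; exact: hamfieldJ.
have d1 := dirD_dirD ss hL hX sf (fun L hL => flowJ chi hL) dZ.
have d2 := dirD_dirD sc hL hX sh (fun L hL => hamfieldJ W hL) dH.
have e1 : dirD (bracket0 chi psi) X L = dirD (dirD psi (flow chi L)) X L + dirD psi Z' L.
  have := smooth_is_derive (smooth_bracket0 sc ss) hL hX.
  rewrite (_ : (fun t : C => bracket0 chi psi (L + t *: X)) =
    (fun t : C => dirD psi (flow chi (L + t *: X)) (L + t *: X))); last first.
    by apply/funext => t; rewrite bracket0E.
  move=> d0; exact: (is_derive_unique d0 d1).
have pairZ (A : C -> Psi) A' (G : Psi) : dcurve A 0 A' ->
    is_derive (0 : C) (1 : C) (fun t => pair (A t) G) (pair A' G).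
  move=> dA; have := dcurve_coef 0 0 (dcurve_mulD lnq dA (dcurve_cst G 0)).
  by rewrite mulD0r addr0.
have e2 : dirD psi Z' L = - (dirD (dirD chi (flow psi L)) X L + dirD chi H' L).
  rewrite -(pair_grad ss hL jZ' (gradP ss hL)) -/W.
  have d3 := pairZ _ _ W dZ.
  have d4 := @is_derive_scaleE C (-1) _ 0 _ d2; rewrite mulN1r in d4.
  apply: (is_derive_unique d3).
  rewrite (_ : (fun t => _) = (fun t => -1 * dirD chi (hamfield (L + t *: X) W) (L + t *: X))).
    exact: d4.
  apply/funext => t; rewrite mulN1r -(star_gradr _ sc (gt t) (gradP sc (gt t))).
  by rewrite /flow -star_hamfield star_swap.
have e3 : dirD chi H' L = - dstar L X V W.
  rewrite -(pair_grad sc hL jH' (gradP sc hL)) -/V.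
  have d3 := pairZ _ _ V dH.
  have d4 := @star_line R lnq alpha M0 adm L X W V.
  have -> : - dstar L X V W = dstar L X W V by rewrite /dstar opprB.
  apply: (is_derive_unique d3).
  rewrite (_ : (fun t => _) = (fun t : C => star (L + t *: X) W V)); first exact: d4.
  by apply/funext => t; rewrite star_hamfield.
by rewrite e1 e2 e3 opprD opprK addrA.
Qed.

Lemma bracket0_poisson : poisson bracket0.
Proof.
split.
- exact: smooth_bracket0.
- by move=> phi psi _ _ L _; exact: bracket0_anti.
- move=> c phi chi psi sp sc ss L hL.
  rewrite bracket0_anti [bracket0 phi psi L]bracket0_anti [bracket0 chi psi L]bracket0_anti.
  rewrite (bracket0E ss (smooth_lin c sp sc) hL) (bracket0E ss sp hL) (bracket0E ss sc hL).
  rewrite (dirD_lin c sp sc hL (flowJ psi hL)).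
  by rewrite opprD mulrN.
- move=> phi chi psi sp sc ss L hL.
  rewrite bracket0_anti [bracket0 phi psi L]bracket0_anti [bracket0 chi psi L]bracket0_anti.
  rewrite (bracket0E ss (smooth_mul sp sc) hL) (bracket0E ss sp hL) (bracket0E ss sc hL).
  rewrite (dirD_mul sp sc hL (flowJ psi hL)).
  by rewrite opprD !mulrN.
- move=> phi chi psi sp sc ss L hL.
  rewrite (bracket0E sp (smooth_bracket0 sc ss) hL) (bracket0E sc (smooth_bracket0 ss sp) hL).
  rewrite (bracket0E ss (smooth_bracket0 sp sc) hL).
  have j1 := flowJ phi hL; have j2 := flowJ chi hL; have j3 := flowJ psi hL.
  rewrite (dirD_bracket0 sc ss hL j1) (dirD_bracket0 ss sp hL j2) (dirD_bracket0 sp sc hL j3).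
  have := @jacobi_linear R lnq alpha M0 L (grad phi L) (grad chi L) (grad psi L).
  rewrite -!/(flow _ L) => j.
  (* the second derivatives cancel in pairs by symmetry *)
  have fin (a1 a2 a3 b1 b2 b3 x y z : C) : a1 = b2 -> a2 = b3 -> a3 = b1 ->
      x + y + z = 0 -> (a1 - b1 + x) + (a2 - b2 + y) + (a3 - b3 + z) = 0.
    by move=> -> -> -> e; rewrite -[RHS]e; ring.
  exact: (fin _ _ _ _ _ _ _ _ _ (dirD_sym ss hL j2 j1) (dirD_sym sp hL j3 j2)
    (dirD_sym sc hL j1 j3) j).
Qed.

End PoissonBracket.

(** * Dressing *)

Section Dressing.
Variables (R : realType) (lnq : CC R) (alpha : CC R).
Local Notation C := (CC R).
Local Notation Psi := (PsiD R).
Implicit Types (A B L S T U V W X Y Z : PsiD R).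
Local Notation qpow := (qpow lnq).
Local Notation hhat := (hhat lnq).
Local Notation mulD := (mulD lnq).
Local Notation sigma := (sigma lnq).
Local Notation expJ := (expJ lnq).
Local Notation exp_trunc := (exp_trunc lnq).
Local Notation pw := (pw lnq).
Lemma smap_coefwise N p (Y : Psi -> Psi) : (forall L, G0 L -> ord_le N L -> zero_above p (Y L)) ->
  (forall n, exists K, forall L, G0 L -> ord_le N L -> zero_above K (Y L n)) ->
  (forall n k, smooth_on N (fun L => Y L n k)) -> smap_on N Y.
Proof.
move=> hp /choice[f hf] sY; split=> //; exists p, f => L hL oL; split; first exact: hp.
by move=> n; rewrite addr0; exact: hf.
Qed.

Lemma smap_zero_above N (Y : Psi -> Psi) n : smap_on N Y ->
  exists K, forall L, G0 L -> ord_le N L -> zero_above K (Y L n).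
Proof.
by move=> [[p [f hf]] _]; exists (f n + 0) => L hL oL; exact: (hf L hL oL).2.
Qed.

Lemma smap_pw N (Y : Psi -> Psi) j : smap_on N Y -> smap_on N (fun L => pw (Y L) j).
Proof.
move=> hY; elim: j => [|j IH]; first exact: smap_cst.
exact: smap_mulD.
Qed.

Lemma smap_exp_trunc N (Y : Psi -> Psi) t K : smap_on N Y -> smap_on N (fun L => exp_trunc t (Y L) K).
Proof.
move=> hY; elim: K => [|K IH].
  rewrite (_ : (fun L => _) = (fun=> 0)); first exact: smap_cst.
  by apply/funext => L; rewrite /exp_trunc big_ord0.
rewrite (_ : (fun L => _) = (fun L => exp_trunc t (Y L) K + (t ^+ K / K`!%:R) *: pw (Y L) K)).
  by apply: smap_D => //; apply: smap_Z; apply: smap_pw.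
by apply/funext => L; rewrite /exp_trunc big_ord_recr.
Qed.

(** In each degree the exponential is a polynomial expression in the
    coefficients of the exponent. *)
Lemma smap_expJ N (Y : Psi -> Psi) t : smap_on N Y -> (forall L, G0 L -> Jminus (Y L)) ->
  smap_on N (fun L => expJ t (Y L)).
Proof.
move=> hY jY.
have e n L : G0 L -> expJ t (Y L) n = exp_trunc t (Y L) (absz n).+2 n.
  by move=> hL; rewrite exp_truncE//; [exact: jY|lia].
apply: (@smap_coefwise N 0) => [L hL oL|n|n k].
- by apply: G0_above; apply: G0_expJ; exact: jY.
- have [K hK] := smap_zero_above n (smap_exp_trunc t (absz n).+2 hY).
  by exists K => L hL oL; rewrite e//; exact: hK.
apply: (smooth_on_ext _ ((smap_exp_trunc t (absz n).+2 hY).2 n k)) => L hL _.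
by rewrite e.
Qed.

Lemma smap_sigma N b (Y : Psi -> Psi) : smap_on N Y -> smap_on N (fun L => sigma b (Y L)).
Proof.
move=> hY; rewrite (_ : (fun L => _) = (fun L => cdiag (fun k => qpow b ^ k) (Y L))).
  exact: smap_cdiag.
by apply/funext => L; rewrite sigma_cdiag.
Qed.

Hypothesis qpow_alpha : forall k : int, k != 0 -> qpow alpha ^ k != 1.
Hypothesis alpha_neq0 : alpha != 0.

(** The dressing operator and the logarithm are stored in one series T: the
    coefficients of z^k, k != 0, give the former, those of z^0 the latter. In
    each degree L determines both together. *)
Definition dress_op T : Psi := oneD R + cdiag (fun k => if k == 0 then 0 else 1) T.
Definition dress_log T : Psi := cdiag (fun k => if k == 0 then 1 else 0) T.

Lemma dress_op_G0 T : Jminus T -> G0 (dress_op T).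
Proof.
move=> hT; apply: G0D; first exact: oneG0.
by apply/JminusP; apply: cdiag_above; apply/JminusP.
Qed.
Lemma dress_log_Jminus T : Jminus T -> Jminus (dress_log T).
Proof. by move=> /JminusP hT; apply/JminusP; apply: cdiag_above. Qed.
Lemma dress_log_constc T : constc (dress_log T).
Proof. by move=> n k /negPf hk; rewrite cdiagE hk mul0r. Qed.

Definition dress_defect L T : Psi :=
  mulD (dress_op T) L - mulD (expJ alpha (dress_log T)) (sigma alpha (dress_op T)).

(** In degree n the defect of the dressing equation depends on the coefficient
    of z^k in T through the factor 1 - q^(alpha k), or - alpha for k = 0. The
    next definition is the corresponding Newton step. *)
Definition dress_weight (k : int) : C := if k == 0 then - alpha^-1 else (1 - qpow alpha ^ k)^-1.
Definition dress_step L T : Psi :=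
  restr (fun n => n < 0) (T - cdiag dress_weight (dress_defect L T)).

Lemma dress_step_above L A : zero_above (-1) A -> zero_above (-1) (dress_step L A).
Proof. by move=> _ n hn; rewrite /= ltNge (_ : 0 <= n)//; lia. Qed.

(** The top coefficient of the change of the defect is the change of T times
    the inverse of the weight, so that the step no longer depends on T in that
    degree. *)
Lemma dress_step_causal L n A B : G0 L -> zero_above (-1) A -> zero_above (-1) B ->
  (forall m, n < m -> A m = B m) -> dress_step L A n = dress_step L B n.
Proof.
move=> hL /JminusP hA /JminusP hB hAB.
suff main : (A - cdiag dress_weight (dress_defect L A)) n =
    (B - cdiag dress_weight (dress_defect L B)) n.
  by rewrite /dress_step /restr /=; case: ifP => // _; exact: main.
have hD : zero_above n (A - B) by move=> m hm; rewrite serB hAB// subrr.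
pose d := (A - B) n.
have hS : dress_op A - dress_op B = cdiag (fun k => if k == 0 then 0 else 1) (A - B).
  by rewrite /dress_op cdiagB opprD addrACA subrr add0r.
have hl : dress_log A - dress_log B = cdiag (fun k => if k == 0 then 1 else 0) (A - B).
  by rewrite /dress_log cdiagB.
have hlD : zero_above n (dress_log A - dress_log B) by rewrite hl; apply: cdiag_above.
have [eA eT] := expJB_top lnq alpha (dress_log_Jminus hA) (dress_log_Jminus hB) hlD.
have hSD : zero_above n (dress_op A - dress_op B) by rewrite hS; apply: cdiag_above.
have e0 : dress_defect L A - dress_defect L B =
    mulD (dress_op A - dress_op B) L
    - (mulD (expJ alpha (dress_log A) - expJ alpha (dress_log B)) (sigma alpha (dress_op A))
      + mulD (expJ alpha (dress_log B)) (sigma alpha (dress_op A - dress_op B))).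
  have ac (u b c v e : Psi) : (u - b) - (c - v) = (u - c) - ((b - e) + (e - v)).
    by rewrite [b - e + _]addrA subrK !opprB addrACA [in RHS]addrACA [- c - b]addrC.
  by rewrite /dress_defect sigmaB !mulDBl mulDBr; exact: ac.
have e1 : mulD (dress_op A - dress_op B) L n = diag (fun k => if k == 0 then 0 else 1) d.
  rewrite -[n]addr0 mulD_top//; last exact: G0_above.
  by rewrite (G0_0 hL) hhat1 mulJ1 hS ?addr0.
have e2 : mulD (expJ alpha (dress_log A) - expJ alpha (dress_log B)) (sigma alpha (dress_op A)) n
    = alpha *: diag (fun k => if k == 0 then 1 else 0) d.
  rewrite -[n]addr0 mulD_top//; last first.
    by apply: sigma_bnd; apply: G0_above; apply: dress_op_G0.
  rewrite ?addr0 (G0_0 (G0_sigma lnq alpha (dress_op_G0 hA))) hhat1 mulJ1 eT hl.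
  by [].
have e3 : mulD (expJ alpha (dress_log B)) (sigma alpha (dress_op A - dress_op B)) n
    = hhat alpha (diag (fun k => if k == 0 then 0 else 1) d).
  rewrite -[n]add0r mulD_top//; last 2 first.
  - by apply: G0_above; apply: G0_expJ; exact: dress_log_Jminus.
  - exact: sigma_bnd.
  rewrite ?add0r (expJ0 _ _ (dress_log_Jminus hB)) mul1J hhat_exp0 sigmaE hS.
  by [].
have e4 : diag dress_weight ((dress_defect L A - dress_defect L B) n) = d.
  rewrite e0 serB serD e1 e2 e3; apply: J0P => k.
  rewrite diagE serB serD serZ scaleCE (hhatE lnq alpha).
  rewrite !(diagE (fun k => if k == 0 then 0 else 1)) !(diagE (fun k => if k == 0 then 1 else 0)).
  rewrite /dress_weight; case: eqP => [_|/eqP k0].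
    by rewrite mul0r mulr0 mul1r addr0 sub0r mulrN mulNr opprK mulKf.
  have h0 : 1 - qpow alpha ^ k != 0 by rewrite subr_eq0 eq_sym qpow_alpha.
  by rewrite mul0r mulr0 add0r mul1r -{1}[d k]mul1r -mulrBl mulKf.
apply/eqP; rewrite -subr_eq0 -serB; apply/eqP.
have ac (u b c v : Psi) : (u - b) - (c - v) = (u - c) - (b - v).
  by rewrite !opprB addrACA [in RHS]addrACA [- c - b]addrC.
rewrite ac -cdiagB serB -/d.
have -> : cdiag dress_weight (dress_defect L A - dress_defect L B) n =
   diag dress_weight ((dress_defect L A - dress_defect L B) n) by [].
by rewrite e4 subrr.
Qed.

Definition dress L : Psi := xget 0 [set T | Jminus T /\ dress_step L T = T].

Lemma dressP L : G0 L -> Jminus (dress L) /\ dress_step L (dress L) = dress L.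
Proof.
move=> hL; have [T hT eT] := causal_fixpoint (@dress_step_above L)
  (fun n A B hA hB => @dress_step_causal L n A B hL hA hB).
apply: (@xgetPex _ 0 [set T | Jminus T /\ dress_step L T = T]).
by exists T; split=> //; apply/JminusP.
Qed.

Lemma dress_eq L : G0 L ->
  mulD (dress_op (dress L)) L = mulD (expJ alpha (dress_log (dress L))) (sigma alpha (dress_op (dress L))).
Proof.
move=> hL; have [hT eT] := dressP hL.
apply/eqP; rewrite -subr_eq0 -/(dress_defect L (dress L)); apply/eqP.
apply: PsiP => n k; rewrite !ser0; have [hn|hn] := leP 0 n.
  have : Jminus (dress_defect L (dress L)).
    apply: G0B; first by apply: G0M => //; exact: dress_op_G0.
    apply: G0M; first by apply: G0_expJ; exact: dress_log_Jminus.
    by apply: G0_sigma; exact: dress_op_G0.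
  by move=> ->.
have := congr1 (fun A : Psi => A n k) eT; rewrite /dress_step /= hn.
rewrite serB -[X in _ - X]/(dress_weight k * dress_defect L (dress L) n k).
move=> /eqP; rewrite -subr_eq0 addrAC subrr add0r oppr_eq0 mulf_eq0 => /orP[|/eqP//].
rewrite /dress_weight; case: (k =P 0) => [_|/eqP k0].
  by rewrite oppr_eq0 invr_eq0 (negPf alpha_neq0).
by rewrite invr_eq0 subr_eq0 eq_sym (negPf (qpow_alpha k0)).
Qed.

Lemma smap_dress_op N (Y : Psi -> Psi) : smap_on N Y -> smap_on N (fun L => dress_op (Y L)).
Proof. by move=> hY; apply: smap_D; [exact: smap_cst|exact: smap_cdiag]. Qed.

Lemma smap_dress_step N (Y : Psi -> Psi) : smap_on N Y -> (forall L, G0 L -> Jminus (Y L)) ->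
  smap_on N (fun L => dress_step L (Y L)).
Proof.
move=> hY jY; apply: smap_restr; apply: smap_B => //; apply: smap_cdiag; apply: smap_B.
  by apply: smap_mulD; [exact: smap_dress_op|exact: smap_id].
apply: smap_mulD; last by apply: smap_sigma; exact: smap_dress_op.
by apply: smap_expJ; [exact: smap_cdiag | move=> L hL; apply: dress_log_Jminus; exact: jY].
Qed.

(** By induction on the degree: each coefficient of the fixed point is a
    coefficient of the step applied to the part of T of higher degree. *)
Lemma smap_dress N : smap_on N dress.
Proof.
suff key (j : nat) : forall n : int, 0 <= n + j%:Z ->
    (exists K, forall L, G0 L -> ord_le N L -> zero_above K (dress L n)) /\
    forall k, smooth_on N (fun L => dress L n k).
  apply: (@smap_coefwise N (-1)) => [L hL _|n|n k].
  - by apply/JminusP; exact: (dressP hL).1.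
  - by apply: (key (absz n) n _).1; lia.
  - by apply: (key (absz n) n _).2; lia.
elim: j => [|j IH] n hn.
  have z L : G0 L -> dress L n = 0 by move=> hL; apply: (dressP hL).1; lia.
  split=> [|k]; first by exists 0 => L hL _; rewrite z.
  by apply: (@smooth_on_ext _ N (fun=> 0)) => [L hL _|]; [rewrite z|exact: smooth_on_cst].
pose tr L := restr (fun m => n < m) (dress L).
have jtr L : G0 L -> Jminus (tr L).
  by move=> hL m hm; rewrite /= (dressP hL).1 ?if_same.
have str : smap_on N tr.
  apply: (@smap_coefwise N (-1)) => [L hL _|m|m k].
  - by apply/JminusP; exact: jtr.
  - have [hm|hm] := ltP n m.
      have [|[K hK] _] := IH m; first by lia.
      by exists K => L hL oL; rewrite /= hm; exact: hK.
    by exists 0 => L hL oL; rewrite /= ltNge hm.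
  - rewrite /=; have [hm|hm] := ltP n m; last exact: smooth_on_cst.
    by apply: (IH m _).2; lia.
have e L : G0 L -> dress L n = dress_step L (tr L) n.
  move=> hL; rewrite -{1}(dressP hL).2; apply: dress_step_causal => //.
  - by apply/JminusP; exact: (dressP hL).1.
  - by apply/JminusP; exact: jtr.
  - by move=> m hm; rewrite /= hm.
have ss := smap_dress_step str jtr.
split=> [|k].
  have [K hK] := smap_zero_above n ss.
  by exists K => L hL oL; rewrite e//; exact: hK.
by apply: (smooth_on_ext _ (ss.2 n k)) => L hL _; rewrite e.
Qed.

End Dressing.

(** * Exponentials and logarithms *)

Section Exponential.
Variables (R : realType) (lnq : CC R).
Local Notation C := (CC R).
Local Notation Psi := (PsiD R).
Implicit Types (A B L S T U V W X Y Z : PsiD R).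
Local Notation qpow := (qpow lnq).
Local Notation hhat := (hhat lnq).
Local Notation mulD := (mulD lnq).
Local Notation sigma := (sigma lnq).
Local Notation expJ := (expJ lnq).
Local Notation exp_trunc := (exp_trunc lnq).
Local Notation pw := (pw lnq).

Lemma dcurve_constc (A : C -> Psi) t A' : (forall s, constc (A s)) -> dcurve A t A' -> constc A'.
Proof. by move=> cA dA n k hk; apply: (dcurve_zero dA) => s; apply: cA. Qed.

(** The curve consists of commuting symbols, so that the derivative is as for
    numbers. *)
Lemma dcurve_pw (A : C -> Psi) t A' j : (forall s, constc (A s)) -> dcurve A t A' ->
  dcurve (fun s => pw (A s) j.+1) t (j.+1%:R *: mulD A' (pw (A t) j)).
Proof.
move=> cA dA; have cA' := dcurve_constc cA dA.
elim: j => [|j IH].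
  apply: (dcurve_eq (dcurve_mulD lnq dA (dcurve_cst (oneD R) t))).
  by rewrite scale1r mulD0r addr0.
apply: (dcurve_eq (dcurve_mulD lnq dA IH)).
rewrite mulDZr (mulDA lnq (A t)) (constc_mulDC lnq (cA t) cA') -mulDA -pwS.
by rewrite -{1}[mulD A' _]scale1r -scalerDl -[1 : C]/(1%:R) -natrD add1n.
Qed.

Lemma dcurve_exp_trunc (A : C -> Psi) t A' c K : (forall s, constc (A s)) -> dcurve A t A' ->
  dcurve (fun s => exp_trunc c (A s) K.+1) t (c *: mulD A' (exp_trunc c (A t) K)).
Proof.
move=> cA dA; elim: K => [|K IH].
  rewrite (_ : (fun s => _) = (fun=> (c ^+ 0 / 0`!%:R) *: oneD R)); last first.
    by apply/funext => s; rewrite /exp_trunc big_ord_recl big_ord0 addr0.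
  by rewrite [exp_trunc c (A t) 0](_ : _ = 0) ?mulD0r ?scaler0 ?/exp_trunc ?big_ord0//; exact: dcurve_cst.
rewrite (_ : (fun s => _) = (fun s => exp_trunc c (A s) K.+1 +
    (c ^+ K.+1 / K.+1`!%:R) *: pw (A s) K.+1)); last first.
  by apply/funext => s; rewrite /exp_trunc big_ord_recr.
apply: (dcurve_eq (dcurveD IH (dcurveZ _ (dcurve_pw K cA dA)))).
rewrite [in RHS]/exp_trunc big_ord_recr /= -/(exp_trunc c (A t) K) mulDDr scalerDr; congr (_ + _).
rewrite mulDZr !scalerA; congr (_ *: _).
have n0 : K.+1%:R != 0 :> C by rewrite pnatr_eq0.
by rewrite exprS factS natrM invfM [_^-1 / _]mulrC !mulrA divfK.
Qed.

Lemma dcurve_expJ (A : C -> Psi) t A' c : (forall s, constc (A s)) -> (forall s, Jminus (A s)) ->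
  dcurve A t A' -> dcurve (fun s => expJ c (A s)) t (c *: mulD A' (expJ c (A t))).
Proof.
move=> cA jA dA; have cA' := dcurve_constc cA dA.
have jA' := dcurve_Jminus jA dA.
have ob (B : Psi) : zero_above 0 B -> constc B -> ord_in 0 (fun=> 0) 0 B.
  by move=> hB cB; split=> // n k hk; apply: cB; rewrite gt_eqF.
split=> [|n k].
  exists 0, (fun=> 0); split=> [s|]; apply: ob.
  - exact: G0_above (G0_expJ _ _ (jA s)).
  - exact: constc_expJ.
  - apply: zero_aboveW (_ : (-1 <= 0)%R) => //; apply/JminusP; apply: JminusZ.
    by apply: JminusMr => //; apply/Jleq0P; apply: G0_above (G0_expJ _ _ (jA t)).
  - by apply: constcZ; apply: constc_mulD => //; exact: constc_expJ.
pose K := (absz n).+1.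
rewrite (_ : (fun s => _) = (fun s => exp_trunc c (A s) K.+1 n k)); last first.
  by apply/funext => s; rewrite exp_truncE//; rewrite /K; lia.
rewrite (_ : (c *: mulD A' (expJ c (A t))) n k = (c *: mulD A' (exp_trunc c (A t) K)) n k).
  exact: dcurve_coef (dcurve_exp_trunc c K cA dA).
have -> // : (c *: mulD A' (expJ c (A t))) n = (c *: mulD A' (exp_trunc c (A t) K)) n.
rewrite !serZ (@mulD_causall _ lnq n A' (expJ c (A t)) (exp_trunc c (A t) K))// => m hm.
by rewrite exp_truncE//; rewrite /K; lia.
Qed.

Lemma pwZ c A j : pw (c *: A) j = c ^+ j *: pw A j.
Proof.
elim: j => [|j IH]; first by rewrite expr0 scale1r.
by rewrite !pwS IH mulDZl mulDZr scalerA exprS.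
Qed.

Lemma expJ_scale t A : expJ t A = expJ 1 (t *: A).
Proof.
apply: serP => n; rewrite /= /expc; case: ifP => // _; congr ((_ : Psi) n).
rewrite /exp_trunc; apply: eq_bigr => j _; rewrite pwZ scalerA expr1n.
by rewrite mul1r mulrC.
Qed.

Lemma dcurve_expJ_time A t : constc A -> Jminus A ->
  dcurve (fun s => expJ s A) t (mulD A (expJ t A)).
Proof.
move=> cA jA.
have dl : dcurve (fun s : C => s *: A) t A.
  split=> [|n k].
    have [p [f h]] := ord_in_ex A.
    by exists p, f; split=> [s|//]; apply: ord_inZ.
  rewrite (_ : (fun s => _) = (fun s : C => s * A n k)); last first.
    by apply/funext => s; rewrite !serZ.
  have h := @is_derive_mulE C _ _ t _ _ (@is_derive_idE C t) (@is_derive_cstE C (A n k) t).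
  by apply: (is_derive_eq h); rewrite mul1r mulr0 addr0.
have e : (fun s => expJ s A) = (fun s => expJ 1 (s *: A)).
  by apply/funext => s; exact: expJ_scale.
rewrite e (expJ_scale t).
apply: (dcurve_eq (@dcurve_expJ (fun s => s *: A) t A 1 _ _ dl)).
- by move=> s; apply: constcZ.
- by move=> s; apply: JminusZ.
- by rewrite scale1r.
Qed.

(** The commutator with ln D, as sigma_t is conjugation by e^(t ln D). *)
Definition adlnD A : Psi := cdiag (fun k => k%:~R * lnq) A.

Lemma dcurve_sigma A t : dcurve (fun s => sigma s A) t (sigma t (adlnD A)).
Proof.
split=> [|n k].
  have [p [f h]] := ord_in_ex A; exists p, f.
  by split=> [s|]; rewrite sigma_cdiag; apply: ord_cdiag => //; apply: ord_cdiag.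
have e s : qpow s ^ k = cexp (s * (k%:~R * lnq)).
  by rewrite qpow_exp /Defs.qpow; congr cexp; rewrite mulrAC mulrC mulrA.
rewrite (_ : (fun s => _) = (fun s => A n k * cexp (s * (k%:~R * lnq)))); last first.
  by apply/funext => s; rewrite sigmaE hhatE e mulrC.
have h := @is_derive_scaleE C (A n k) _ t _ (is_derive_cexp (k%:~R * lnq) t).
apply: (is_derive_eq h); rewrite sigmaE hhatE cdiagE e.
by rewrite mulrCA [A n k * _]mulrC mulrCA.
Qed.

Lemma adlnD_Jminus S : G0 S -> Jminus (adlnD S).
Proof.
move=> hS n hn; apply: J0P => k; rewrite cdiagE; move: hn.
rewrite le_eqVlt => /orP[/eqP <-|hn]; last by rewrite (G0_above hS)// mulr0.
rewrite (G0_0 hS) /oneJ -[monom 0 1 k]/(if k == 0 then 1 else 0 : C).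
by case: (k =P 0) => [->|_]; rewrite ?mul0r ?mulr0.
Qed.

(** Conjugation by S turns l + ln D into X + ln D, and exp t(l + ln D) = e^(t
    l) D^t because l commutes with D. *)
Lemma is_exp_dressed S Si l : G0 S -> G0 Si -> mulD S Si = oneD R -> mulD Si S = oneD R ->
  constc l -> Jminus l ->
  Jminus (mulD Si (mulD l S + adlnD S)) /\
  is_exp lnq (mulD Si (mulD l S + adlnD S)) (fun t => mulD Si (mulD (expJ t l) (sigma t S))).
Proof.
move=> hS hSi eS eSi cl jl; split.
  apply: JminusMl; first exact: G0_above.
  by apply: JminusD; [apply: JminusMr => //; exact: G0_above|exact: adlnD_Jminus].
split=> [t||t n k].
- by do 2?[apply: G0M => //]; [exact: G0_expJ|exact: G0_sigma].
- by rewrite expJ_0 sigma0 mul1D.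
have d := dcurve_mulD lnq (dcurve_cst Si t)
  (dcurve_mulD lnq (dcurve_expJ_time t cl jl) (dcurve_sigma S t)).
apply: dcurve_coef; apply: (dcurve_eq d); rewrite mulD0l add0r -!mulDA.
congr (mulD Si _).
rewrite sigmaM (mulDA lnq (sigma t S)) -sigmaM eS sigma1 mul1D sigmaD sigmaM (constc_sigma lnq t cl).
rewrite mulDDr (mulDA lnq (expJ t l)) -(constc_mulDC lnq cl (constc_expJ lnq t cl)).
by rewrite mulDA.
Qed.

(** In the equation A' = A sigma_t(X) a coefficient of A is driven by X in
    degrees at least its own and by the higher coefficients of A, so that a
    difference of two solutions has derivative 0. *)
Lemma exp_causal n X X' (A A' : C -> Psi) : Jminus X -> Jminus X' -> is_exp lnq X A -> is_exp lnq X' A' ->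
  (forall m, n < m -> X m = X' m) -> forall t, zero_above n (A t - A' t).
Proof.
move=> jX jX' [gA A0 dA] [gA' A'0 dA'] hX.
suff key (j : nat) m t : n < m -> 0 < m + j%:Z -> A t m = A' t m.
  by move=> t m hm; rewrite serB (key (absz m).+1)// ?subrr//; lia.
elim: j m t => [|j IH] m t hm hj.
  by rewrite (G0_above (gA t)) ?(G0_above (gA' t))//; lia.
apply: J0P => k; apply/eqP; rewrite -subr_eq0; apply/eqP.
have e s : mulD (A s) (sigma s X) m = mulD (A' s) (sigma s X') m.
  transitivity (mulD (A s) (sigma s X') m).
    apply/eqP; rewrite -subr_eq0 -serB -mulDBr -sigmaB.
    apply/eqP.
    apply: (mulD_bnd lnq (G0_above (gA s)) (sigma_bnd _ _ (_ : zero_above n (X - X')))).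
      by move=> i hi; rewrite serB hX// subrr.
    by rewrite add0r.
  apply: mulD_causalr; first exact: Jminus_sigma.
  by move=> i hi; apply: IH; lia.
have d0 s : is_derive s (1 : C) (fun s => A s m k + (- 1) * A' s m k) 0.
  have h := @is_derive_addE C _ _ s _ _ (dA s m k) (@is_derive_scaleE C (-1) _ s _ (dA' s m k)).
  by apply: (is_derive_eq h); rewrite e mulN1r subrr.
have := is_derive0_const d0 t; rewrite A0 A'0 !mulN1r subrr => <-.
by [].
Qed.

Lemma exp_unique X (A A' : C -> Psi) : Jminus X -> is_exp lnq X A -> is_exp lnq X A' -> A = A'.
Proof.
move=> jX hA hA'; apply/funext => t; apply: serP => n.
have := @exp_causal (n - 1) X X A A' jX jX hA hA' (fun _ _ => erefl) t n.
rewrite ltrBlDr ltrDl ltr01 serB => /(_ isT)/eqP.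
by rewrite subr_eq0 => /eqP.
Qed.

Lemma exp_E X (A : C -> Psi) : Jminus X -> is_exp lnq X A -> exp_ lnq X = A.
Proof.
move=> jX hA; apply: (exp_unique jX) => //.
by apply: (@xgetPex _ (fun=> 0) [set A | is_exp lnq X A]); exists A.
Qed.

Section Logarithm.
Variable alpha : C.
Hypothesis qpow_alpha : forall k : int, k != 0 -> qpow alpha ^ k != 1.
Hypothesis alpha_neq0 : alpha != 0.
Hypothesis lnq_neq0 : lnq != 0.

(** In the first degree in which the exponents differ, by x z^k, the
    exponentials differ by the integral of q^(s k) x z^k ds over [0, alpha],
    which is x z^k times alpha, if k = 0, or (q^(alpha k) - 1)/(k ln q). *)
Lemma exp_inj X X' (A A' : C -> Psi) : Jminus X -> Jminus X' -> is_exp lnq X A -> is_exp lnq X' A' ->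
  A alpha = A' alpha -> X = X'.
Proof.
move=> jX jX' hA hA' eA.
suff key (j : nat) n : 0 <= n + j%:Z -> X n = X' n.
  by apply: serP => n; apply: (key (absz n)); lia.
elim: j n => [|j IH] n hn; first by rewrite jX ?jX'//; lia.
have hX m : n < m -> X m = X' m by move=> hm; apply: IH; lia.
have hz := exp_causal jX jX' hA hA' hX.
have hA2 := hA; have hA2' := hA'.
case: hA hA' => gA A0 dA [gA' A'0 dA'].
apply: J0P => k; apply/eqP; rewrite -subr_eq0; apply/eqP.
set x := X n k - X' n k.
have e s : mulD (A s) (sigma s X) n - mulD (A' s) (sigma s X') n = hhat s ((X - X') n).
  have zX : zero_above n (sigma s (X - X')).
    by apply: sigma_bnd => i hi; rewrite serB hX// subrr.
  have -> : mulD (A' s) (sigma s X') n = mulD (A s) (sigma s X') n.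
    apply: mulD_causalr; first exact: Jminus_sigma.
    by move=> i hi; apply/eqP; rewrite eq_sym -subr_eq0 -serB hz.
  rewrite -serB -mulDBr -sigmaB -[n in LHS]add0r mulD_top//; last exact: G0_above.
  by rewrite (G0_0 (gA s)) mul1J hhat_exp0 sigmaE.
have d s : is_derive s (1 : C) (fun s => A s n k + (- 1) * A' s n k) (cexp (s * (k%:~R * lnq)) * x).
  have h := @is_derive_addE C _ _ s _ _ (dA s n k) (@is_derive_scaleE C (-1) _ s _ (dA' s n k)).
  apply: (is_derive_eq h).
  have := congr1 (fun f : J0 R => f k) (e s); rewrite serB hhatE serB serB => e'.
  rewrite mulN1r e' qpow_exp /Defs.qpow /x; congr (cexp _ * _).
  by rewrite mulrAC mulrC mulrA.
(* a primitive of q^(s k) *)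
pose G s : C := if k == 0 then s else (k%:~R * lnq)^-1 * cexp (s * (k%:~R * lnq)).
have dG s : is_derive s (1 : C) G (cexp (s * (k%:~R * lnq))).
  rewrite /G; case: (k =P 0) => [->|/eqP k0].
    by rewrite mul0r mulr0 cexp0; exact: (@is_derive_idE C s).
  have h := @is_derive_scaleE C (k%:~R * lnq)^-1 _ s _ (is_derive_cexp (k%:~R * lnq) s).
  by apply: (is_derive_eq h); rewrite mulrA mulVf ?mul1r// mulf_neq0// intr_eq0.
have d0 s : is_derive s (1 : C) (fun s => (A s n k + (- 1) * A' s n k) + (- x) * G s) 0.
  have h := @is_derive_addE C _ _ s _ _ (d s) (@is_derive_scaleE C (- x) _ s _ (dG s)).
  by apply: (is_derive_eq h); rewrite mulNr [x * _]mulrC subrr.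
have := is_derive0_const d0 alpha; rewrite A0 A'0 eA !mulN1r !subrr !add0r.
move=> /eqP; rewrite -subr_eq0 -mulrBr mulf_eq0 oppr_eq0 => /orP[/eqP//|].
rewrite /G; case: (k =P 0) => [_|/eqP k0].
  by rewrite subr0 (negPf alpha_neq0).
rewrite mul0r cexp0 -mulrBr mulf_eq0 invr_eq0 mulf_eq0 intr_eq0 (negPf k0) (negPf lnq_neq0) /=.
rewrite subr_eq0 => /eqP h; have := qpow_alpha k0; rewrite qpow_exp /Defs.qpow.
by rewrite -mulrA [_ * (alpha * _)]mulrCA h eqxx.
Qed.

Lemma log_E X (A : C -> Psi) L : Jminus X -> is_exp lnq X A -> G0 L -> A alpha = L -> log_ lnq alpha L = X.
Proof.
move=> jX hA hL eA.
have [jY eY] : [set Y | Jminus Y /\ exp_ lnq Y alpha = L] (log_ lnq alpha L).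
  apply: (@xgetPex _ 0 [set Y | Jminus Y /\ exp_ lnq Y alpha = L]).
  by exists X; split=> //; rewrite (exp_E jX hA).
move: (log_ lnq alpha L) jY eY => Y jY eY.
have [[B hB]|nB] := pselect (exists B : C -> Psi, is_exp lnq Y B).
  by apply: (exp_inj jY jX hB hA); rewrite eA -eY (exp_E jY hB).
have h0 : exp_ lnq Y = fun=> 0.
  by apply: xgetPN => B hB; apply: nB; exists B.
move: eY; rewrite h0 => e; case: hL => + _; rewrite -e /P0 ser0.
move=> /(congr1 (fun f : J0 R => f 0)); rewrite ser0 /oneJ -[monom 0 1 0]/(1 : C) => /eqP.
by rewrite eq_sym oner_eq0.
Qed.

Lemma cpowE X (A : C -> Psi) L beta : Jminus X -> is_exp lnq X A -> G0 L -> A alpha = L ->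
  cpow lnq alpha beta L = A (alpha * beta).
Proof. by move=> jX hA hL eA; rewrite /cpow (log_E jX hA hL eA) (exp_E jX hA). Qed.

End Logarithm.
End Exponential.

(** * Powers, Hamiltonians and their differentials *)

Section Powers.
Variables (R : realType) (lnq : CC R) (alpha : CC R).
Local Notation C := (CC R).
Local Notation Psi := (PsiD R).
Implicit Types (A B L S T U V W X Y Z : PsiD R).
Local Notation qpow := (qpow lnq).
Local Notation mulD := (mulD lnq).
Local Notation sigma := (sigma lnq).
Local Notation expJ := (expJ lnq).
Local Notation dress := (dress lnq alpha).
Hypothesis qpow_alpha : forall k : int, k != 0 -> qpow alpha ^ k != 1.
Hypothesis alpha_neq0 : alpha != 0.
Hypothesis lnq_neq0 : lnq != 0.

Definition undresses L Si : Prop :=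
  [/\ G0 Si, mulD (dress_op (dress L)) Si = oneD R & mulD Si (dress_op (dress L)) = oneD R].

Lemma undress_exists L : G0 L -> exists Si, undresses L Si.
Proof. by move=> hL; apply: G0_inv; apply: dress_op_G0; exact: (dressP qpow_alpha alpha_neq0 hL).1. Qed.

(** This is exp m(l + ln D) when l has constant coefficients. *)
Definition exp_lnD m l : Psi := mulD (expJ m%:R l) (Dpow R m).

Lemma cpowE_dressed L Si beta : G0 L -> undresses L Si ->
  cpow lnq alpha beta L = mulD Si (mulD (expJ (alpha * beta) (dress_log (dress L)))
    (sigma (alpha * beta) (dress_op (dress L)))).
Proof.
move=> hL [gSi eS eSi]; have [jT _] := dressP qpow_alpha alpha_neq0 hL.
have [jX hX] := @is_exp_dressed R lnq _ Si _ (dress_op_G0 jT) gSi eS eSi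
  (dress_log_constc (dress L)) (dress_log_Jminus jT).
rewrite (@cpowE R lnq alpha qpow_alpha alpha_neq0 lnq_neq0 _ _ L beta jX hX hL)//.
by rewrite -(dress_eq qpow_alpha alpha_neq0 hL) mulDA eSi mul1D.
Qed.

Lemma fracpowE L Si m : G0 L -> undresses L Si ->
  fracpow lnq alpha m L = mulD Si (mulD (exp_lnD m (dress_log (dress L))) (dress_op (dress L))).
Proof.
move=> hL hSi; rewrite /fracpow (cpowE_dressed _ hL hSi).
have -> : alpha * (m%:R / alpha) = m%:R by rewrite mulrC divfK.
by rewrite /exp_lnD -!mulDA; congr (mulD _ (mulD _ _)); rewrite (Dpow_sigma lnq m).
Qed.

Lemma hamiltonianE L m : G0 L ->
  hamiltonian lnq alpha m L = alpha / m%:R * Tr (exp_lnD m (dress_log (dress L))).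
Proof.
move=> hL; have [Si hSi] := undress_exists hL; have [_ eS _] := hSi.
rewrite /hamiltonian (fracpowE m hL hSi) TrCA -mulDA eS.
by rewrite mulD1.
Qed.

Lemma smap_exp_lnD N m : smap_on N (fun L => exp_lnD m (dress_log (dress L))).
Proof.
apply: smap_mulD; last exact: smap_cst.
apply: smap_expJ.
  exact: (@smap_cdiag R N (fun k => if k == 0 then 1 else 0) dress (smap_dress qpow_alpha alpha_neq0 N)).
by move=> L hL; apply: dress_log_Jminus; exact: (dressP qpow_alpha alpha_neq0 hL).1.
Qed.

Lemma smooth_hamiltonian m : smooth (hamiltonian lnq alpha m).
Proof.
apply/smoothP => N; have [_ s] := smap_exp_lnD N m.
apply: (smooth_on_ext _ (smooth_onZ (alpha / m%:R) (s 0 0))) => L hL _.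
by rewrite hamiltonianE.
Qed.

Lemma exp_lnD_commute b m l : constc l ->
  mulD (exp_lnD m l) (expJ b l) = mulD (expJ b l) (sigma alpha (exp_lnD m l)).
Proof.
move=> cl; have ce c := constc_expJ lnq c cl.
have -> : sigma alpha (exp_lnD m l) = exp_lnD m l.
  rewrite /exp_lnD sigmaM (constc_sigma lnq alpha (ce _)); congr (mulD _ _).
  by apply: constc_sigma => n k hk; rewrite /Dpow /monom /=; case: ifP => // _; rewrite /= (negPf hk).
rewrite /exp_lnD -mulDA (Dpow_sigma lnq m) (constc_sigma lnq _ (ce b)) !mulDA.
by rewrite (constc_mulDC lnq (ce m%:R) (ce b)).
Qed.

Section OnePower.
Variables (L Si : Psi) (m : nat).
Hypotheses (hL : G0 L) (hSi : undresses L Si).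
Let T := dress L.
Let S := dress_op T.
Let l := dress_log T.
Let e := expJ alpha l.
Let W := fracpow lnq alpha m L.

Let eL : mulD S L = mulD e (sigma alpha S).
Proof. exact: dress_eq. Qed.
Let eS : mulD S Si = oneD R. Proof. by case: hSi. Qed.
Let eSi : mulD Si S = oneD R. Proof. by case: hSi. Qed.
Let eL' : L = mulD Si (mulD e (sigma alpha S)).
Proof. by rewrite -eL mulDA eSi mul1D. Qed.
Let eW : W = mulD Si (mulD (exp_lnD m l) S).
Proof. exact: fracpowE. Qed.

Lemma fracpow_commute : mulD W L = mulD L (sigma alpha W).
Proof.
have eSs : mulD (sigma alpha S) (sigma alpha Si) = oneD R by rewrite -sigmaM eS sigma1.
rewrite eW -!mulDA eL; rewrite {1}eL' !sigmaM -!mulDA; congr (mulD Si _).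
rewrite (mulDA lnq (sigma alpha S)) eSs mul1D. 
rewrite (mulDA lnq (expJ m%:R l)) -/(exp_lnD m l) (mulDA lnq (sigma alpha (expJ m%:R l))) -sigmaM -/(exp_lnD m l).
by rewrite (mulDA lnq (exp_lnD m l)) (exp_lnD_commute alpha m (dress_log_constc T)) -mulDA.
Qed.

Variable Li : Psi.
Hypotheses (eLi : mulD L Li = oneD R) (eiL : mulD Li L = oneD R).

Lemma grad_left : mulD L (mulD Li W) = W.
Proof. by rewrite mulDA eLi mul1D. Qed.
Lemma grad_right : mulD (mulD Li W) L = sigma alpha W.
Proof. by rewrite -mulDA fracpow_commute mulDA eiL mul1D. Qed.

(** Differentiating S L = e^(alpha l) sigma_alpha(S) gives X L^-1 = alpha S^-1
    l' S + L sigma_alpha(Q) L^-1 - Q with Q = S^-1 S'. The last two terms are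
    orthogonal to W since W L = L sigma_alpha(W). *)
Lemma dress_variation X T' : Jminus X ->
  dcurve (fun t : C => dress (L + t *: X)) 0 T' ->
  Tr (mulD X (mulD Li W)) = alpha * Tr (mulD (dress_log T') (exp_lnD m l)).
Proof.
move=> jX dT; pose S' : Psi := cdiag (fun k => if k == 0 then 0 else 1) T'.
have gL (t : C) : G0 (L + t *: X) by apply: G0D => //; apply: JminusZ.
have e0 : L + (0 : C) *: X = L by rewrite scale0r addr0.
have dS : dcurve (fun t : C => dress_op (dress (L + t *: X))) 0 S'.
  apply: (dcurve_eq (dcurveD (dcurve_cst (oneD R) 0) (dcurve_cdiag _ dT))).
  by rewrite add0r.
have dl : dcurve (fun t : C => dress_log (dress (L + t *: X))) 0 (dress_log T') := dcurve_cdiag _ dT.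
have de := @dcurve_expJ R lnq _ 0 _ alpha (fun t => dress_log_constc _)
  (fun t => dress_log_Jminus (dressP qpow_alpha alpha_neq0 (gL t)).1) dl.
have d1 := dcurve_mulD lnq dS (dcurve_line L X).
have dsS : dcurve (fun t : C => sigma alpha (dress_op (dress (L + t *: X)))) 0 (sigma alpha S').
  rewrite sigma_cdiag (_ : (fun t => _) =
    (fun t : C => cdiag (fun k => qpow alpha ^ k) (dress_op (dress (L + t *: X))))).
    exact: dcurve_cdiag.
  by apply/funext => t; rewrite sigma_cdiag.
have d2 := dcurve_mulD lnq de dsS.
have ee : (fun t : C => mulD (dress_op (dress (L + t *: X))) (L + t *: X)) =
    (fun t : C => mulD (expJ alpha (dress_log (dress (L + t *: X))))
                       (sigma alpha (dress_op (dress (L + t *: X))))).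
  by apply/funext => t; exact: dress_eq.
rewrite ee in d1; have := dcurve_unique d1 d2; rewrite e0 -/T -/S -/l -/e.
rewrite mulDZl -mulDA -eL => hX.
have {hX}hX : mulD S X = alpha *: mulD (dress_log T') (mulD S L) + mulD e (sigma alpha S') - mulD S' L.
  by rewrite -hX [mulD S' L + _]addrC addrK.
have eLs : mulD Si e = mulD L (sigma alpha Si).
  by rewrite eL' -!mulDA -sigmaM eS sigma1 mulD1.
have hXL : mulD X Li = alpha *: mulD Si (mulD (dress_log T') S)
   + mulD L (mulD (sigma alpha (mulD Si S')) Li) - mulD Si S'.
  have -> : X = mulD Si (mulD S X) by rewrite mulDA eSi mul1D.
  rewrite hX mulDBr mulDDr mulDZr mulDBl mulDDl mulDZl -!mulDA eLi mulD1.
  congr (alpha *: _ + _ - _); last by rewrite mulD1.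
  by rewrite mulDA eLs sigmaM -!mulDA.
rewrite mulDA hXL mulDBl mulDDl mulDZl TrB TrD TrZ.
have -> : Tr (mulD (mulD L (mulD (sigma alpha (mulD Si S')) Li)) W) = Tr (mulD (mulD Si S') W).
  rewrite -!mulDA TrC -mulDA -[mulD (mulD Li W) L]mulDA fracpow_commute (mulDA lnq Li) eiL mul1D.
  by rewrite -sigmaM Tr_sigma mulDA.
rewrite addrK; congr (alpha * _).
rewrite eW -!mulDA (mulDA lnq S) eS mul1D TrC -!mulDA eS mulD1.
by [].
Qed.

Lemma is_grad_hamiltonian : (0 < m)%N -> is_grad lnq (hamiltonian lnq alpha m) L (mulD Li W).
Proof.
move=> m0 X jX.
have [T' dT] := smap_dcurve (smap_dress qpow_alpha alpha_neq0) hL jX.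
have gL (t : C) : G0 (L + t *: X) by apply: G0D => //; apply: JminusZ.
have e0 : L + (0 : C) *: X = L by rewrite scale0r addr0.
have dl : dcurve (fun t : C => dress_log (dress (L + t *: X))) 0 (dress_log T') := dcurve_cdiag _ dT.
have de := @dcurve_expJ R lnq _ 0 _ m%:R (fun t => dress_log_constc _)
  (fun t => dress_log_Jminus (dressP qpow_alpha alpha_neq0 (gL t)).1) dl.
have dY := dcurve_mulD lnq de (dcurve_cst (Dpow R m) 0).
have dc := @is_derive_scaleE C (alpha / m%:R) _ 0 _ (dcurve_coef 0 0 dY).
rewrite (_ : (fun t => _) = (fun t : C => alpha / m%:R *
    mulD (expJ m%:R (dress_log (dress (L + t *: X)))) (Dpow R m) 0 0)); last first.
  by apply/funext => t; rewrite hamiltonianE.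
apply: (is_derive_eq dc).
rewrite [RHS](dress_variation jX dT) mulD0r addr0 e0 mulDZl. 
have fin (B : Psi) : alpha / m%:R * (m%:R *: B) 0 0 = alpha * Tr B.
  rewrite (serZ m%:R B 0) (serZ m%:R (B 0) 0) scaleCE mulrA divfK// pnatr_eq0 -lt0n.
  exact: m0.
by rewrite fin -mulDA.
Qed.

End OnePower.

Lemma G0M_1 A B : G0 A -> G0 B -> mulD A B (-1) = A (-1) + B (-1).
Proof.
move=> hA hB; have hA' := G0B hA (oneG0 R); have hB' := G0B hB (oneG0 R).
have -> : mulD A B = A + B - oneD R + mulD (A - oneD R) (B - oneD R).
  have ac (a b o p : Psi) : p = a + b - o + (p - a - (b - o)).
    by rewrite -[a + b - o]addrA [RHS]addrC -[p - a - (b - o) + _]addrA [- (b - o) + _]addrC addrK subrK.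
  by rewrite mulDBl mul1D mulDBr mulD1; exact: ac.
have h2 : mulD (A - oneD R) (B - oneD R) (-1) = 0.
  by apply: (mulD_bnd lnq ((JminusP _).1 hA') ((JminusP _).1 hB')).
by rewrite serD h2 addr0 serB serD ofJ0E /= subr0.
Qed.

Lemma expJ_1 b l : Jminus l -> expJ b l (-1) = b *: l (-1).
Proof.
move=> jl; rewrite -(@exp_truncE _ _ b l 2)// /exp_trunc !big_ord_recl big_ord0 addr0.
by rewrite serD !serZ pw1 ofJ0E scaler0 add0r expr1 divr1.
Qed.

(** In degree -1 all products are sums. With T the dressing series, the
    coefficient of z^k in degree -1 is (q^(alpha k) - 1) T_k in L and (q^k -
    1) T_k in L^(1/alpha), or alpha T_0 and T_0 for k = 0. *)
Lemma fracpow1_surj w : (forall k : int, k != 0 -> qpow k%:~R != 1) ->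
  exists a, forall L, G0 L -> L (-1) = a -> P0 (fracpow lnq alpha 1 L) = w.
Proof.
move=> qpow_int.
have q1 k : qpow 1 ^ k = qpow k%:~R by rewrite qpow_exp mulr1.
exists (diag (fun k => if k == 0 then alpha else (qpow alpha ^ k - 1) / (qpow 1 ^ k - 1)) w) => L hL eL.
have [Si hSi] := undress_exists hL; have [gSi eS _] := hSi.
have [jT _] := dressP qpow_alpha alpha_neq0 hL.
have gS := dress_op_G0 jT; have jl := dress_log_Jminus jT.
have gp b := G0_sigma lnq b gS; have ge b := G0_expJ lnq b jl.
have cf b k : mulD Si (mulD (expJ b (dress_log (dress L))) (sigma b (dress_op (dress L)))) (-1) k =
    (if k == 0 then b else qpow b ^ k - 1) * dress L (-1) k.
  rewrite !G0M_1//; last exact: G0M.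
  have -> : Si (-1) = - dress_op (dress L) (-1).
    apply/eqP; rewrite -addr_eq0 addrC -G0M_1// eS ofJ0E.
    by [].
  rewrite expJ_1// !serD serN serZ sigmaE hhatE scaleCE.
  rewrite -[dress_log (dress L) (-1) k]/((if k == 0 then 1 else 0) * dress L (-1) k).
  have -> : dress_op (dress L) (-1) k = (if k == 0 then 0 else 1) * dress L (-1) k.
    by rewrite /dress_op !serD ofJ0E /= add0r.
  case: (k =P 0) => _; first by rewrite !mul0r mulr0 oppr0 addr0 add0r mul1r.
  by rewrite !mul0r mulr0 add0r mul1r mulrBl mul1r addrC.
have eA : alpha * (1%:R / alpha) = 1 by rewrite mulrC divfK.
apply: J0P => k.
have : L (-1) k = (if k == 0 then alpha else qpow alpha ^ k - 1) * dress L (-1) k.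
  rewrite -cf -(dress_eq qpow_alpha alpha_neq0 hL) (mulDA lnq Si).
  by case: hSi => _ _ ->; rewrite mul1D.
rewrite eL diagE => ew.
rewrite /P0 /fracpow mulDpow sub0r (cpowE_dressed _ hL hSi) eA cf.
move: ew; case: (k =P 0) => [_|/eqP k0] ew.
  by rewrite mul1r; exact: (mulfI alpha_neq0 (esym ew)).
have hq : qpow 1 ^ k - 1 != 0 by rewrite subr_eq0 q1 qpow_int.
have ha : qpow alpha ^ k - 1 != 0 by rewrite subr_eq0 qpow_alpha.
have fin (x y z d : C) : x != 0 -> y != 0 -> x / y * z = x * d -> y * d = z.
  move=> x0 y0 e; have -> : d = z / y.
    by apply: (mulfI x0); rewrite -e -mulrA [_^-1 * _]mulrC.
  by rewrite mulrC divfK.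
exact: fin ha hq ew.
Qed.

End Powers.

(** * The Lax equations and uniqueness *)

Section Lax.
Variables (R : realType) (lnq : CC R) (alpha : CC R).
Local Notation C := (CC R).
Implicit Types (A B L U V W X Y Z : PsiD R).
Local Notation qpow := (qpow lnq).
Local Notation mulD := (mulD lnq).
Local Notation sigma := (sigma lnq).
Local Notation pair := (pair lnq).
Hypothesis qpow_int : forall k : int, k != 0 -> qpow k%:~R != 1.
Hypothesis qpow_alpha : forall k : int, k != 0 -> qpow alpha ^ k != 1.
Hypothesis alpha_neq0 : alpha != 0.
Hypothesis lnq_neq0 : lnq != 0.
Local Notation M0 := (explicit_ops lnq alpha).
Local Notation bracket0 := (bracket0 lnq alpha).

Lemma is_grad_pair L V : G0 L -> is_grad lnq (fun A => pair A V) L V.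
Proof.
move=> hL X jX; have h := smooth_is_derive (smooth_pair lnq V) hL jX.
by rewrite dirD_pair in h.
Qed.

Lemma grad_power L m : G0 L -> (0 < m)%N ->
  let W := fracpow lnq alpha m L in
  exists G, [/\ is_grad lnq (hamiltonian lnq alpha m) L G, mulD L G = W,
    mulD G L = sigma alpha W & mulD W L = mulD L (sigma alpha W)].
Proof.
move=> hL m0 W; have [Si hSi] := undress_exists qpow_alpha alpha_neq0 hL.
have [Li [_ e1 e2]] := G0_inv lnq hL.
exists (mulD Li W); split.
- exact: (is_grad_hamiltonian qpow_alpha alpha_neq0 lnq_neq0 hL hSi e1 e2 m0).
- exact: grad_left.
- exact: (grad_right qpow_alpha alpha_neq0 lnq_neq0 m hL hSi e2).
- exact: (fracpow_commute qpow_alpha alpha_neq0 lnq_neq0 m hL hSi).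
Qed.

(** By the Lax relation the Hamiltonian field of H_m and the commutator have
    the same pairing with every V. *)
Lemma bracket0_lax : lax lnq alpha bracket0.
Proof.
move=> m m0; split; first exact: smooth_hamiltonian.
move=> L hL; have [G [gG e1 e2 e3]] := grad_power hL m0.
set W := fracpow lnq alpha m L in e1 e2 e3 *.
have ec : commutator lnq alpha (Pgeq0 W) L = hamfield lnq alpha M0 L G.
  apply: PsiP => n k; rewrite -!(pair_dual lnq) -star_hamfield (star_lax _ _ e1 e2 e3).
  have [mu hmu] := explicit_lax_rel qpow_alpha.
  have [-> ->] := hmu (P0 W); rewrite !pair_const (TrC lnq L).
  by rewrite subrr addr0.
rewrite ec; have hj := hamfieldJ qpow_alpha G hL; split=> // psi ss.
have sH := smooth_hamiltonian qpow_alpha alpha_neq0 lnq_neq0 m.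
rewrite (bracket0_form qpow_alpha sH ss hL gG (gradP lnq ss hL)).
rewrite (star_gradr qpow_alpha G ss hL (gradP lnq ss hL)).
exact: smooth_is_derive.
Qed.

(** Test the first Lax equation with the linear functionals L -> <L, V> at a
    probe with P_0 L^(1/alpha) = w: the two terms by which the bracket differs
    from the commutator must cancel for all V. *)
Lemma lax_lax_rel (M : opmatrix R) (B : bracket R) : of_star_form lnq alpha M B -> lax lnq alpha B ->
  lax_rel lnq alpha M.
Proof.
move=> hB hl; suff /choice[mu hmu] : forall w, exists c : C,
    f1 lnq alpha M w (hhat lnq alpha w) - 2^-1 *: w = c *: oneJ R /\
    f2 lnq alpha M w (hhat lnq alpha w) - 2^-1 *: hhat lnq alpha w = c *: oneJ R by exists mu.
move=> w; have [a ha] := fracpow1_surj qpow_alpha alpha_neq0 lnq_neq0 w qpow_int.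
have hL := probe_G0 a.
have p1 : probe a (-1) = a by rewrite /probe !serD ofJ0E /= add0r addr0.
have ew := ha _ hL p1; have [G [gG e1 e2 e3]] := grad_power hL (isT : (0 < 1)%N).
rewrite -[w in X in exists c, X = _ /\ _]ew -ew; apply: (probe_const qpow_int (a := a)) => V.
have [sH hV] := hl 1%N isT; have [jV dV] := hV _ hL.
have e := is_derive_unique (dV _ (smooth_pair lnq V))
  (is_grad_pair V hL jV).
have e4 := star_lax M V e1 e2 e3.
rewrite -(hB _ _ sH (smooth_pair lnq V) _ _ _ hL gG (is_grad_pair V hL)) e in e4.
move/eqP: e4; rewrite -subr_eq0 opprD addrA subrr add0r oppr_eq0 subr_eq0 => /eqP.
exact.
Qed.

Lemma bracket0_lax_poisson : lax_poisson_bracket lnq alpha bracket0.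
Proof.
split; first exact: bracket0_poisson.
exists M0; split.
- exact: explicit_admissible.
- exact: bracket0_form.
- by apply: wd_rel_well_defined; [exact: explicit_admissible|exact: explicit_wd_rel].
- exact: bracket0_lax.
Qed.

Lemma lax_poisson_unique (B : bracket R) : lax_poisson_bracket lnq alpha B ->
  forall phi psi : functional R, smooth phi -> smooth psi ->
  forall L, G0 L -> B phi psi L = bracket0 phi psi L.
Proof.
move=> [_ [M [aM fM wM lM]]] phi psi sp ss L hL.
have gp := gradP lnq sp hL; have gs := gradP lnq ss hL.
rewrite (fM _ _ sp ss _ _ _ hL gp gs) (bracket0_form qpow_alpha sp ss hL gp gs).
apply: star_unique => //.
- exact: explicit_admissible.
- exact: (well_defined_wd_rel qpow_int aM wM).
- exact: (lax_lax_rel fM lM).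
- exact: explicit_wd_rel.
- exact: explicit_lax_rel.
Qed.

End Lax.

Section Hypotheses.
Variables (R : realType) (q lnq alpha : CC R).
Local Notation C := (CC R).
Hypotheses (hq0 : 0 < `|q|) (hq1 : `|q| < 1) (hln : is_ln q lnq) (halpha : generic lnq alpha).

Let qpow1 : qpow lnq 1 = q.
Proof. by case: hln => e _; rewrite /qpow mul1r. Qed.

Lemma qpow_int_neq1 (k : int) : k != 0 -> qpow lnq k%:~R != 1.
Proof.
move=> k0; rewrite -[k%:~R]mulr1 -qpow_exp qpow1; apply/eqP => e.
have nz : `|q ^ k| = `|q| ^ k.
  by case: (k) => n; [rewrite -!exprnP normrX | rewrite !NegzE -!exprnN normfV normrX].
have := congr1 (fun z : C => `|z|) e; rewrite nz normr1 => /eqP.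
by rewrite pexprz_eq1// (negPf k0) (lt_eqF hq1).
Qed.

Lemma lnq_neq0 : lnq != 0.
Proof.
apply/eqP => e; have := qpow1; rewrite /qpow e mulr0 cexp0 => eq.
by move: hq1; rewrite -eq normr1 ltxx.
Qed.

Let two_pi_i : C := Complex 0 (2 * pi).
Let two_pi_i_neq0 : two_pi_i != 0.
Proof.
apply/eqP => /(congr1 (fun z : C => complex.Im z)) /= /eqP.
by rewrite mulf_eq0 pnatr_eq0 /= gt_eqF ?pi_gt0.
Qed.

Lemma generic_neq0 : alpha != 0.
Proof.
apply/eqP => e; have := halpha 0; rewrite e !mul0r rmorph0.
by rewrite eqxx.
Qed.

(** By the definition of generic: q^(alpha k) = 1 means that k alpha ln q is
    an integral multiple of 2 pi i. *)
Lemma qpow_generic (k : int) : k != 0 -> qpow lnq alpha ^ k != 1.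
Proof.
move=> k0; rewrite qpow_exp; apply/eqP => /cexp_eq1[n en].
have kC : k%:~R != 0 :> C by rewrite intr_eq0.
have := halpha (n%:~R / k%:~R); rewrite fmorph_div !rmorph_int -/two_pi_i.
rewrite -subr_eq0; apply/negP; rewrite negbK subr_eq0; apply/eqP.
apply: (mulfI kC); rewrite mulrA mulrA en -/two_pi_i.
by rewrite mulfK// mulrC divfK.
Qed.

End Hypotheses.

Theorem theorem3p7 (R : realType) (q lnq alpha : CC R)
    (hq0 : 0 < `|q|) (hq1 : `|q| < 1) (hln : is_ln q lnq)
    (halpha : generic lnq alpha) :
  exists B : bracket R,
    [/\ lax_poisson_bracket lnq alpha B,
        forall B' : bracket R, lax_poisson_bracket lnq alpha B' ->
          forall phi psi : functional R, smooth phi -> smooth psi ->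
          forall L : PsiD R, G0 L -> B' phi psi L = B phi psi L
      & of_star_form lnq alpha (explicit_ops lnq alpha) B].
Proof.
have qpow_int := qpow_int_neq1 hq1 hln.
have qpow_alpha := qpow_generic halpha.
have alpha_neq0 := generic_neq0 halpha.
have lnq_neq0 := lnq_neq0 hq1 hln.
exists (bracket0 lnq alpha); split.
- exact: bracket0_lax_poisson.
- exact: lax_poisson_unique.
- exact: bracket0_form.
Qed.
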